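(* Let $S$ be a connected analytic submanifold of $\mathbb{R}^{n-1}$ and let $P\in\mathbb{R}[\mathbf{x};x_n]$ have degree $d_n$ in $x_n$. Assume $P$ never nullifies on $S$, and that $\mathrm{Disc}^{d_n}_{x_n}(P)$ is not the zero polynomial and is order-invariant on $S$. Then for each $\mathbf{s}\in S$ there exists a connected neighbourhood $N_{\mathbf{s}}$ of $\mathbf{s}$ in $S$, open in $S$, such that $P$ is projectively delineable on $N_{\mathbf{s}}$ and $H^{d_n}(P)$ is order-invariant on each projective $P$-section over $N_{\mathbf{s}}$.
   Context: Write $\mathbf{x}=(x_1,\dots,x_{n-1})$; $E_{\mathbf{x}_0}P$ is the polynomial in $x_n$ obtained by substituting $\mathbf{x}_0$ for $\mathbf{x}$. ''$P$ never nullifies on $S$'' means $E_{\mathbf{x}}P$ is not the zero polynomial for every $\mathbf{x}\in S$. $\mathrm{Disc}^{d}_{x_n}(P)\in\mathbb{R}[\mathbf{x}]$ is the discriminant of $P$ with respect to $x_n$ computed for formal degree $d$, so that $E_{\mathbf{x}}\mathrm{Disc}^d_{x_n}(P)$ is the discriminant of $E_{\mathbf{x}}P$ regarded as a polynomial of formal degree $d$. For a polynomial $f$ in $m$ variables and $v\in\mathbb{R}^m$, $\mathrm{ord}(f,v)$ is the least total order of a partial derivative of $f$ that is nonzero at $v$; $f$ is order-invariant on a set if $\mathrm{ord}(f,\cdot)$ is constant on it. $\mathbb{RP}^1$ is the quotient of $\mathbb{R}^2\setminus\{(0,0)\}$ by proportionality with the quotient topology; $(u:v)$ is the class of $(u,v)$.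 $H^{d}(P)(\mathbf{x},x_n,y)=\sum_kc_k(\mathbf{x})x_n^ky^{d-k}$ for $P=\sum_kc_k(\mathbf{x})x_n^k$. A projective root of a binary form $g(u,v)$ is $(u_0:v_0)$ with $g(u_0,v_0)=0$, with multiplicity (for $g\ne0$) the largest $m$ such that $(v_0u-u_0v)^m$ divides $g$. $Z_{\mathbb{RP}^1}(P,T)=\{(\mathbf{x},(x_n:y))\in T\times\mathbb{RP}^1: H^{d_n}(P)(\mathbf{x},x_n,y)=0\}$. $P$ is projectively delineable on $T\subseteq\mathbb{R}^{n-1}$ if there are $k\in\mathbb{N}$ and continuous $\theta_1,\dots,\theta_k:T\to\mathbb{RP}^1$ such that $Z_{\mathbb{RP}^1}(P,T)$ is the disjoint union of their graphs and, for each $l$, there is $m_l\ge1$ with $\theta_l(\mathbf{x})$ a projective root of $E_{\mathbf{x}}H^{d_n}(P)$ of multiplicity $m_l$ for all $\mathbf{x}\in T$; the graphs of the $\theta_l$ are the projective $P$-sections over $T$. ''$H^{d_n}(P)$ is order-invariant on the projective $P$-section of $\theta_l$'' means $\mathbf{x}\mapsto\mathrm{ord}(H^{d_n}(P),(\mathbf{x},u,v))$ is constant on $T$, where $(u,v)$ is any representative of $\theta_l(\mathbf{x})$. *)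

(* Defs.v *)
From HB Require Import structures.
From mathcomp Require Import all_boot all_order all_algebra.
From mathcomp Require Import reals.
From mathcomp Require Import mpoly.

Set Implicit Arguments.
Unset Strict Implicit.
Unset Printing Implicit Defensive.

Import Order.TTheory GRing.Theory Num.Theory.
Local Open Scope ring_scope.

Section Defs.
Variable R : realType.

Definition near_pt (k : nat) (p q : 'I_k -> R) (r : R) : Prop :=
  forall i, `|q i - p i| < r.

Definition rel_open (k : nat) (T U : ('I_k -> R) -> Prop) : Prop :=
  (forall q, U q -> T q) /\
  forall p, U p -> exists2 r : R, 0 < r &
    forall q, T q -> near_pt p q r -> U q.

Definition open_set (k : nat) (U : ('I_k -> R) -> Prop) : Prop :=
  rel_open (fun _ => True) U.

Definition connected_set (k : nat) (T : ('I_k -> R) -> Prop) : Prop :=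
  forall A B : ('I_k -> R) -> Prop,
    rel_open T A -> rel_open T B ->
    (forall q, T q -> A q \/ B q) ->
    (forall q, ~ (A q /\ B q)) ->
    (exists q, A q) -> (exists q, B q) -> False.

Definition box_sum (k N : nat) (c : ('I_k -> nat) -> R) (a x : 'I_k -> R)
    : R :=
  \sum_(f : {ffun 'I_k -> 'I_N})
     c (fun i => nat_of_ord (f i)) * \prod_i (x i - a i) ^+ f i.

Definition box_abs_sum (k N : nat) (c : ('I_k -> nat) -> R) (a x : 'I_k -> R)
    : R :=
  \sum_(f : {ffun 'I_k -> 'I_N})
     `|c (fun i => nat_of_ord (f i)) * \prod_i (x i - a i) ^+ f i|.

Definition analytic_at (k : nat) (f : ('I_k -> R) -> R) (a : 'I_k -> R)
    : Prop :=
  exists c : ('I_k -> nat) -> R, exists2 r : R, 0 < r &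
    forall x, near_pt a x r ->
      (exists M : R, forall N, box_abs_sum N c a x <= M) /\
      (forall e : R, 0 < e -> exists N0 : nat, forall N, (N0 <= N)%N ->
          `|box_sum N c a x - f x| < e).

Definition analytic_map_on (k : nat) (U : ('I_k -> R) -> Prop)
    (phi : ('I_k -> R) -> 'I_k -> R) : Prop :=
  forall i a, U a -> analytic_at (fun x => phi x i) a.

Definition analytic_submanifold (k : nat) (S : ('I_k -> R) -> Prop) : Prop :=
  forall p, S p ->
  exists d : nat, exists U V : ('I_k -> R) -> Prop,
  exists phi psi : ('I_k -> R) -> 'I_k -> R,
    [/\ open_set U /\ open_set V, U p,
        (forall x, U x -> V (phi x)) /\ (forall y, V y -> U (psi y)),
        ((forall x, U x -> psi (phi x) = x) /\ (forall y, V y -> phi (psi y) = y)) /\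
        (analytic_map_on U phi /\ analytic_map_on V psi) &
        forall x, U x -> (S x <-> forall i : 'I_k, (d <= i)%N -> phi x i = 0)].

(* Polynomials: P in R[x][x_n], x = (x_1,...,x_{m}), m = n-1.         *)

Definition Eval (m : nat) (x : 'I_m -> R) (P : {poly {mpoly R[m]}}) : {poly R} :=
  map_poly (meval x) P.

(* D is Disc^d_{x_n}(P) for the formal degree d = deg_{x_n} P (which  *)
(* is the actual degree, so the leading coefficient is nonzero and D  *)
(* is uniquely determined):                                           *)
(*   lc(P) * Disc(P) = (-1)^(d(d-1)/2) Res_{d,d-1}(P, P')             *)
Definition is_disc (m : nat) (P : {poly {mpoly R[m]}}) (D : {mpoly R[m]})
    : Prop :=
  let d := (size P).-1 in
  lead_coef P * D = (-1) ^+ (d * d.-1)./2 * resultant P P^`().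

Definition ord_is (k : nat) (f : {mpoly R[k]}) (v : 'I_k -> R) (o : nat) : Prop :=
  (exists2 a : 'X_{1..k}, mdeg a = o & (f^`M[a]).@[v] != 0) /\
  (forall a : 'X_{1..k}, (mdeg a < o)%N -> (f^`M[a]).@[v] = 0).

(* f is order-invariant on T, i.e. ord(f, .) (with values in N u {oo}) *)
(* is constant on T.                                                  *)
Definition order_invariant (k : nat) (f : {mpoly R[k]}) (T : ('I_k -> R) -> Prop)
    : Prop :=
  forall v w, T v -> T w -> forall o, ord_is f v o <-> ord_is f w o.

Definition pt3 (m : nat) (x : 'I_m -> R) (u v : R) : 'I_(m + 2) -> R :=
  fun i => match split i with
           | inl j => x j
           | inr j => if j == ord0 then u else v
           end.

Definition liftc (m : nat) (c : {mpoly R[m]}) : {mpoly R[m + 2]} :=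
  c \mPo [tuple 'X_(lshift 2 j) | j < m].

Definition var_xn (m : nat) : 'I_(m + 2) := rshift m (ord0 : 'I_2).
Definition var_y (m : nat) : 'I_(m + 2) := rshift m (ord_max : 'I_2).

Definition homogH (m d : nat) (P : {poly {mpoly R[m]}}) : {mpoly R[m + 2]} :=
  \sum_(k < d.+1)
     liftc P`_k * 'X_(var_xn m) ^+ k * 'X_(var_y m) ^+ (d - k).

Definition Eval_form (m : nat) (x : 'I_m -> R) (H : {mpoly R[m + 2]})
    : {mpoly R[2]} :=
  H \mPo [tuple match split i with
                | inl j => (x j)%:MP
                | inr j => 'X_j
                end | i < m + 2].

Definition lin_form (u0 v0 : R) : {mpoly R[2]} :=
  v0 *: 'X_(ord0 : 'I_2) - u0 *: 'X_(ord_max : 'I_2).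

Definition mdivides (k : nat) (a b : {mpoly R[k]}) : Prop :=
  exists q : {mpoly R[k]}, b = a * q.

Definition proj_root_mult (g : {mpoly R[2]}) (w : R * R) (mu : nat) : Prop :=
  [/\ g != 0,
      g.@[fun i : 'I_2 => if i == ord0 then w.1 else w.2] = 0,
      mdivides (lin_form w.1 w.2 ^+ mu) g &
      ~ mdivides (lin_form w.1 w.2 ^+ mu.+1) g].

(* RP^1 = (R^2 \ {0}) / proportionality, with the quotient topology.  *)
(* A map T -> RP^1 is given by a representative map T -> R^2 \ {0}.   *)

Definition nonzero2 (w : R * R) : Prop := w <> (0, 0).

Definition proj_eq (w w' : R * R) : Prop := w.1 * w'.2 = w'.1 * w.2.

(* W is an open subset of R^2 \ {0} saturated for proportionality,    *)
(* i.e. the preimage of an open subset of RP^1.                       *)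
Definition sat_open (W : R * R -> Prop) : Prop :=
  (forall w, W w -> nonzero2 w) /\
  (forall w w', W w -> nonzero2 w' -> proj_eq w w' -> W w') /\
  (forall w, W w -> exists2 r : R, 0 < r &
     forall w', `|w'.1 - w.1| < r -> `|w'.2 - w.2| < r -> W w').

Definition proj_continuous (m : nat) (T : ('I_m -> R) -> Prop)
    (theta : ('I_m -> R) -> R * R) : Prop :=
  forall W, sat_open W -> rel_open T (fun x => T x /\ W (theta x)).

Definition proj_delineable_by (m : nat) (P : {poly {mpoly R[m]}})
    (T : ('I_m -> R) -> Prop) (k : nat)
    (theta : 'I_k -> ('I_m -> R) -> R * R) : Prop :=
  let H := homogH (size P).-1 P in
  [/\ (forall l x, T x -> nonzero2 (theta l x)),
      (forall l, proj_continuous T (theta l)),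
      (forall x w, T x -> nonzero2 w ->
         ((Eval_form x H).@[fun i : 'I_2 => if i == ord0 then w.1 else w.2] = 0
          <-> exists l, proj_eq (theta l x) w)),
      (forall l l' x, T x -> l != l' -> ~ proj_eq (theta l x) (theta l' x)) &
      (forall l, exists2 mu : nat, (1 <= mu)%N &
         forall x, T x -> proj_root_mult (Eval_form x H) (theta l x) mu)].

(* H is order-invariant on the projective section of theta over T:   *)
(* x |-> ord(H, (x, u, v)), (u, v) the representative theta x, is     *)
(* constant on T (ord valued in N u {oo}).                            *)
Definition order_invariant_section (m : nat) (H : {mpoly R[m + 2]})
    (T : ('I_m -> R) -> Prop) (theta : ('I_m -> R) -> R * R) : Prop :=
  forall x y, T x -> T y -> forall o,
    ord_is H (pt3 x (theta x).1 (theta x).2) o <->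
    ord_is H (pt3 y (theta y).1 (theta y).2) o.

End Defs.

(* Main.v *)
(* Near s only the set where D has the same order e as at s matters; S enters
   through its local connectedness.  The substitution x_n = l + 1/z, with
   P(s, l) <> 0, turns P into a polynomial F in z whose leading coefficient does
   not vanish near s, so that all projective roots become finite.

   Restrict F to the lines p + t v with ord(D, p) = e and v near a direction v0
   along which D has exact order e at s.  The discriminant of the restriction is
   t^e h with h(0) bounded below uniformly in (p, v), and the roots are Puiseux
   series zeta_i in t.  The key point is that their coefficients and the leading
   coefficients of the zeta_i - zeta_j are bounded, respectively bounded below,
   uniformly in (p, v).  Indeed the Vandermonde matrix V of the roots has
   determinant t^k h; the diagonal matrices diag(x) such that t^m V diag(x)
   V^-1 has bounded coefficients form an algebra.  A characteristic polynomial
   argument shows that an integral x in it has a bounded constant term,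
   and a uniform saturation of the row lattice of V followed by the lifting of
   idempotents shows that it contains uniformly bounded approximations of the
   idempotents of the split algebra.

   At t = 0 this keeps distinct complex roots of F(p, .) at a distance >= c.
   As multiplicities are upper semicontinuous and sum to the degree, every root
   of F(s, .) is continued by exactly one root of F(p, .) of the same
   multiplicity, and it is real if and only if it starts real.  Likewise,
   if F restricted to such a line has order < k at a root of F(p, .), then one
   of its Taylor coefficients of degree < k there is >= c in absolute value;
   so the order of F is locally constant along each root. *)

Require Import Defs.
From HB Require Import structures.
From mathcomp Require Import all_boot all_order all_fingroup all_algebra all_solvable all_field.
From mathcomp Require Import boolp reals complex.
From mathcomp Require Import ring lra zify.
From mathcomp Require Import mpoly.
From mathcomp Require classical_sets.

Set Implicit Arguments.
Unset Strict Implicit.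
Unset Printing Implicit Defensive.
Import Order.TTheory GRing.Theory Num.Theory.
Local Open Scope ring_scope.

(** * Formal power series *)

(** The Puiseux roots are chosen separately for each [(p, v)], with no continuity in the parameters,
    so compactness does not apply to them. All series are therefore formal, and what is controlled
    is the boundedness of each single coefficient over an arbitrary index type [Om]. The obstacle is
    that bounded coefficients of F bound only the constant terms of its roots. To reach the next
    coefficient one would subtract from each root its constant term and divide by t, but these
    constants differ from root to root, so the result need not satisfy an integral equation with
    bounded coefficients. Idempotents of the split algebra turn this subtraction into an operation
    inside an algebra with bounded structure; they have denominators, which is why powers of t are
    allowed there. Lines are used because D restricted to them is a power of t times a unit, within
    reach of one-variable Puiseux series. Directions close to a single [v0] suffice, since a
    homogeneous polynomial that vanishes near [v0] is zero. *)

Record fps (K : Type) := Fps { fc : nat -> K }.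

HB.instance Definition _ (K : Type) := gen_eqMixin (fps K).
HB.instance Definition _ (K : Type) := gen_choiceMixin (fps K).

Lemma fpsP (K : Type) (f g : fps K) : (forall n, fc f n = fc g n) -> f = g.
Proof. by case: f => f; case: g => g /= fg; congr Fps; apply/funext. Qed.

Section FpsRing.
Variable K : fieldType.
Implicit Types f g h : fps K.

Definition fps_add f g := Fps (fun n => fc f n + fc g n).
Definition fps_opp f := Fps (fun n => - fc f n).
Definition fps_zero := Fps (fun _ => 0 : K).

Fact fps_addA : associative fps_add.
Proof. by move=> f g h; apply: fpsP => n /=; rewrite addrA. Qed.
Fact fps_addC : commutative fps_add.
Proof. by move=> f g; apply: fpsP => n /=; rewrite addrC. Qed.
Fact fps_add0 : left_id fps_zero fps_add.
Proof. by move=> f; apply: fpsP => n /=; rewrite add0r. Qed.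
Fact fps_addN : left_inverse fps_zero fps_opp fps_add.
Proof. by move=> f; apply: fpsP => n /=; rewrite addNr. Qed.

HB.instance Definition _ := GRing.isZmodule.Build (fps K)
  fps_addA fps_addC fps_add0 fps_addN.

Definition trp n f : {poly K} := \poly_(i < n) fc f i.

Definition fps_mul f g :=
  Fps (fun n => \sum_(i < n.+1) fc f i * fc g (n - i)).
Definition fps_one := Fps (fun n => (n == 0%N)%:R : K).

(** A coefficient of a product sees only finitely many coefficients of the factors, so the ring
    axioms are inherited from [{poly K}] through truncation. *)
Lemma coef_trp_mul m n f g : (n < m)%N ->
  (trp m f * trp m g)`_n = fc (fps_mul f g) n.
Proof.
move=> nm; rewrite coefM /=; apply: eq_bigr => i _.
rewrite !coef_poly (leq_trans _ nm) ?ltn_ord //.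
by rewrite (leq_trans _ nm) // ltnS leq_subr.
Qed.

Fact fps_mulA : associative fps_mul.
Proof.
move=> f g h; apply: fpsP => n.
transitivity ((trp n.+1 f * (trp n.+1 g * trp n.+1 h))`_n).
  rewrite coefM; apply: eq_bigr => i _.
  by rewrite coef_trp_mul ?ltnS ?leq_subr // coef_poly ltn_ord.
rewrite mulrA coefM; apply: eq_bigr => i _.
by rewrite coef_trp_mul // [in LHS]coef_poly ltnS leq_subr.
Qed.
Fact fps_mulC : commutative fps_mul.
Proof.
by move=> f g; apply: fpsP => n; rewrite -!(@coef_trp_mul n.+1) // mulrC.
Qed.
Fact fps_mul1 : left_id fps_one fps_mul.
Proof.
move=> f; apply: fpsP => n /=; rewrite big_ord_recl /= mul1r subn0 big1 ?addr0 //.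
by move=> i _; rewrite mul0r.
Qed.
Fact fps_mulD : left_distributive fps_mul fps_add.
Proof.
move=> f g h; apply: fpsP => n /=; rewrite -big_split /=.
by apply: eq_bigr => i _; rewrite mulrDl.
Qed.
Fact fps_1neq0 : fps_one != 0.
Proof.
by apply/eqP => /(congr1 (fun f => fc f 0)) /= /eqP; rewrite oner_eq0.
Qed.

HB.instance Definition _ := GRing.Zmodule_isComNzRing.Build (fps K)
  fps_mulA fps_mulC fps_mul1 fps_mulD fps_1neq0.

Lemma fcN f n : fc (- f) n = - fc f n. Proof. by []. Qed.
Lemma fcB f g n : fc (f - g) n = fc f n - fc g n. Proof. by []. Qed.
Lemma fc0 n : fc (0 : fps K) n = 0. Proof. by []. Qed.
Lemma fc1 n : fc (1 : fps K) n = (n == 0%N)%:R. Proof. by []. Qed.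
Lemma fcM f g n : fc (f * g) n = \sum_(i < n.+1) fc f i * fc g (n - i).
Proof. by []. Qed.
Lemma fcM0 f g : fc (f * g) 0 = fc f 0 * fc g 0.
Proof. by rewrite fcM big_ord_recl big_ord0 addr0. Qed.
Lemma fc_sum (I : Type) (r : seq I) (P : pred I) (F : I -> fps K) n :
  fc (\sum_(i <- r | P i) F i) n = \sum_(i <- r | P i) fc (F i) n.
Proof. by elim/big_rec2: _ => // i x y _ <-. Qed.

(* Coefficients of the inverse: [c_n = - (\sum_(i < n) f_(n-i) c_i) / f_0]. *)
Fixpoint inv_seq f n : seq K :=
  if n is m.+1 then
    let s := inv_seq f m in
    rcons s (if m == 0%N then (fc f 0)^-1
             else - (\sum_(i < m) fc f (m - i) * s`_i) / fc f 0)
  else [::].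

Lemma size_inv_seq f n : size (inv_seq f n) = n.
Proof. by elim: n => //= n IH; rewrite size_rcons IH. Qed.

Lemma inv_seq_nth f n i : (i < n)%N -> (inv_seq f n)`_i = (inv_seq f i.+1)`_i.
Proof.
elim: n => // n IH; rewrite ltnS leq_eqVlt => /orP[/eqP->//|lt_in].
by rewrite [in LHS]/= nth_rcons size_inv_seq lt_in IH.
Qed.

Definition fps_unit : {pred fps K} := fun f => fc f 0 != 0.
Definition fps_inv f :=
  if fps_unit f then Fps (fun n => (inv_seq f n.+1)`_n) else f.

Fact fps_mulV : {in fps_unit, left_inverse 1 fps_inv *%R}.
Proof.
move=> f uf; rewrite mulrC; apply: fpsP => n.
have uf1 : fc f 0 != 0 by [].
rewrite /fps_inv (_ : fps_unit f = true) //.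
have E m : (inv_seq f m.+1)`_m = if m == 0%N then (fc f 0)^-1
    else - (\sum_(i < m) fc f (m - i) * (inv_seq f i.+1)`_i) / fc f 0.
  rewrite /= nth_rcons size_inv_seq ltnn eqxx; case: eqP => // _.
  by congr (- _ / _); apply: eq_bigr => i _; rewrite inv_seq_nth.
pose c m := (inv_seq f m.+1)`_m; rewrite -/c in E *.
transitivity (\sum_(i < n.+1) fc f (n - i) * c i).
  rewrite fcM (reindex_inj rev_ord_inj) /=; apply: eq_bigr => i _.
  by rewrite subSS subKn // -ltnS.
rewrite big_ord_recr /= subnn (E n : c n = _).
case: n => [|n]; first by rewrite big_ord0 add0r mulfV.
rewrite mulrCA mulfV // mulr1 (eq_bigr (fun i : 'I_n.+1 =>
    fc f (n.+1 - i) * (inv_seq f n.+1)`_i)) ?subrr // => i _.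
by rewrite [in RHS]inv_seq_nth.
Qed.

Fact fps_unitPl : forall f g, g * f = 1 -> fps_unit f.
Proof.
move=> f g /(congr1 (fun h => fc h 0)); rewrite fcM0 fc1 /= => E.
by apply/negP => /eqP f0; move/eqP: E; rewrite f0 mulr0 eq_sym oner_eq0.
Qed.
Fact fps_invr_out : {in [predC fps_unit], fps_inv =1 id}.
Proof. by move=> f /negP nf; rewrite /fps_inv; case: ifP. Qed.

HB.instance Definition _ := GRing.ComNzRing_hasMulInverse.Build (fps K)
  fps_mulV fps_unitPl fps_invr_out.

Lemma fps_unitE f : (f \is a GRing.unit) = (fc f 0 != 0).
Proof. by []. Qed.

Definition fpoly (p : {poly K}) : fps K := Fps (fun n => p`_n).
Fact fpoly_is_zmod_morphism : zmod_morphism fpoly.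
Proof. by move=> p q; apply: fpsP => n; rewrite fcB /= coefB. Qed.
Fact fpoly_is_monoid_morphism : monoid_morphism fpoly.
Proof.
by split=> [|p q]; apply: fpsP => n; rewrite ?fcM ?fc1 /= ?coefM ?coef1.
Qed.
HB.instance Definition _ := GRing.isZmodMorphism.Build {poly K} (fps K) fpoly
  fpoly_is_zmod_morphism.
HB.instance Definition _ := GRing.isMonoidMorphism.Build {poly K} (fps K) fpoly
  fpoly_is_monoid_morphism.

Definition ft : fps K := fpoly 'X.
Definition fcst (c : K) : fps K := fpoly c%:P.
Definition fev (f : fps K) : K := fc f 0.

Fact fcst_is_zmod_morphism : zmod_morphism fcst.
Proof. by move=> p q; rewrite /fcst polyCB rmorphB. Qed.
Fact fcst_is_monoid_morphism : monoid_morphism fcst.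
Proof. by split=> [|p q]; rewrite /fcst ?rmorph1 // polyCM rmorphM. Qed.
HB.instance Definition _ := GRing.isZmodMorphism.Build K (fps K) fcst
  fcst_is_zmod_morphism.
HB.instance Definition _ := GRing.isMonoidMorphism.Build K (fps K) fcst
  fcst_is_monoid_morphism.
Fact fev_is_zmod_morphism : zmod_morphism fev. Proof. by []. Qed.
Fact fev_is_monoid_morphism : monoid_morphism fev.
Proof. by split=> [|p q] //; apply: fcM0. Qed.
HB.instance Definition _ := GRing.isZmodMorphism.Build (fps K) K fev
  fev_is_zmod_morphism.
HB.instance Definition _ := GRing.isMonoidMorphism.Build (fps K) K fev
  fev_is_monoid_morphism.

Lemma fc_fcst c n : fc (fcst c) n = if n == 0%N then c else 0.
Proof. by rewrite /= coefC. Qed.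
Lemma fev_fcst c : fev (fcst c) = c. Proof. by rewrite /fev fc_fcst. Qed.
Lemma fcstM c f n : fc (fcst c * f) n = c * fc f n.
Proof.
rewrite fcM big_ord_recl fc_fcst /= subn0 big1 ?addr0 // => i _.
by rewrite coefC /= mul0r.
Qed.
Lemma fc_tM k f n : fc (ft ^+ k * f) n = if (n < k)%N then 0 else fc f (n - k).
Proof.
rewrite /ft -rmorphXn fcM; case: ltnP => [nk|kn].
  rewrite big1 // => i _; rewrite /= coefXn ltn_eqF ?mul0r //.
  exact: leq_ltn_trans (ltn_ord i : (i <= n)%N) nk.
have kn' : (k < n.+1)%N by [].
rewrite (bigD1 (Ordinal kn')) //= coefXn eqxx mul1r big1 ?addr0 // => i ne.
by rewrite coefXn -[_ == _]/(i == Ordinal kn') (negPf ne) mul0r.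
Qed.
Lemma fc_t n : fc ft n = (n == 1%N)%:R. Proof. by rewrite /= coefX. Qed.
Lemma fev_t : fev ft = 0. Proof. by rewrite /fev fc_t. Qed.

Lemma fps_divt f k : (forall n, (n < k)%N -> fc f n = 0) ->
  f = ft ^+ k * Fps (fun n => fc f (n + k)).
Proof.
move=> H; apply: fpsP => n; rewrite fc_tM /=; case: ltnP => [/H//|kn].
by rewrite subnK.
Qed.

Lemma fps_ord f : f != 0 -> exists k g, f = ft ^+ k * g /\ fc g 0 != 0.
Proof.
move=> f0; have /ex_minnP[k fk mk] : exists n, fc f n != 0.
  apply: contrapT => H; move/eqP: f0; apply; apply: fpsP => n.
  by apply/eqP; case: eqP => // /eqP ne; case: H; exists n.
exists k, (Fps (fun n => fc f (n + k))); split; last by rewrite /= add0n.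
apply: fps_divt => n nk; apply/eqP; case: eqP => // /eqP /mk.
by rewrite leqNgt nk.
Qed.

Lemma tX_mul0 k f : ft ^+ k * f = 0 -> f = 0.
Proof.
move=> E; apply: fpsP => n; have := congr1 (fun h => fc h (n + k)) E.
by rewrite fc_tM ltnNge leq_addl addnK.
Qed.

Fact fps_integral : GRing.integral_domain_axiom (fps K).
Proof.
move=> f g fg; apply/orP; case: (eqVneq f 0) => [|f0]; first by left.
right; apply/eqP; have [k [u [Ef u0]]] := fps_ord f0.
have : u * g = 0 by apply: (@tX_mul0 k); rewrite mulrA -Ef.
move/(congr1 (GRing.mul u^-1)); rewrite mulrA mulr0 mulVr ?mul1r //.
Qed.
HB.instance Definition _ := GRing.ComUnitRing_isIntegral.Build (fps K)
  fps_integral.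

Lemma tX_neq0 k : ft ^+ k != 0.
Proof.
by apply: expf_neq0; apply/eqP => /(congr1 (fun f => fc f 1)); rewrite fc_t fc0 => /eqP; rewrite oner_eq0.
Qed.

Lemma tX_inj k f g : ft ^+ k * f = ft ^+ k * g -> f = g.
Proof. exact/mulfI/tX_neq0. Qed.

Lemma tX_ord_uniq k l f g : fc f 0 != 0 -> fc g 0 != 0 ->
  ft ^+ k * f = ft ^+ l * g -> k = l /\ f = g.
Proof.
wlog kl : k l f g / (k <= l)%N => [W f0 g0 E|f0 g0 E].
  case/orP: (leq_total k l) => [/W H|/W H]; first exact: H E.
  by case: (H _ _ g0 f0 (esym E)) => -> ->.
move: E; rewrite -(subnKC kl) exprD -mulrA => /tX_inj E.
have := congr1 (fun h => fc h 0) E; rewrite fc_tM; case: ifP.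
  by move=> _ f00; rewrite f00 eqxx in f0.
move=> H _; have {H} H : (l - k = 0)%N by lia.
by rewrite H expr0 mul1r in E; rewrite H addn0.
Qed.

(* Substitution of [t ^+ N] for [t]; junk for [N = 0]. *)
Definition fsub N f : fps K :=
  Fps (fun n => if (N %| n)%N then fc f (n %/ N) else 0).
(** The substitution of [c * t] for t. For a root of unity [c] of order N + 1 it is the Galois
    action on series in the (N + 1)-st root of t. *)
Definition frot (c : K) f : fps K := Fps (fun n => c ^+ n * fc f n).

Lemma fc_fsub_mul N f g n : (0 < N)%N ->
  fc (fsub N f * fsub N g) n = fc (fsub N (f * g)) n.
Proof.
move=> N0; have E h i : (i <= n)%N -> fc (fsub N h) i = (trp n.+1 h \Po 'X^N)`_i.
  move=> le_in; rewrite coef_comp_poly_Xn //= coef_poly.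
  by rewrite ltnS (leq_trans (leq_div _ _) le_in).
transitivity (((trp n.+1 f \Po 'X^N) * (trp n.+1 g \Po 'X^N))`_n).
  by rewrite fcM coefM; apply: eq_bigr => i _; rewrite !E ?leq_subr // -ltnS.
rewrite -rmorphM /= coef_comp_poly_Xn //=; case: ifP => // _.
by rewrite coef_trp_mul // ltnS leq_div.
Qed.

Lemma frot_mul c f g : frot c (f * g) = frot c f * frot c g.
Proof.
apply: fpsP => n; rewrite /= big_distrr /=; apply: eq_bigr => i _.
by rewrite mulrACA -exprD subnKC // -ltnS.
Qed.

Fact frot_is_zmod_morphism c : zmod_morphism (frot c).
Proof. by move=> f g; apply: fpsP => n; rewrite /= mulrBr. Qed.
Fact frot_is_monoid_morphism c : monoid_morphism (frot c).
Proof.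
split=> [|p q]; last exact: frot_mul.
by apply: fpsP => n; rewrite /=; case: n => [|n]; rewrite ?mulr1 ?mulr0.
Qed.
HB.instance Definition _ c := GRing.isZmodMorphism.Build (fps K) (fps K) (frot c)
  (frot_is_zmod_morphism c).
HB.instance Definition _ c := GRing.isMonoidMorphism.Build (fps K) (fps K) (frot c)
  (frot_is_monoid_morphism c).

(** The shift excludes the exponent 0, so that the substitution is a ring morphism for every [N]. *)
Definition fsubS N := fsub N.+1.
Fact fsub_is_zmod_morphism N : zmod_morphism (fsubS N).
Proof. by move=> f g; apply: fpsP => n /=; case: ifP; rewrite ?subr0. Qed.
Fact fsub_is_monoid_morphism N : monoid_morphism (fsubS N).
Proof.
split=> [|p q]; apply: fpsP => n; last by rewrite fc_fsub_mul.
rewrite /=; case: n => [|n] //=.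
by case: ifP => // /dvdnP[[|k]] // ->; rewrite mulnK.
Qed.
HB.instance Definition _ N := GRing.isZmodMorphism.Build (fps K) (fps K) (fsubS N)
  (fsub_is_zmod_morphism N).
HB.instance Definition _ N := GRing.isMonoidMorphism.Build (fps K) (fps K) (fsubS N)
  (fsub_is_monoid_morphism N).

Lemma fsub_t N : fsubS N ft = ft ^+ N.+1.
Proof.
rewrite /ft -rmorphXn; apply: fpsP => n; rewrite [LHS]/= [RHS]/= coefX coefXn.
case: ifP => [/dvdnP[k ->]|nd].
  by rewrite mulnK // -{2}[N.+1]mul1n eqn_pmul2r.
by case: eqP => // E; rewrite E dvdnn in nd.
Qed.

Lemma fsub_comp M N f : fsubS M (fsubS N f) = fsub (M.+1 * N.+1) f.
Proof.
apply: fpsP => n; rewrite /=; case: (boolP (M.+1 %| n)%N) => [/dvdnP[k ->]|nd].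
  rewrite mulnK // [(M.+1 * _)%N]mulnC dvdn_pmul2r // divnMr //.
case: ifP => // /(dvdn_trans (dvdn_mulr _ (dvdnn _))).
by rewrite (negPf nd).
Qed.

End FpsRing.

Lemma fcE (K : Type) (F : nat -> K) n : fc (Fps F) n = F n. Proof. by []. Qed.
Arguments fc {K} f n : simpl never.

(** * Newton-Puiseux *)

(** Dependent choice in which each term may depend on all its predecessors, as for the successive
    corrections in Hensel's lemma. *)
Lemma course_of_values_choice (T : Type) (P : seq T -> T -> Prop) :
  (forall s, exists x, P s x) ->
  exists u : nat -> T, forall n, P (mkseq u n) (u n).
Proof.
move=> /choice[F HF].
pose s := fix s n := if n is m.+1 then rcons (s m) (F (s m)) else [::].
exists (fun n => F (s n)) => n.
suff -> : mkseq (fun n => F (s n)) n = s n by [].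
by elim: n => // n IH; rewrite mkseqS IH.
Qed.

Lemma leq_pred_trans a b k : (a < b)%N -> (b.-1 <= k)%N -> (a <= k)%N.
Proof. lia. Qed.

Lemma neq_pred_leq b k : (0 < b)%N -> (b.-1 <= k)%N -> k != b.-1 -> (b <= k)%N.
Proof. lia. Qed.

Lemma size_mul_ltn z y1 y2 v : (0 < y2)%N -> (z < y1)%N -> (y2 <= v)%N ->
  ((z + y2).-1 < (y1 + v).-1)%N.
Proof. lia. Qed.

Lemma size_mul_ltn2 a b y1 y2 : (a < y1)%N -> (b < y2)%N ->
  ((a + b).-1 < (y1 + y2).-1)%N.
Proof. lia. Qed.

Lemma sub_range i n : (0 < i < n)%N -> (0 < n - i < n)%N.
Proof. lia. Qed.

(** * Hensel's lemma over formal power series *)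

Section Hensel.
Variable K : fieldType.
Implicit Types (h : {poly fps K}) (p : {poly K}).

(** The coefficient of [t ^ m] when [h] is read as a series in t with polynomial coefficients;
    factoring [h] then means solving one Bezout equation per power of t. *)
Definition slice m h : {poly K} := \poly_(k < size h) fc h`_k m.

Lemma coef_slice m h k : (slice m h)`_k = fc h`_k m.
Proof. by rewrite coef_poly; case: ltnP => // H; rewrite nth_default. Qed.

Lemma sliceM m h1 h2 :
  slice m (h1 * h2) = \sum_(i < m.+1) slice i h1 * slice (m - i) h2.
Proof.
apply/polyP => k; rewrite coef_slice coefM fc_sum coef_sum.
under eq_bigr do rewrite fcM.
rewrite exchange_big /=; apply: eq_bigr => i _; rewrite coefM.
by apply: eq_bigr => j _; rewrite !coef_slice.
Qed.

Lemma slice_inj h1 h2 : (forall m, slice m h1 = slice m h2) -> h1 = h2.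
Proof.
move=> E; apply/polyP => k; apply: fpsP => m.
by rewrite -!coef_slice E.
Qed.

Lemma slice_surj (u : nat -> {poly K}) B : (forall m, (size (u m) <= B)%N) ->
  exists h, forall m, slice m h = u m.
Proof.
move=> uB; exists (\poly_(k < B) Fps (fun m => (u m)`_k)) => m.
apply/polyP => k; rewrite coef_slice coef_poly; case: ltnP => // Bk.
by rewrite nth_default // (leq_trans (uB m)).
Qed.

Lemma slice0 h : slice 0 h = map_poly (@fev K) h.
Proof. by apply/polyP => k; rewrite coef_slice. Qed.

Lemma slice_monic h p : p \is monic -> slice 0 h = p ->
  (forall m, (0 < m)%N -> (size (slice m h) < size p)%N) ->
  h \is monic /\ size h = size p.
Proof.
move=> mp h0 hm; have sp : (0 < size p)%N by rewrite size_poly_gt0 monic_neq0.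
have E k : ((size p).-1 <= k)%N -> h`_k = (k == (size p).-1)%:R.
  move=> le; apply: fpsP => -[|m]; rewrite -coef_slice.
    rewrite h0; case: eqP => [->|ne]; first by have /monicP := mp.
    by rewrite fc0; apply: nth_default; apply/neq_pred_leq => //; apply/eqP.
  have -> : fc (k == (size p).-1)%:R m.+1 = 0 :> K by case: eqP.
  rewrite nth_default //; exact: leq_pred_trans (hm m.+1 isT) le.
have sh : size h = size p.
  apply/eqP; rewrite eqn_leq; apply/andP; split.
    apply/leq_sizeP => k le; rewrite E ?(leq_trans (leq_pred _)) //.
    by rewrite gtn_eqF // (leq_trans _ le) // prednK.
  rewrite leqNgt; apply/negP => lt.
  have : h`_(size p).-1 = 0 by rewrite nth_default // -ltnS prednK.
  by rewrite E // eqxx => /eqP; rewrite oner_eq0.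
by split=> //; rewrite monicE lead_coefE sh E ?eqxx.
Qed.

(** Any Bezout solution can have its first component reduced modulo [p1]. The size of the second is
    then forced: otherwise the top term of [p1 * v] could not be cancelled and [r] would be too
    large. *)
Lemma bezout_small p1 p2 (r : {poly K}) : p1 \is monic -> p2 \is monic -> coprimep p1 p2 ->
  (size r < size (p1 * p2)%R)%N -> exists uv : {poly K} * {poly K},
  [/\ (size uv.1 < size p1)%N, (size uv.2 < size p2)%N &
      r = uv.1 * p2 + p1 * uv.2].
Proof.
move=> m1 m2 /Bezout_coprimepP[[a b] /= /eqpf_eq [c c0 E]] sr.
have n1 := monic_neq0 m1; have n2 := monic_neq0 m2.
have E1 : r = (c^-1 *: (r * a)) * p1 + (c^-1 *: (r * b)) * p2.
  rewrite -!scalerAl -scalerDr -!mulrA -mulrDr E alg_polyC.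
  by rewrite mulrC mul_polyC scalerA mulVf ?scale1r.
set A := c^-1 *: (r * a) in E1; set B := c^-1 *: (r * b) in E1.
exists (B %% p1, A + (B %/ p1) * p2) => /=.
have E2 : r = B %% p1 * p2 + p1 * (A + B %/ p1 * p2).
  rewrite [LHS]E1 {1}(divp_eq B p1); ring.
split=> //; first by rewrite ltn_modp.
rewrite ltnNge; apply/negP => le.
have nv : A + B %/ p1 * p2 != 0.
  by rewrite -size_poly_gt0 (leq_trans _ le) // size_poly_gt0.
have su : (size (B %% p1 * p2)%R < size (p1 * (A + B %/ p1 * p2))%R)%N.
  rewrite [X in (_ < X)%N]size_mul // (leq_ltn_trans (size_polyMleq _ _)) //.
  by apply: size_mul_ltn; rewrite ?ltn_modp // size_poly_gt0.
have := congr1 (fun p : {poly K} => size p) E2; rewrite addrC size_polyDl // => E3.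
move: sr; rewrite E3 (size_mul n1 nv) (size_mul n1 n2) ltnNge => /negP; apply.
by rewrite -!subn1 leq_sub2r // leq_add2l.
Qed.

Theorem hensel h p1 p2 : h \is monic -> p1 \is monic -> p2 \is monic ->
  coprimep p1 p2 -> map_poly (@fev K) h = p1 * p2 ->
  exists h1 h2, [/\ h1 \is monic, h2 \is monic, size h1 = size p1,
    size h2 = size p2 & h = h1 * h2].
Proof.
move=> mh m1 m2 cop E0.
have n1 := monic_neq0 m1; have n2 := monic_neq0 m2.
have sh : size h = size (p1 * p2) by rewrite -E0 size_map_poly_id0 // (monicP mh) rmorph1 oner_neq0.
have ssl m : (0 < m)%N -> (size (slice m h) < size (p1 * p2)%R)%N.
  move=> m0; rewrite -sh -(prednK (_ : 0 < size h)%N); last first.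
    by rewrite size_poly_gt0 monic_neq0.
  rewrite ltnS; apply/leq_sizeP => k le; rewrite coef_slice.
  have [lt|ge] := ltnP k (size h); last by rewrite nth_default.
  have -> : k = (size h).-1 by lia.
  have /monicP := mh; rewrite lead_coefE => ->.
  by rewrite fc1; case: m m0.
pose small (s : seq ({poly K} * {poly K})) := forall i, (0 < i < size s)%N ->
  (size (nth (p1, p2) s i).1 < size p1)%N /\
  (size (nth (p1, p2) s i).2 < size p2)%N.
(* The choice principle needs [P] to be solvable after every list, hence the guard [small s]; strong
   induction shows below that the sequence obtained satisfies it. *)
pose P (s : seq ({poly K} * {poly K})) (uv : {poly K} * {poly K}) :=
  if s is nil then uv = (p1, p2) else
  (small s ->
   [/\ (size uv.1 < size p1)%N, (size uv.2 < size p2)%N &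
      slice (size s) h - \sum_(1 <= i < size s)
         (nth (p1, p2) s i).1 * (nth (p1, p2) s (size s - i)%N).2
        = uv.1 * p2 + p1 * uv.2]).
have [s|w Hw] := @course_of_values_choice _ P.
  case: s => [|x s]; first by exists (p1, p2).
  rewrite /P; case: (pselect (small (x :: s))); last first.
    by move=> nH; exists (p1, p2).
  move=> H; have [|uv Huv] := @bezout_small p1 p2 (slice (size (x :: s)) h -
    \sum_(1 <= i < size (x :: s)) (nth (p1, p2) (x :: s) i).1 *
         (nth (p1, p2) (x :: s) (size (x :: s) - i)%N).2) m1 m2 cop.
    rewrite (leq_ltn_trans (size_polyD _ _)) // gtn_max ssl //= size_polyN.
    rewrite big_nat; elim/big_ind: _ => [|a b la lb|i Hi].
    - by rewrite size_poly0 size_poly_gt0 mulf_neq0.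
    - by rewrite (leq_ltn_trans (size_polyD _ _)) // gtn_max la lb.
    have [lt1 _] := H i Hi.
    have [_ lt2] := H (size (x :: s) - i)%N (sub_range Hi).
    rewrite (size_mul n1 n2) (leq_ltn_trans (size_polyMleq _ _)) //.
    exact: size_mul_ltn2 lt1 lt2.
  by exists uv => _; case: Huv => ? ? ->; split.
have w0 : w 0%N = (p1, p2) by apply: (Hw 0%N).
have Hm m : (0 < m)%N -> [/\ (size (w m).1 < size p1)%N, (size (w m).2 < size p2)%N &
   slice m h - \sum_(1 <= i < m) (w i).1 * (w (m - i)%N).2
      = (w m).1 * p2 + p1 * (w m).2].
  elim/ltn_ind: m => m IH m0; have sm : small (mkseq w m).
    move=> i; rewrite size_mkseq => /andP[i0 im]; rewrite nth_mkseq //.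
    by have [] := IH i im i0.
  have := Hw m; rewrite /P; case E : (mkseq w m) => [|x s].
    by move/(congr1 size): E; rewrite size_mkseq => m00; rewrite m00 in m0.
  rewrite -E size_mkseq => /(_ sm)[].
  move=> -> -> <-; split=> //; congr (_ - _).
  rewrite !big_nat; apply: eq_bigr => i Hi.
  by rewrite !nth_mkseq //; lia.
have [|h1 S1] := @slice_surj (fun m => (w m).1) (size p1).
  by case=> [|m]; [rewrite w0|have [/ltnW] := Hm m.+1 isT].
have [|h2 S2] := @slice_surj (fun m => (w m).2) (size p2).
  by case=> [|m]; [rewrite w0|have [_ /ltnW] := Hm m.+1 isT].
exists h1, h2.
have [|m m0|mh1 sh1] := @slice_monic h1 p1 m1; first by rewrite S1 w0.
  by rewrite S1; have [] := Hm m m0.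
have [|m m0|mh2 sh2] := @slice_monic h2 p2 m2; first by rewrite S2 w0.
  by rewrite S2; have [] := Hm m m0.
split=> //; apply: slice_inj => m; rewrite sliceM.
case: m => [|m]; first by rewrite big_ord_recl big_ord0 addr0 slice0 E0 S1 S2 w0.
have [_ _ /eqP] := Hm m.+1 isT; rewrite subr_eq => /eqP ->.
rewrite big_ord_recl big_ord_recr /= subnn subn0 !S1 !S2 w0 /=.
rewrite -(big_mkord predT (fun i => slice (bump 0 i) h1 * slice (m.+1 - bump 0 i)%N h2)).
rewrite [RHS]addrCA [LHS]addrC; congr (_ + _); last by rewrite addrC.
rewrite big_add1; apply: eq_bigr => i _.
by rewrite S1 S2.
Qed.

End Hensel.

(** The factor [T ^+ j] replaces the exponent [size rs - j], so that no division by [T] and no bound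
    on [j] occurs. *)
Lemma coef_prod_XsubC_scale (R : comNzRingType) (T : R) (rs : seq R) j :
  (\prod_(z <- rs) ('X - (T * z)%:P))`_j * T ^+ j =
  T ^+ size rs * (\prod_(z <- rs) ('X - z%:P))`_j.
Proof.
elim: rs j => [|z rs IH] j.
  by rewrite !big_nil !coef1 expr0 mul1r; case: j => [|j]; rewrite ?mulr1 ?mul0r.
rewrite !big_cons /= !mulrBl !coefB !coefXM !coefCM mulrBl exprS mulrBr.
congr (_ - _); last by rewrite -!mulrA IH; ring.
by case: j => [|j] /=; rewrite ?mul0r ?mulr0 // exprS mulrCA IH mulrA.
Qed.

(** * The Newton-Puiseux theorem with a ramification index depending on the degree only *)

Section Puiseux.
Variable C : numClosedFieldType.
Local Notation fps := (fps C).
Local Notation ft := (ft C).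
Implicit Types (f g h : {poly fps}).

Definition fsplits N f :=
  exists rs : seq fps, map_poly (@fsubS C N) f = \prod_(z <- rs) ('X - z%:P).

Lemma map_prod_XsubC (R S : nzRingType) (phi : {rmorphism R -> S}) (rs : seq R) :
  map_poly phi (\prod_(z <- rs) ('X - z%:P)) = \prod_(z <- map phi rs) ('X - z%:P).
Proof.
rewrite rmorph_prod /= big_map; apply: eq_bigr => z _.
by rewrite map_polyXsubC.
Qed.

Lemma fsplits_dvd N M f : fsplits N f -> (N.+1 %| M.+1)%N -> fsplits M f.
Proof.
case=> rs E /dvdnP[[|k] Ek] //; exists (map (@fsubS C k) rs).
rewrite -map_prod_XsubC -E; apply/polyP => j; rewrite !coef_map /=.
by rewrite fsub_comp /fsubS -Ek.
Qed.

Lemma fsplitsM N f g : fsplits N f -> fsplits N g -> fsplits N (f * g).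
Proof.
by move=> [r Er] [s Es]; exists (r ++ s); rewrite rmorphM /= Er Es big_cat.
Qed.

Lemma fsplits_shift N f c : fsplits N (f \Po ('X + c%:P)) -> fsplits N f.
Proof.
case=> rs E; pose d := @fsubS C N c.
exists [seq z + d | z <- rs].
have -> : f = (f \Po ('X + c%:P)) \Po ('X - c%:P).
  by rewrite -comp_polyA comp_polyD comp_polyX comp_polyC subrK comp_polyXr.
rewrite map_comp_poly E rmorphB /= map_polyX map_polyC /= big_map.
rewrite rmorph_prod /=; apply: eq_bigr => z _.
by rewrite comp_polyB comp_polyX comp_polyC polyCD; ring.
Qed.

Lemma fsplits_scale N q n f h : h \is monic -> size h = n.+1 ->
  (forall j, f`_j * ft ^+ (q * j) = ft ^+ (q * n) * h`_j) ->
  fsplits N h -> fsplits N f.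
Proof.
move=> mh sh E [rs Ers]; pose T : fps := ft ^+ (N.+1 * q).
exists [seq T * z | z <- rs]; rewrite big_map; apply/polyP => j.
have T0 : T ^+ j != 0 by rewrite expf_neq0 // tX_neq0.
apply: (mulIf T0); rewrite coef_prod_XsubC_scale -Ers !coef_map /=.
have -> : size rs = n.
  have := size_map_poly_id0 (f := @fsubS C N) (p := h).
  rewrite (monicP mh) rmorph1 oner_neq0 => /(_ isT); rewrite Ers sh.
  by rewrite size_prod_XsubC => -[].
have Et m : T ^+ m = fsubS N (ft ^+ (q * m)).
  by rewrite rmorphXn /= fsub_t -!exprM mulnA.
by rewrite !Et -!rmorphM /= E.
Qed.

(** Splitting off a root with its full multiplicity gives coprime factors. This fails only for a
    single root [r]; then the vanishing subleading coefficient is a nonzero multiple of [r], so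
    [r = 0]. *)
Lemma poly_monic_root_split (h : {poly C}) n : h \is monic -> size h = n.+2 ->
  h`_n = 0 -> h != 'X^(n.+1) ->
  exists p1 p2, [/\ p1 \is monic, p2 \is monic, coprimep p1 p2, h = p1 * p2 &
   (size p1 < n.+2)%N /\ (size p2 < n.+2)%N].
Proof.
move=> mh sh hn hX; have h0 := monic_neq0 mh.
have /closed_rootP[r rr] : size h != 1%N by rewrite sh.
have [k [q nq Eh]] := multiplicity_XsubC h r; rewrite h0 /= in nq.
have k0 : (0 < k)%N.
  by case: k Eh => // Eh; move: rr; rewrite Eh expr0 mulr1 (negPf nq).
have mX : ('X - r%:P) ^+ k \is monic by rewrite monic_exp ?monicXsubC.
have mq : q \is monic by move: mh; rewrite Eh monicMr.
have sX : size (('X - r%:P) ^+ k) = k.+1 by rewrite size_exp_XsubC.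
have sE : (size q + k)%N = n.+2.
  by rewrite -sh Eh size_Mmonic ?monic_neq0 // sX addnS.
have q0 : (0 < size q)%N by rewrite size_poly_gt0 monic_neq0.
have [lt1|] := ltnP 1 (size q); last first.
  move=> le1; have sq : size q = 1%N by apply/eqP; rewrite eqn_leq le1.
  have q1 : q = 1.
    rewrite (size1_polyC le1); have := monicP mq.
    by rewrite lead_coefE sq => ->.
  have kE : k = n.+1 by move: sE; rewrite sq add1n => -[].
  move: hn; rewrite Eh q1 mul1r kE => hn.
  suff r0 : r = 0 by case/eqP: hX; rewrite Eh q1 mul1r kE r0 subr0.
  have := @coefPn_prod_XsubC _ (nseq n.+1 r); rewrite size_nseq => /(_ isT).
  rewrite (_ : \prod_(x <- nseq n.+1 r) ('X - x%:P) = ('X - r%:P) ^+ n.+1).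
    rewrite [_.-1]/= hn big_nseq iter_addr addr0 => /eqP.
    by rewrite eq_sym oppr_eq0 mulrn_eq0 /= => /eqP.
  by rewrite big_nseq iter_mulr mulr1.
exists q, (('X - r%:P) ^+ k); split=> //.
  by rewrite coprimep_expr // coprimep_XsubC.
split; first by rewrite -sE -[X in (X < _)%N]addn0 ltn_add2l.
by rewrite sX -sE -[k.+1]add1n ltn_add2r.
Qed.

Lemma ord_choice n (a : 'I_n -> fps) : exists al : 'I_n -> nat, exists u,
  forall i, a i != 0 -> a i = ft ^+ al i * u i /\ fc (u i) 0 != 0.
Proof.
have /choice[F HF] : forall i, exists ku : nat * fps,
    a i != 0 -> a i = ft ^+ ku.1 * ku.2 /\ fc ku.2 0 != 0.
  move=> i; case: (eqVneq (a i) 0) => [_|]; first by exists (0%N, 0).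
  by move=> /fps_ord[k [u Hu]]; exists (k, u).
by exists (fun i => (F i).1), (fun i => (F i).2).
Qed.

(* Depressed polynomial with a nonzero lower coefficient: after [t -> t ^+ n!]
   all slopes of the Newton polygon are integers, so that scaling by the
   smallest one gives a polynomial whose reduction has two distinct roots. *)
Lemma fsplits_depressed N n g : g \is monic -> size g = n.+2 -> g`_n = 0 ->
  g != 'X^(n.+1) ->
  (forall f, f \is monic -> (size f <= n.+1)%N -> fsplits N f) ->
  fsplits ((n.+1)`! * N.+1).-1 g.
Proof.
move=> mg sg gn gX IH.
have [al [u Hu]] := ord_choice (fun i : 'I_n.+1 => g`_i).
have [i0 gi0] : exists i : 'I_n.+1, g`_i != 0.
  apply: contrapT => H; case/eqP: gX; apply/polyP => j; rewrite coefXn.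
  have [lt|ge] := ltnP j n.+1.
    rewrite ltn_eqF //; apply/eqP; case: eqP => // /eqP ne; case: H.
    by exists (Ordinal lt).
  case: eqP => [->|ne]; first by have := monicP mg; rewrite lead_coefE sg.
  by rewrite nth_default // sg; lia.
(* Slope of the segment from the i-th point of the Newton polygon to the point [(n.+1, 0)] of the
   leading coefficient. *)
pose w (i : 'I_n.+1) : rat := (al i)%:R / (n.+1 - i)%N%:R.
have [i gi imin] := @arg_minP _ rat _ i0 (fun i : 'I_n.+1 => g`_i != 0) w gi0.
have {imin} mi j : g`_j != 0 -> (j < n.+1)%N -> forall l : 'I_n.+1, l = j :> nat ->
    (al i * (n.+1 - l) <= al l * (n.+1 - i))%N.
  move=> gj lt l lj; rewrite -lj in gj; have := imin l gj.
  rewrite /w ler_pdivrMr ?ltr0n ?subn_gt0 // mulrAC ler_pdivlMr ?ltr0n ?subn_gt0 //.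
  by rewrite -!natrM ler_nat.
pose M := (n.+1)`!; have M0 : (0 < M)%N := fact_gt0 _.
have dv : (n.+1 - i %| M)%N by rewrite dvdn_fact // subn_gt0 ltn_ord leq_subr.
(* The smallest slope multiplied by [M], an integer because [n.+1 - i] divides [M]. *)
pose q := (al i * (M %/ (n.+1 - i)))%N.
have qi : (q * (n.+1 - i) = M * al i)%N.
  by rewrite /q -mulnA divnK // mulnC.
pose gM := map_poly (@fsubS C M.-1) g.
have Et k : fsubS M.-1 (ft ^+ k) = ft ^+ (M * k).
  by rewrite rmorphXn /= fsub_t -exprM prednK.
have fs0 (v : fps) : fc (fsubS M.-1 v) 0 = fc v 0 by rewrite /fsubS /fsub fcE ?dvdn0 ?div0n.
(* The [b j] are the coefficients after the roots have been divided by [t ^ q]. Minimality of the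
   slope makes them power series, and at [j = i] the quotient is a unit, so the reduction is not a
   pure power of X. *)
have /choice[b Hb] : forall j : nat, exists b, (j < n.+1)%N ->
    [/\ gM`_j = ft ^+ (q * (n.+1 - j)) * b,
       g`_j = 0 -> b = 0 & (j = i :> nat -> fc b 0 != 0)].
  move=> j; have [lt|] := ltnP j n.+1; last by exists 0.
  rewrite coef_map /=; have [E0|ne] := eqVneq g`_j 0.
    by exists 0; rewrite E0 rmorph0 mulr0; split=> // ji; rewrite -ji E0 eqxx in gi.
  have [E1 u0] := Hu (Ordinal lt) ne; rewrite /= in E1.
  have le := mi j ne lt (Ordinal lt) erefl; rewrite /= in le.
  have le' : (q * (n.+1 - j) <= M * al (Ordinal lt))%N.
    rewrite -(leq_pmul2r (_ : 0 < n.+1 - i)%N) ?subn_gt0 //.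
    by rewrite [X in (X <= _)%N]mulnAC qi -[X in (X <= _)%N]mulnA -[X in (_ <= X)%N]mulnA (leq_pmul2l M0).
  exists (ft ^+ (M * al (Ordinal lt) - q * (n.+1 - j)) * fsubS M.-1 (u (Ordinal lt))).
  rewrite mulrA -exprD subnKC // E1 rmorphM /= Et; split=> // [|ji].
    by rewrite -E1 => /eqP; rewrite (negPf ne).
  have li : Ordinal lt = i by apply: val_inj.
  by rewrite li ji qi subnn expr0 mul1r fs0 -li.
pose h := 'X^(n.+1) + \poly_(j < n.+1) b j.
have hj j : (j < n.+1)%N -> h`_j = b j.
  by move=> lt; rewrite coefD coefXn coef_poly lt ltn_eqF // add0r.
have sh : size h = n.+2.
  by rewrite size_polyDl size_polyXn // ltnS size_poly.
have mh : h \is monic.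
  by rewrite monicE lead_coefE sh coefD coefXn eqxx coef_poly ltnn addr0.
have E j : gM`_j * ft ^+ (q * j) = ft ^+ (q * n.+1) * h`_j.
  have [lt|ge] := ltnP j n.+1.
    rewrite hj //; have [-> _ _] := Hb j lt.
    by rewrite mulrAC -exprD -mulnDr subnK // ltnW.
  have [->|ne] := eqVneq j n.+1.
    have -> : h`_n.+1 = 1 by have := monicP mh; rewrite lead_coefE sh.
    have -> : gM`_n.+1 = 1.
      have g1 : g`_n.+1 = 1 by have := monicP mg; rewrite lead_coefE sg.
      by rewrite coef_map g1; exact: rmorph1.
    by rewrite mulrC.
  have lt : (n.+2 <= j)%N by lia.
  rewrite nth_default ?mul0r; last by rewrite (leq_trans (size_poly _ _)) ?sg.
  by rewrite nth_default ?mulr0 ?sh.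
have mh0 : map_poly (@fev C) h \is monic by apply: monic_map.
have sh0 : size (map_poly (@fev C) h) = n.+2.
  by rewrite size_map_poly_id0 ?sh // (monicP mh) rmorph1 oner_neq0.
have [| |p1 [p2 [m1 m2 cop Ep [s1 s2]]]] := poly_monic_root_split mh0 sh0.
- rewrite coef_map /= hj //; have [_ H _] := Hb n (ltnSn n).
  by rewrite (H gn) rmorph0.
- apply/eqP => /(congr1 (fun p : {poly C} => p`_i)).
  rewrite coef_map coefXn ltn_eqF // hj //.
  have [_ _ /(_ erefl)] := Hb i (ltn_ord i).
  by move=> /eqP.
have [h1 [h2 [mh1 mh2 sh1 sh2 Eh]]] := hensel mh m1 m2 cop Ep.
have Sh : fsplits N h.
  by rewrite Eh; apply: fsplitsM; apply: IH; rewrite // ?sh1 ?sh2 -ltnS.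
have [rs Ers] := fsplits_scale mh sh E Sh.
exists rs; rewrite -Ers; apply/polyP => j; rewrite !coef_map /=.
rewrite fsub_comp (prednK M0) /fsubS prednK; last by rewrite muln_gt0 M0.
by rewrite mulnC.
Qed.

Theorem puiseux d : exists N, forall f, f \is monic -> (size f <= d.+1)%N ->
  fsplits N f.
Proof.
elim: d => [|n [N IH]].
  exists 0%N => f mf sf; exists [::]; rewrite big_nil.
  have sf1 : size f = 1%N.
    by apply/eqP; rewrite eqn_leq sf size_poly_gt0 monic_neq0.
  rewrite (size1_polyC sf); have := monicP mf; rewrite lead_coefE sf1 /= => ->.
  by rewrite polyC1; exact: rmorph1.
pose N' := ((n.+1)`! * N.+1).-1; exists N' => f mf.
have N'E : N'.+1 = ((n.+1)`! * N.+1)%N by rewrite prednK // muln_gt0 fact_gt0.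
rewrite leq_eqVlt => /orP[/eqP sf|lt]; last first.
  by apply: (fsplits_dvd (IH f mf lt)); rewrite N'E dvdn_mull.
(* [c] is the mean of the roots; translating by it kills the subleading coefficient. *)
pose c : fps := fcst (- (n.+1)%:R^-1) * f`_n.
have nz : (n.+1)%:R != 0 :> C by rewrite pnatr_eq0.
pose g := f \Po ('X + c%:P).
apply: (@fsplits_shift _ _ c); rewrite -/g.
have sg : size g = n.+2 by rewrite size_comp_poly2 ?size_XaddC.
have mg : g \is monic.
  by rewrite monicE lead_coef_comp ?size_XaddC // (monicP mf) lead_coefXaddC expr1n mulr1.
have [gX|gX] := eqVneq g 'X^(n.+1).
  exists (nseq n.+1 0); rewrite gX map_polyXn big_nseq iter_mulr mulr1.
  by rewrite subr0.
apply: fsplits_depressed => //.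
have Ef : f = \poly_(i < n.+2) f`_i by rewrite -sf coefK.
have -> : g = \sum_(i < n.+2) f`_i *: ('X + c%:P) ^+ i.
  by rewrite /g comp_polyE sf.
have CP k : ('X + c%:P) ^+ k = \prod_(z <- nseq k (- c)) ('X - z%:P).
  by rewrite big_nseq iter_mulr mulr1 polyCN opprK.
rewrite big_ord_recr big_ord_recr /= coefD coefD coef_sum big1 ?add0r => [|i _].
  rewrite !coefZ.
  have -> : f`_n.+1 = 1 by have := monicP mf; rewrite lead_coefE sf.
  rewrite mul1r (CP n.+1); have := @coefPn_prod_XsubC _ (nseq n.+1 (- c)).
  rewrite size_nseq => /(_ isT); rewrite [_.-1]/= => ->; rewrite big_nseq iter_addr addr0.
  have -> : (('X + c%:P) ^+ n)`_n = 1.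
    have := lead_coef_prod_XsubC (nseq n (- c)) predT id.
    by rewrite lead_coefE size_prod_XsubC size_nseq CP.
  rewrite mulr1 mulNrn opprK /c -mulrnAl -rmorphMn /= -mulr_natr mulNr mulVf //.
  by rewrite rmorphN rmorph1 mulN1r subrr.
rewrite coefZ [X in _ * X]nth_default ?mulr0 //.
by apply: leq_trans (ltn_ord i); rewrite CP size_prod_XsubC size_nseq.
Qed.

End Puiseux.

(** * Bounded families *)

(** Closure under the pointwise ring operations. Boundedness, coefficientwise boundedness and the
    Lipschitz property are all of this kind, so any polynomial expression inherits them without
    explicit estimates. *)
Definition family_ring (Om : Type) (T : pzRingType) (B : (Om -> T) -> Prop) :=
  [/\ B (fun=> 0), B (fun=> 1), forall f, B f -> B (fun w => - f w),
      forall f g, B f -> B g -> B (fun w => f w + g w) &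
      forall f g, B f -> B g -> B (fun w => f w * g w)].

Section FamilyRing.
Variables (Om : Type) (T : pzRingType) (B : (Om -> T) -> Prop).
Hypothesis HB : family_ring B.

Lemma frD f g : B f -> B g -> B (fun w => f w + g w).
Proof. by case: HB => _ _ _ H _; apply: H. Qed.
Lemma frN f : B f -> B (fun w => - f w).
Proof. by case: HB => _ _ H _ _; apply: H. Qed.
Lemma frB f g : B f -> B g -> B (fun w => f w - g w).
Proof. by move=> Bf /frN; apply: frD. Qed.
Lemma frM f g : B f -> B g -> B (fun w => f w * g w).
Proof. by case: HB => _ _ _ _ H; apply: H. Qed.
Lemma fr0 : B (fun=> 0). Proof. by case: HB. Qed.
Lemma fr1 : B (fun=> 1). Proof. by case: HB. Qed.
Lemma frX f n : B f -> B (fun w => f w ^+ n).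
Proof.
move=> Bf; elim: n => [|n IH]; first exact: fr1.
by under eq_fun do rewrite exprS; apply: frM.
Qed.
Lemma fr_sum (I : Type) (r : seq I) (P : pred I) (F : I -> Om -> T) :
  (forall i, P i -> B (F i)) -> B (fun w => \sum_(i <- r | P i) F i w).
Proof.
move=> H; elim: r => [|i r IH].
  by under eq_fun do rewrite big_nil; apply: fr0.
under eq_fun do rewrite big_cons; case: (boolP (P i)) => // Pi.
exact: (frD (H i Pi)).
Qed.
Lemma fr_prod (I : Type) (r : seq I) (P : pred I) (F : I -> Om -> T) :
  (forall i, P i -> B (F i)) -> B (fun w => \prod_(i <- r | P i) F i w).
Proof.
move=> H; elim: r => [|i r IH].
  by under eq_fun do rewrite big_nil; apply: fr1.
under eq_fun do rewrite big_cons; case: (boolP (P i)) => // Pi.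
exact: (frM (H i Pi)).
Qed.
Lemma fr_nat n : B (fun=> n%:R).
Proof.
elim: n => [|n IH]; first exact: fr0.
by under eq_fun do rewrite -addn1 natrD; apply: (frD IH fr1).
Qed.

Definition fmx m n (A : Om -> 'M[T]_(m, n)) := forall i j, B (fun w => A w i j).

Lemma fmxM m n p (A1 : Om -> 'M[T]_(m, n)) (A2 : Om -> 'M[T]_(n, p)) :
  fmx A1 -> fmx A2 -> fmx (fun w => A1 w *m A2 w).
Proof.
move=> H1 H2 i j; under eq_fun do rewrite mxE.
by apply: fr_sum => k _; apply: frM.
Qed.
Lemma fmxD m n (A1 A2 : Om -> 'M[T]_(m, n)) :
  fmx A1 -> fmx A2 -> fmx (fun w => A1 w + A2 w).
Proof. by move=> H1 H2 i j; under eq_fun do rewrite mxE; apply: frD. Qed.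
Lemma fmxZ m n (c : Om -> T) (A : Om -> 'M[T]_(m, n)) :
  B c -> fmx A -> fmx (fun w => c w *: A w).
Proof. by move=> H1 H2 i j; under eq_fun do rewrite mxE; apply: frM. Qed.
Lemma fmx_scalar n (c : Om -> T) : B c -> fmx (fun w => (c w)%:M : 'M_n).
Proof.
move=> Bc i j; under eq_fun do rewrite mxE.
by case: (i == j) => /=; [exact: Bc|exact: fr0].
Qed.
End FamilyRing.

Lemma fr_det Om (T : comPzRingType) (B : (Om -> T) -> Prop) n (A : Om -> 'M[T]_n) :
  family_ring B -> fmx B A -> B (fun w => \det (A w)).
Proof.
move=> HB HA; under eq_fun do rewrite /determinant.
apply: fr_sum => // s _; apply: frM => //.
  by apply: frX => //; apply: frN => //; apply: fr1.
by apply: fr_prod.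
Qed.

Lemma fr_fps Om (K : fieldType) (B : (Om -> K) -> Prop) : family_ring B ->
  family_ring (fun f : Om -> fps K => forall n, B (fun w => fc (f w) n)).
Proof.
move=> HB; split.
- by move=> n; apply: fr0.
- by move=> n; under eq_fun do rewrite fc1; apply: fr_nat.
- by move=> f Hf n; apply: frN.
- by move=> f g Hf Hg n; apply: frD.
- move=> f g Hf Hg n; under eq_fun do rewrite fcM.
  by apply: fr_sum => // i _; apply: frM.
Qed.

Lemma fr_poly Om (K : nzRingType) (B : (Om -> K) -> Prop) : family_ring B ->
  family_ring (fun f : Om -> {poly K} => forall n, B (fun w => (f w)`_n)).
Proof.
move=> HB; split.
- by move=> n; under eq_fun do rewrite coef0; apply: fr0.
- by move=> n; under eq_fun do rewrite coef1; apply: fr_nat.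
- by move=> f Hf n; under eq_fun do rewrite coefN; apply: frN.
- by move=> f g Hf Hg n; under eq_fun do rewrite coefD; apply: frD.
- move=> f g Hf Hg n; under eq_fun do rewrite coefM.
  by apply: fr_sum => // i _; apply: frM.
Qed.

Section Bounded.
Variables (C : numFieldType) (Om : Type).

Definition bnd (f : Om -> C) := exists B, forall w, `|f w| <= B.

Lemma bnd_ring : family_ring bnd.
Proof.
split.
- by exists 0 => w; rewrite normr0.
- by exists 1 => w; rewrite normr1.
- by move=> f [B H]; exists B => w; rewrite normrN.
- move=> f g [B H] [B' H']; exists (B + B') => w.
  by rewrite (le_trans (ler_normD _ _)) // lerD.
- move=> f g [B H] [B' H']; exists (B * B') => w.
  by rewrite normrM ler_pM.
Qed.

Lemma bnd_cst c : bnd (fun=> c). Proof. by exists `|c|. Qed.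

Lemma bnd_inv (f : Om -> C) c : 0 < c -> (forall w, c <= `|f w|) ->
  bnd (fun w => (f w)^-1).
Proof.
move=> c0 H; exists c^-1 => w; rewrite normfV lef_pV2 ?posrE //.
exact: lt_le_trans c0 (H w).
Qed.

Lemma bnd_max (I : finType) (f : I -> Om -> C) : (forall i, bnd (f i)) ->
  exists2 B, 1 <= B & forall i w, `|f i w| <= B.
Proof.
(* Over an empty [Om] the bounds [B i] may be negative, so this case is separated. *)
move=> /choice[B HB]; have [[w0]|nOm] := pselect (inhabited Om); last first.
  by exists 1 => // i w; case: nOm.
have B0 i : 0 <= B i by apply: le_trans (HB i w0).
exists (1 + \sum_i B i); first by rewrite lerDl sumr_ge0.
move=> i w; rewrite (le_trans (HB i w)) // (bigD1 i) //= addrCA lerDl.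
by rewrite addr_ge0 // sumr_ge0.
Qed.

(** The bound may depend on [n] in any way: uniformity is over [Om] only, and convergence is never
    involved. *)
Definition bser : (Om -> fps C) -> Prop := fun f => forall n, bnd (fun w => fc (f w) n).
Lemma bser_ring : family_ring bser. Proof. exact: fr_fps bnd_ring. Qed.
Lemma bser_cst f : bser (fun=> f). Proof. by move=> n; apply: bnd_cst. Qed.
Lemma bser_fcst (f : Om -> C) : bnd f -> bser (fun w => fcst (f w)).
Proof.
move=> Hf n; under eq_fun do rewrite fc_fcst.
by case: n => [|n] //=; apply: bnd_cst.
Qed.

(** Cauchy's bound: a root of modulus above 1 satisfies [|z| ^ d <= d * B * |z| ^ (d - 1)]. *)
Lemma bnd_root (p : Om -> {poly C}) d (z : Om -> C) :
  (forall w, p w \is monic) -> (forall w, size (p w) = d.+1) ->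
  (forall j, bnd (fun w => (p w)`_j)) -> (forall w, root (p w) (z w)) -> bnd z.
Proof.
move=> mp sp Hp rz; have [B B1 HB] := bnd_max (fun i : 'I_d => Hp i).
exists (1 + d%:R * B) => w.
have dB : 0 <= d%:R * B by rewrite mulr_ge0 // (le_trans ler01).
have [le1|ge1] := real_leP (normr_real (z w)) (real1 C).
  by rewrite (le_trans le1) // lerDl.
have d0 : (0 < d)%N.
  case: d sp {Hp HB dB} => // sp; have := rz w; rewrite rootE.
  have := mp w; rewrite monicE lead_coefE sp (size1_polyC (eq_leq (sp w))) /= => /eqP.
  by rewrite coefC /= => ->; rewrite hornerC oner_eq0.
have E : z w ^+ d = - \sum_(i < d) (p w)`_i * z w ^+ i.
  have := rz w; rewrite rootE horner_coef sp big_ord_recr /=.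
  have := mp w; rewrite monicE lead_coefE sp => /eqP ->; rewrite mul1r addrC.
  by rewrite addr_eq0 => /eqP.
have zp : 0 < `|z w| by rewrite (lt_trans ltr01).
have : `|z w| ^+ d <= d%:R * B * `|z w| ^+ d.-1.
  rewrite -normrX E normrN (le_trans (ler_norm_sum _ _ _)) //.
  have -> : d%:R * B * `|z w| ^+ d.-1 = \sum_(i < d) B * `|z w| ^+ d.-1.
    by rewrite sumr_const card_ord -mulrA mulr_natl.
  apply: ler_sum => i _; rewrite normrM normrX; apply: ler_pM => //; first exact: exprn_ge0.
  by rewrite ler_weXn2l ?(ltW ge1) // -ltnS prednK.
rewrite -{1}(prednK d0) exprS ler_pM2r ?exprn_gt0 // => H.
by rewrite (le_trans H) // lerDr.
Qed.

End Bounded.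

(** * Uniform saturation of the row lattice of a matrix *)

Section Saturation.
Variables (C : numClosedFieldType) (Om : Type).
Local Notation fps := (fps C).
Local Notation ft := (ft C).
Local Notation bser := (@bser C Om).
Local Notation bnd := (@bnd C Om).
Let SR := bser_ring C Om.
Let BR := bnd_ring C Om.

(** A permutation other than the identity moves some [i != i0], and there it meets a zero entry. *)
Lemma det_row_id n (A : 'M[fps]_n) i0 :
  (forall i j, i != i0 -> A i j = if i == j then ft else 0) -> A i0 i0 = 1 ->
  \det A = ft ^+ n.-1.
Proof.
move=> HA HA0; rewrite /determinant (bigD1 (1%g : 'S_n)) //= [X in _ + X]big1 => [|s s1].
  rewrite odd_perm1 expr0 mul1r addr0 (bigD1 i0) //= perm1 HA0 mul1r.
  rewrite (eq_bigr (fun=> ft)) => [|i ne]; last by rewrite perm1 HA // eqxx.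
  by rewrite prodr_const cardC1 card_ord.
have [i ne0 ne] : exists2 i, i != i0 & s i != i.
  apply: contrapT => H; case/eqP: s1; apply/permP => i; rewrite perm1.
  have H' j : j != i0 -> s j = j.
    by move=> jn; apply/eqP/negPn/negP => nj; apply: H; exists j.
  have [->|/H'//] := eqVneq i i0.
  apply/eqP/negPn/negP => ne; have /perm_inj E := H' _ ne.
  by rewrite E eqxx in ne.
by rewrite (bigD1 i) //= HA // eq_sym (negPf ne) mul0r mulr0.
Qed.

(* One step of saturation: a left kernel vector of the reduction of [V],
   normalised to have sup norm 1, gives a combination of rows divisible by t. *)
Lemma saturate_step n (V : 'M[fps]_n) h : \det V = ft * h ->
  exists A W : 'M[fps]_n, [/\ forall i j m, `|fc (A i j) m| <= 1 :> C,
    ft *: W = A *m V & ft * \det W = \det V].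
Proof.
case: n V => [|n] V dV.
  move/(congr1 (@fev C)): dV; rewrite det_mx00 rmorph1 rmorphM /= fev_t mul0r.
  by move/eqP; rewrite oner_eq0.
have /eqP/det0P[v v0 vV] : \det (map_mx (@fev C) V) = 0.
  by rewrite det_map_mx dV rmorphM /= fev_t mul0r.
have [i0 _ Hi0] := @real_arg_maxP C _ (@ord0 n) predT (fun i => `|v 0 i|) isT
  (fun i _ => normr_real _).
have vi0 : v 0 i0 != 0.
  apply: contra_neq v0 => E; apply/rowP => j; rewrite mxE; apply/eqP.
  have := Hi0 j isT; rewrite /= E normr0 normr_le0 => H; exact: H.
pose q j := v 0 j / v 0 i0.
have qV j : fc (\sum_l fcst (q l) * V l j) 0 = 0.
  rewrite fc_sum; move/rowP/(_ j): vV; rewrite !mxE => E.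
  rewrite (eq_bigr (fun l => (v 0 i0)^-1 * (v 0 l * map_mx (@fev C) V l j))).
    by rewrite -mulr_sumr E mulr0.
  by move=> l _; rewrite fcstM mxE /q [v 0 l / _]mulrC -mulrA.
pose A : 'M[fps]_n.+1 := \matrix_(i, j) if i == i0 then fcst (q j) else if i == j then ft else 0.
pose W : 'M[fps]_n.+1 := \matrix_(i, j) if i == i0
   then Fps (fun m => fc (\sum_l fcst (q l) * V l j) (m + 1)) else V i j.
have E : ft *: W = A *m V.
  apply/matrixP => i j; rewrite !mxE; have [->|ne] := eqVneq i i0.
    under [RHS]eq_bigr do rewrite mxE eqxx.
    rewrite [RHS](@fps_divt _ _ 1) ?expr1 //.
    by move=> [|m] // _; rewrite qV.
  rewrite (bigD1 i) //= mxE (negPf ne) eqxx [X in _ = _ + X]big1 ?addr0 // => l nl.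
  by rewrite mxE (negPf ne) eq_sym (negPf nl) mul0r.
exists A, W; split=> //.
  move=> i j m; rewrite mxE; case: ifP => _.
    rewrite fc_fcst; case: ifP => _; last by rewrite normr0.
    by rewrite normrM normfV ler_pdivrMr ?normr_gt0 // mul1r; apply: Hi0.
  case: ifP => _; last by rewrite fc0 normr0.
  by rewrite fc_t; case: (m == 1%N); rewrite ?normr1 ?normr0.
have := congr1 determinant E; rewrite detZ det_mulmx (@det_row_id _ A i0) /=.
- by rewrite exprSr -mulrA => /tX_inj.
- by move=> i j ne; rewrite mxE (negPf ne).
by rewrite mxE eqxx /q divff // rmorph1.
Qed.

(** Each step removes one factor t from the determinant at the cost of a transition matrix with
    coefficients at most 1 in absolute value. The product [A] of [k] such matrices thus stays
    bounded, although nothing is claimed about [W] itself. *)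
Lemma saturate n k (V : Om -> 'M[fps]_n) :
  (forall w, exists h, \det (V w) = ft ^+ k * h) ->
  exists A W : Om -> 'M[fps]_n, fmx bser A /\ forall w, ft ^+ k *: W w = A w *m V w /\
    ft ^+ k * \det (W w) = \det (V w).
Proof.
elim: k V => [|k IH] V HV.
  exists (fun=> 1%:M), V; split.
    by apply: fmx_scalar => //; apply: fr1.
  by move=> w; rewrite expr0 scale1r mul1mx mul1r.
have /choice[AW HAW] w : exists AW : 'M[fps]_n * 'M[fps]_n,
   [/\ forall i j m, `|fc (AW.1 i j) m| <= 1 :> C,
    ft *: AW.2 = AW.1 *m V w & ft * \det AW.2 = \det (V w)].
  have [h] := HV w; rewrite exprS -mulrA => /saturate_step[A [W H]].
  by exists (A, W).
have [w|A [W [HA HW]]] := IH (fun w => (AW w).2).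
  have [_ _ E] := HAW w; have [h] := HV w; rewrite -E exprS -mulrA.
  by move=> /(@tX_inj _ 1) ->; exists h.
exists (fun w => A w *m (AW w).1), W; split.
  apply: fmxM => // i j m; exists 1 => w.
  by have [H _ _] := HAW w; apply: H.
move=> w; have [_ E1 E2] := HAW w; have [E3 E4] := HW w.
rewrite -mulmxA -E1 -scalemxAr -E3 scalerA -exprS; split=> //.
by rewrite -E2 -E4 mulrA -exprS.
Qed.
End Saturation.

(** * Uniform bounds for roots and for leading terms of their differences *)

Section Core.
Variables (C : numClosedFieldType) (Om : Type) (d : nat).
Local Notation fps := (fps C).
Local Notation ft := (ft C).
Local Notation bser := (@bser C Om).
Local Notation bnd := (@bnd C Om).
Let SR := bser_ring C Om.
Let BR := bnd_ring C Om.

Variable zeta : Om -> 'I_d -> fps.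
Let F w : {poly fps} := \prod_(i < d) ('X - (zeta w i)%:P).
Hypothesis bF : forall j, bser (fun w => (F w)`_j).
Let V w : 'M[fps]_d := Vandermonde d (\row_i zeta w i).
Variables (k : nat) (h : Om -> fps) (c : C).
Hypothesis dV : forall w, \det (V w) = ft ^+ k * h w.
Hypothesis c0 : 0 < c.
Hypothesis hc : forall w, c <= `|fc (h w) 0|.

Let dV0 w : \det (V w) != 0.
Proof.
rewrite dV mulf_neq0 ?tX_neq0 //; apply/eqP => E.
by have := hc w; rewrite E fc0 normr0 => /(lt_le_trans c0); rewrite ltxx.
Qed.

(* The elements [x] of the split algebra [fps ^ d] that, up to a power of t,
   are polynomials in [zeta] with bounded coefficients, presented by the matrix
   of multiplication by [t ^+ k x] in the basis of powers of [zeta]. *)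
Definition good (x : Om -> 'I_d -> fps) := exists k, exists2 B, fmx bser B &
  forall w, V w *m diag_mx (\row_i (ft ^+ k * x w i)) = B w *m V w.

Lemma diag_mxD n (a b : 'rV[fps]_n) : diag_mx (a + b) = diag_mx a + diag_mx b.
Proof. by rewrite raddfD. Qed.

Lemma good_cst (a : Om -> fps) : bser a -> good (fun w _ => a w).
Proof.
move=> Ha; exists 0%N, (fun w => (a w)%:M); first exact: fmx_scalar.
move=> w; have -> : \row_(i < d) (ft ^+ 0 * a w) = const_mx (a w).
  by apply/rowP => i; rewrite !mxE expr0 mul1r.
by rewrite diag_const_mx mul_scalar_mx mul_mx_scalar.
Qed.

Lemma good_up x k1 k2 : (k1 <= k2)%N ->
  (exists2 B, fmx bser B &
    forall w, V w *m diag_mx (\row_i (ft ^+ k1 * x w i)) = B w *m V w) ->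
  (exists2 B, fmx bser B &
    forall w, V w *m diag_mx (\row_i (ft ^+ k2 * x w i)) = B w *m V w).
Proof.
move=> le [B HB E]; exists (fun w => ft ^+ (k2 - k1) *: B w).
  by apply: fmxZ => //; exact: bser_cst.
move=> w; rewrite -scalemxAl -E scalemxAr -linearZ /=; congr (_ *m diag_mx _).
by apply/rowP => i; rewrite !mxE mulrA -exprD subnK.
Qed.

Lemma goodD x y : good x -> good y -> good (fun w i => x w i + y w i).
Proof.
move=> [k1 H1] [k2 H2].
have [A HA EA] := good_up (leq_addr k2 k1) H1.
have [B HB EB] := good_up (leq_addl k1 k2) H2.
exists (k1 + k2)%N, (fun w => A w + B w); first exact: fmxD.
move=> w; rewrite mulmxDl -EA -EB -mulmxDr -diag_mxD; congr (_ *m diag_mx _).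
by apply/rowP => i; rewrite !mxE mulrDr.
Qed.

Lemma goodM x y : good x -> good y -> good (fun w i => x w i * y w i).
Proof.
move=> [k1 [A HA EA]] [k2 [B HB EB]].
exists (k1 + k2)%N, (fun w => A w *m B w); first exact: fmxM.
move=> w; rewrite -mulmxA -EB mulmxA -EA -mulmxA mulmx_diag.
congr (_ *m diag_mx _); apply/rowP => i; rewrite !mxE exprD; ring.
Qed.

Lemma goodN x : good x -> good (fun w i => - x w i).
Proof.
move=> Hx; have H1 := good_cst (frN SR (fr1 SR)).
by have := goodM H1 Hx; under eq_fun do under eq_fun do rewrite mulN1r.
Qed.

Lemma goodB x y : good x -> good y -> good (fun w i => x w i - y w i).
Proof. by move=> Hx /goodN; apply: goodD. Qed.

Lemma good_sum n (x : 'I_n -> Om -> 'I_d -> fps) : (forall j, good (x j)) ->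
  good (fun w i => \sum_j x j w i).
Proof.
move=> Hx; suff : forall r, good (fun w i => \sum_(j <- r) x j w i) by apply.
elim=> [|j r IH].
  under eq_fun do under eq_fun do rewrite big_nil.
  exact: good_cst (fr0 SR).
under eq_fun do under eq_fun do rewrite big_cons.
exact: goodD.
Qed.

Lemma goodX x n : good x -> good (fun w i => x w i ^+ n).
Proof.
move=> Hx; elim: n => [|n IH]; first exact: good_cst (fr1 SR).
by under eq_fun do under eq_fun do rewrite exprS; apply: goodM.
Qed.

(** Division by [t ^ n] only raises the exponent in [good]; the bounded matrix stays the same. This
    is what the power of t in the definition is for. *)
Lemma good_divt n x y : good y -> (forall w i, y w i = ft ^+ n * x w i) -> good x.
Proof.
move=> [k' [B HB E]] H; exists (k' + n)%N, B => // w; rewrite -E.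
by congr (_ *m diag_mx _); apply/rowP => i; rewrite !mxE H exprD mulrA.
Qed.

Lemma size_F w : size (F w) = d.+1.
Proof. by rewrite /F -big_enum /= size_prod_XsubC size_enum_ord. Qed.

Lemma F_monic w : F w \is monic. Proof. exact: monic_prod_XsubC. Qed.

(** The matrix is the companion matrix of [F w], whose nontrivial entries are bounded by [bF]. *)
Lemma good_zeta : good zeta.
Proof.
exists 0%N, (fun w => \matrix_(i, j) if i.+1 == d then - (F w)`_j
   else (i.+1 == j)%:R).
  move=> i j; under eq_fun do rewrite mxE.
  by case: (i.+1 == d); [exact: (frN SR (bF j))|exact: bser_cst].
move=> w; apply/matrixP => i j; rewrite mul_mx_diag !mxE expr0 mul1r.
rewrite -exprSr; case: (eqVneq i.+1 d) => [E|ne].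
  have : root (F w) (zeta w j).
    rewrite /root /F horner_prod (bigD1 j) //= !hornerE subrr mul0r //.
  rewrite rootE horner_coef size_F big_ord_recr /=.
  have -> : (F w)`_d = 1 by have := monicP (F_monic w); rewrite lead_coefE size_F.
  rewrite mul1r addrC addr_eq0 E => /eqP ->; rewrite -sumrN.
  by apply: eq_bigr => l _; rewrite !mxE E eqxx mulNr.
have lt : (i.+1 < d)%N by rewrite ltn_neqAle ne ltn_ord.
rewrite (bigD1 (Ordinal lt)) //= !mxE (negPf ne) eqxx mul1r.
rewrite big1 ?addr0 // => l nl; rewrite !mxE (negPf ne) (_ : (i.+1 == l) = false) ?mul0r //.
by rewrite eq_sym; apply: contraNF nl => /eqP E; apply/eqP/val_inj.
Qed.

(** The eigenvalues of the bounded matrix [B w] are the [t ^ k' * x w j]. Scaling by [t ^ k'] moves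
    the constant term of the j-th coefficient of [p], the polynomial with roots [x w j], to index
    [k' * (d - j)] of that of the characteristic polynomial, so it is bounded. The constant terms of
    [x] are roots of the monic reduction of [p], and [bnd_root] applies. *)
Lemma good_ev x i : good x -> bnd (fun w => fc (x w i) 0).
Proof.
move=> [k' [B HB E]].
pose p w : {poly fps} := \prod_(z <- [seq x w j | j <- enum 'I_d]) ('X - z%:P).
pose q w : {poly fps} := char_poly (B w).
have bq j : bser (fun w => (q w)`_j).
  have PR := fr_poly SR; suff : (fun q => forall j, bser (fun w => (q w)`_j)) q by [].
  apply: (fr_det PR) => a b l; suff : bser (fun w => (char_poly_mx (B w) a b)`_l) by [].
  have -> : (fun w => (char_poly_mx (B w) a b)`_l) =
    (fun w => ('X *+ (a == b))`_l - (if l == 0%N then B w a b else 0)).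
    by apply: funext => w; rewrite !mxE coefB coefC.
  apply: (frB SR); first exact: bser_cst.
  by case: (l == 0%N); [exact: HB|exact: bser_cst].
have Eq w : q w = \prod_(z <- [seq x w j | j <- enum 'I_d]) ('X - (ft ^+ k' * z)%:P).
  pose D := diag_mx (\row_i (ft ^+ k' * x w i)).
  have -> : q w = char_poly D.
    (* [V w] need not be invertible over the power series, but its nonzero determinant can be
       cancelled, so [B w] and [D] have the same characteristic polynomial. *)
    have nz : (\det (V w))%:P != 0 by rewrite polyC_eq0.
    apply: (mulIf nz); rewrite [RHS]mulrC /q /char_poly -det_map_mx -!det_mulmx.
    congr (\det _); rewrite /char_poly_mx mulmxBl mulmxBr -!map_mxM /= /D E.
    by rewrite scalar_mxC.
  rewrite char_poly_trig ?diag_mx_is_trig // big_map big_enum /=.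
  by apply: eq_bigr => j _; rewrite !mxE eqxx mulr1n.
have bp j : bnd (fun w => fc (p w)`_j 0).
  have [lt|lt] := leqP j d.
    suff -> : (fun w => fc (p w)`_j 0) = (fun w => fc (q w)`_j (k' * (d - j))%N).
      exact: bq.
    apply: funext => w.
    have := coef_prod_XsubC_scale (ft ^+ k') [seq x w i0 | i0 <- enum 'I_d] j.
    rewrite -Eq -/(p w) size_map size_enum_ord -!exprM mulrC.
    move/(congr1 (fun f => fc f (k' * d)%N)); rewrite !fc_tM ltnn subnn.
    by rewrite ltnNge leq_mul2l lt orbT /= -mulnBr.
  have -> : (fun w => fc (p w)`_j 0) = (fun=> 0).
    apply: funext => w; rewrite nth_default ?fc0 //.
    by rewrite size_prod_XsubC size_map size_enum_ord.
  exact: bnd_cst.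
apply: (@bnd_root _ _ (fun w => map_poly (@fev C) (p w)) d).
- by move=> w; apply/monic_map/monic_prod_XsubC.
- move=> w; have lp : lead_coef (p w) = 1 := lead_coef_prod_XsubC _ predT id.
  rewrite size_map_poly_id0 ?lp ?rmorph1 ?oner_neq0 //.
  by rewrite size_prod_XsubC size_map size_enum_ord.
- by move=> j; under eq_fun do rewrite coef_map; exact: bp.
move=> w; rewrite /p map_prod_XsubC -map_comp root_prod_XsubC.
by apply/mapP; exists i; rewrite ?mem_enum.
Qed.

(** The saturated rows [W] are good, being combinations of powers of [zeta] divided by [t ^ k], so
    [good_ev] bounds their constant terms. The matrix of these has determinant [fc (h w) 0], at
    least [c] in absolute value; by Cramer's rule its inverse is bounded, and applying it to the
    rows gives the unit vectors at [t = 0]. *)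
Lemma idempotents0 : exists eps : 'I_d -> Om -> 'I_d -> fps,
  (forall i, good (eps i)) /\ forall i w l, fc (eps i w l) 0 = (i == l)%:R.
Proof.
have [w|A [W [HA HW]]] := @saturate C Om d k V; first by exists (h w).
have gW j : good (fun w i => W w j i).
  apply: (@good_divt k _ (fun w i => \sum_l A w j l * zeta w i ^+ l)).
    by apply: good_sum => l; apply: goodM (good_cst (HA j l)) (goodX l good_zeta).
  move=> w i; have [/matrixP /(_ j i)] := HW w; rewrite !mxE => -> _.
  by apply: eq_bigr => l _; rewrite !mxE.
pose W0 w := map_mx (@fev C) (W w).
have dW0 w : \det (W0 w) = fc (h w) 0.
  rewrite det_map_mx; have [_] := HW w; rewrite dV => /tX_inj -> //.
have uW w : W0 w \in unitmx.
  rewrite unitmxE dW0 unitfE -normr_gt0; exact: lt_le_trans c0 (hc w).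
have bI i j : bnd (fun w => invmx (W0 w) i j).
  rewrite /invmx; under eq_fun do rewrite uW mxE.
  apply: frM => //; first by under eq_fun do rewrite dW0; apply: bnd_inv c0 hc.
  under eq_fun do rewrite mxE /cofactor.
  apply: frM => //; first exact: bnd_cst.
  apply: fr_det => // a b; under eq_fun do rewrite !mxE.
  exact: good_ev (gW _).
exists (fun i w l => \sum_j fcst (invmx (W0 w) i j) * W w j l); split.
  move=> i; apply: good_sum => j; apply: goodM => //.
  exact/good_cst/bser_fcst.
move=> i w l; have := mulVmx (uW w); move/matrixP/(_ i l); rewrite !mxE => <-.
by rewrite fc_sum; apply: eq_bigr => j _; rewrite fcstM mxE.
Qed.

(* [3 e ^ 2 - 2 e ^ 3] improves the order of approximation of an idempotent. *)
Lemma idempotents m : exists eps : 'I_d -> Om -> 'I_d -> fps,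
  (forall i, good (eps i)) /\
  forall i w l, exists r, eps i w l = (i == l)%:R + ft ^+ m.+1 * r.
Proof.
elim: m => [|m [eps [ge He]]].
  have [eps [ge He]] := idempotents0; exists eps; split=> // i w l.
  exists (Fps (fun n => fc (eps i w l - (i == l)%:R) (n + 1))).
  rewrite -fps_divt; first by rewrite addrC subrK.
  by case=> // _; rewrite fcB He; case: (i == l); rewrite ?fc1 ?fc0 subrr.
exists (fun i w l => eps i w l * eps i w l * (3%:R - 2%:R * eps i w l)); split.
  move=> i; apply: goodM; first exact: goodM.
  apply: goodB; first exact: good_cst (bser_cst _ _).
  by apply: goodM => //; apply: good_cst (bser_cst _ _).
move=> i w l; have [r ->] := He i w l.
rewrite (exprS ft m.+1) !exprS; set T := ft ^+ m; case: (i == l) => /=.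
  exists (- T * r ^+ 2 * 3%:R - 2%:R * T * T * ft * r ^+ 3); ring.
exists (T * r ^+ 2 * (3%:R - 2%:R * (ft * T * r))); ring.
Qed.

(** The approximate idempotents allow the constant term of each component to be subtracted without
    leaving the good elements. The difference is divisible by t, and dividing lowers the index of
    the coefficient by one. *)
Lemma good_bser x i : good x -> bser (fun w => x w i).
Proof.
move=> gx n; elim: n x i gx => [|n IH] x i gx; first exact: good_ev.
(* Precision [t ^ n.+2] leaves the coefficient of index [n.+1] unaltered. *)
have [eps [ge He]] := idempotents n.+1.
pose y w l := x w l - \sum_i fcst (fc (x w i) 0) * eps i w l.
have gy : good y.
  apply: goodB => //; apply: good_sum => j; apply: goodM => //.
  exact/good_cst/bser_fcst/good_ev.
have Hy w l : exists r, y w l = x w l - fcst (fc (x w l) 0) - ft ^+ n.+2 * r.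
  have /choice[r Hr] := He ^~ w ^~ l.
  exists (\sum_j fcst (fc (x w j) 0) * r j); rewrite /y -addrA -opprD; congr (_ - _).
  under eq_bigr do rewrite Hr mulrDr; rewrite big_split /=; congr (_ + _).
    rewrite (bigD1 l) //= eqxx mulr1 big1 ?addr0 // => j /negPf ->.
    by rewrite mulr0.
  by rewrite mulr_sumr; apply: eq_bigr => j _; rewrite mulrCA.
pose x' w l := Fps (fun m => fc (y w l) (m + 1)).
have Ex' w l : y w l = ft ^+ 1 * x' w l.
  apply: fps_divt => -[] // _; have [r ->] := Hy w l.
  by rewrite !fcB fc_tM fc_fcst subrr subr0.
suff -> : (fun w => fc (x w i) n.+1) = (fun w => fc (x' w i) n).
  exact: IH x' i (good_divt gy Ex').
apply: funext => w; rewrite /x' fcE; have [r ->] := Hy w i.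
by rewrite addn1 !fcB fc_tM fc_fcst ltnS leqnn !subr0.
Qed.

Lemma prod_ge_factor (I : finType) (P : pred I) (a : I -> C) B i0 : P i0 ->
  1 <= B -> (forall i, P i -> 0 <= a i <= B) ->
  \prod_(i | P i) a i <= a i0 * B ^+ #|I|.
Proof.
move=> Pi B1 Ha; rewrite (bigD1 i0) //=; have /andP[a0 _] := Ha _ Pi.
apply: ler_wpM2l => //.
have B0 : 0 <= B by apply: le_trans B1.
apply: (@le_trans _ _ (\prod_(i | P i && (i != i0)) B)).
  by apply: ler_prod => i /andP[/Ha].
by rewrite prodr_const ler_weXn2l // max_card.
Qed.

(** The Vandermonde determinant is the product of the differences, so their orders add up to [k] and
    their leading coefficients multiply to [fc (h w) 0], of modulus at least [c]. Each leading
    coefficient has index at most [k] in a difference of bounded series, hence modulus at most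
    [B + B]; a product bounded below with factors bounded above has no small factor. *)
Theorem lead_diff_lower_bound : exists2 c', 0 < c' &
  forall w i j q u, i != j -> zeta w i - zeta w j = ft ^+ q * u -> fc u 0 != 0 ->
    c' <= `|fc u 0|.
Proof.
have [B B1 HB] := bnd_max (fun (x : 'I_d * 'I_k.+1) => good_bser x.1 good_zeta x.2).
have B20 : 1 <= B + B by rewrite (le_trans B1) // lerDl (le_trans ler01 B1).
pose c' := c / (B + B) ^+ #|{: 'I_d * 'I_d}|.
have Bp : 0 < (B + B) ^+ #|{: 'I_d * 'I_d}| by rewrite exprn_gt0 // (lt_le_trans ltr01).
exists c'; first by rewrite divr_gt0.
suff H w (i j : 'I_d) q u : (i < j)%N -> zeta w j - zeta w i = ft ^+ q * u -> fc u 0 != 0 ->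
    c' <= `|fc u 0|.
  move=> w i j q u ne E u0; case: (ltngtP i j) => [lt|lt|eq].
  - rewrite -normrN -fcN; apply: (H w i j q) => //; last by rewrite fcN oppr_eq0.
    by rewrite mulrN -E opprB.
  - exact: (H w j i q).
  - by move: ne; rewrite (val_inj eq) eqxx.
move=> ij E u0; have := dV w; rewrite det_Vandermonde.
under eq_bigr do under eq_bigr do rewrite !mxE.
rewrite pair_big_dep /=.
have /choice[qu Hqu] (p : 'I_d * 'I_d) : exists qu : nat * fps, (p.1 < p.2)%N ->
    zeta w p.2 - zeta w p.1 = ft ^+ qu.1 * qu.2 /\ fc qu.2 0 != 0.
  have [lt|] := boolP (p.1 < p.2)%N; last by exists (0%N, 0).
  have : zeta w p.2 - zeta w p.1 != 0.
    have := dV0 w; rewrite det_Vandermonde; under eq_bigr do under eq_bigr do rewrite !mxE.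
    rewrite pair_big_dep /= => /prodf_neq0 /(_ p); exact.
  by move=> /fps_ord[q' [u' Hu]]; exists (q', u').
have -> : \prod_(p : 'I_d * 'I_d | (p.1 < p.2)%N) (zeta w p.2 - zeta w p.1) =
    ft ^+ (\sum_(p : 'I_d * 'I_d | (p.1 < p.2)%N) (qu p).1) *
    \prod_(p : 'I_d * 'I_d | (p.1 < p.2)%N) (qu p).2.
  rewrite -prodrXr -big_split /=; apply: eq_bigr => p lt.
  by have [] := Hqu p lt.
have h0 : fc (h w) 0 != 0 by rewrite -normr_gt0; apply: lt_le_trans c0 (hc w).
have ev0 : fc (\prod_(p : 'I_d * 'I_d | (p.1 < p.2)%N) (qu p).2) 0 =
    \prod_(p : 'I_d * 'I_d | (p.1 < p.2)%N) fc (qu p).2 0.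
  exact: (rmorph_prod (@fev C)).
move=> /tX_ord_uniq[] //.
  by rewrite ev0; apply/prodf_neq0 => p lt; have [] := Hqu p lt.
move=> Ek Eh; have [E' u'0] := Hqu (i, j) ij; rewrite /= in E'.
have [_ Eu] := tX_ord_uniq u0 u'0 (etrans (esym E) E').
rewrite ler_pdivrMr //; apply: (le_trans (hc w)); rewrite -Eh ev0 normr_prod Eu.
apply: (@prod_ge_factor _ _ (fun p : 'I_d * 'I_d => `|fc (qu p).2 0|) _ (i, j)) => //.
move=> p lt; rewrite normr_ge0 /=; have [Ep _] := Hqu p lt.
have lek : ((qu p).1 < k.+1)%N.
  by rewrite ltnS -Ek (bigD1 p) //= leq_addr.
have -> : fc (qu p).2 0 = fc (zeta w p.2 - zeta w p.1) (qu p).1.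
  by rewrite Ep fc_tM ltnn subnn.
rewrite fcB (le_trans (ler_normB _ _)) // lerD //.
  exact: (HB (p.2, Ordinal lek) w).
exact: (HB (p.1, Ordinal lek) w).
Qed.
End Core.

(** * Discriminants *)

Section Discriminant.

Definition rot_ord m n (k : 'I_(m + n)) : 'I_(m + n) :=
  match split k with
  | inl a => cast_ord (addnC n m) (rshift n a)
  | inr b => cast_ord (addnC n m) (lshift m b)
  end.

Lemma rot_ord_inj m n : injective (@rot_ord m n).
Proof.
move=> k l; rewrite /rot_ord -{2}(splitK k) -{2}(splitK l).
case: (split k) => a; case: (split l) => b /(congr1 val) /=.
- by move/addnI/val_inj ->.
- by move=> E; have := ltn_ord b; rewrite -E ltnNge leq_addr.
- by move=> E; have := ltn_ord a; rewrite E ltnNge leq_addr.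
- by move/val_inj ->.
Qed.

(** This sign is never evaluated; what is used is that it depends on [m] and [n] alone. *)
Definition sylvester_sign m n : bool := perm (@rot_ord_inj m n).

Variable R : idomainType.

(** Multiplying the Sylvester matrix by columns of powers of the roots evaluates its rows there. The
    rows of [p] give 0, so the product is block triangular, with a triangular block of diagonal [L]
    and the Vandermonde matrix scaled by the values of [q]. Keeping the Vandermonde factor on both
    sides covers repeated roots. *)
Lemma sylvester_vandermonde (p q : {poly R}) L (r : 'I_(size p).-1 -> R) :
  p != 0 -> p = L *: \prod_i ('X - (r i)%:P) ->
  let n := (size p).-1 in let m := (size q).-1 in
  resultant p q * ((-1) ^+ sylvester_sign m n * \det (Vandermonde n (\row_i r i))) =
  L ^+ m * \det (Vandermonde n (\row_i r i)) * \prod_i q.[r i].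
Proof.
move=> p0 Ep n m; set V := Vandermonde n _.
pose M : 'M[R]_(m + n) := \matrix_(k, j) match split j with
  | inl a => (k == n + a :> nat)%:R | inr i => r i ^+ k end.
have dM : (-1) ^+ sylvester_sign m n * \det M = \det V.
  pose s := perm (@rot_ord_inj m n).
  have -> : (-1) ^+ sylvester_sign m n * \det M = \det (row_perm s M).
    by rewrite row_permE det_mulmx det_perm.
  have -> : row_perm s M = block_mx 1%:M (\matrix_(k, i) r i ^+ (n + k)) 0 V.
    apply/matrixP => k j; rewrite !mxE permE /rot_ord.
    case: (split k) => a; rewrite !mxE /=; case: (split j) => b; rewrite !mxE //=.
      by rewrite eqn_add2l.
    by rewrite (_ : (_ == _) = false) // ltn_eqF // (leq_trans (ltn_ord a)) ?leq_addr.
  by rewrite det_ublock det1 mul1r.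
have lp : p`_n = L.
  have := congr1 (fun p => lead_coef p) Ep; rewrite lead_coefZ.
  by rewrite (lead_coef_prod_XsubC _ predT r) mulr1 lead_coefE.
have ri i : p.[r i] = 0.
  by rewrite Ep hornerZ horner_prod (bigD1 i) //= hornerXsubC subrr mul0r mulr0.
have sn : size p = n.+1 by rewrite prednK // size_poly_gt0.
have hor (g : {poly R}) (N a : nat) x : (size g + a <= N)%N ->
    \sum_(k < N) (if (a <= k)%N then g`_(k - a) else 0) * x ^+ k = x ^+ a * g.[x].
  move=> le; transitivity (('X^a * g).[x]); last by rewrite hornerM hornerXn.
  have le' : (size ('X^a * g)%R <= N)%N.
    by rewrite (leq_trans (size_polyMleq _ _)) // size_polyXn /= addnC.
  rewrite (horner_coef_wide _ le'); apply: eq_bigr => k _.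
  by rewrite coefXnM ltnNge; case: leqP.
pose U : 'M[R]_m := \matrix_(a, j) if (a <= n + j)%N then p`_(n + j - a) else 0.
have E : Sylvester_mx p q *m M =
   block_mx U 0 (\matrix_(b, j) if (b <= n + j)%N then q`_(n + j - b) else 0)
     (V *m diag_mx (\row_i q.[r i])).
  apply/matrixP => k j; rewrite [LHS]mxE.
  have Erow a : Sylvester_mx p q k a = match split k with
     | inl k => if (k <= a)%N then p`_(a - k) else 0
     | inr k => if (k <= a)%N then q`_(a - k) else 0 end.
    by rewrite Sylvester_mxE; case: (split k) => b; rewrite mulrb.
  under eq_bigr do rewrite Erow mxE.
  have pick (G : nat -> R) (b : 'I_m) :
     \sum_(a < m + n) G a * (a == n + b :> nat)%:R = G (n + b)%N.
    have lt : (n + b < m + n)%N by rewrite addnC ltn_add2r.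
    rewrite (bigD1 (Ordinal lt)) //= eqxx mulr1 big1 ?addr0 // => a ne.
    by rewrite -[(_ == _)]/(a == Ordinal lt) (negPf ne) mulr0.
  rewrite /block_mx [RHS]mxE; case: {Erow} (split k) => a; rewrite [RHS]mxE; case: (split j) => b.
  - by rewrite (pick (fun x => if (a <= x)%N then p`_(x - a) else 0)) mxE.
  - rewrite hor; first by rewrite ri mulr0 mxE.
    by rewrite sn addSnnS addnC leq_add2r.
  - by rewrite (pick (fun x => if (a <= x)%N then q`_(x - a) else 0)) mxE.
  - rewrite hor; first by rewrite mul_mx_diag !mxE.
    rewrite addnC /m; case: (size q) => [|sq] /=; first by rewrite addn0 add0n ltnW.
    by rewrite addnS -addSn [(sq + _)%N]addnC leq_add2r.
have := congr1 determinant E; rewrite det_mulmx det_lblock det_mulmx det_diag.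
have -> : \det U = L ^+ m.
  rewrite det_trig.
    rewrite (eq_bigr (fun=> L)); first by rewrite prodr_const card_ord.
    by move=> a _; rewrite mxE leq_addl addnK.
  apply/is_trig_mxP => a j lt; rewrite mxE; case: leqP => // le.
  by rewrite nth_default // sn; lia.
move=> E'; rewrite -[RHS]mulrA; transitivity (resultant p q * \det M).
  by rewrite -dM [X in _ * X]mulrA -expr2 sqrr_sign mul1r.
by rewrite /resultant E'; congr (_ * (_ * _)); apply: eq_bigr => i _; rewrite mxE.
Qed.

Hypothesis char0 : forall n, n.+1%:R != 0 :> R.

Lemma size_deriv_char0 (p : {poly R}) : size p^`() = (size p).-1.
Proof.
have [lt|le] := ltnP 1 (size p); last first.
  by rewrite (size1_polyC le) derivC size_poly0 size_polyC; case: (_ == 0).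
apply/eqP; rewrite eqn_leq; apply/andP; split.
  apply/leq_sizeP => j le; rewrite coef_deriv nth_default ?mul0rn //.
  by rewrite -(prednK (ltnW lt)) ltnS.
case E : (size p) lt => [|[|n]] //= _; rewrite ltnNge; apply/negP => /leq_sizeP.
move=> /(_ n (leqnn n)); rewrite coef_deriv -mulr_natr => /eqP.
rewrite mulf_eq0 (negPf (char0 n)) orbF => /eqP pn.
have : lead_coef p == 0 by rewrite lead_coefE E pn.
by rewrite lead_coef_eq0 => /eqP p0; rewrite p0 size_poly0 in E.
Qed.

(** For distinct roots the Vandermonde determinant cancels in [sylvester_vandermonde]; for a
    repeated root both sides vanish, as [p] and its derivative share it. *)
Lemma resultant_deriv d (p : {poly R}) L (r : 'I_d -> R) : (0 < d)%N -> L != 0 ->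
  p = L *: \prod_i ('X - (r i)%:P) ->
  resultant p p^`() = (-1) ^+ sylvester_sign d.-1 d * L ^+ (d.-1 + d) *
     \prod_i \prod_(j | j != i) (r i - r j).
Proof.
move=> d0 L0 Ep.
have sp : size p = d.+1.
  by rewrite Ep size_scale // -big_enum /= size_prod_XsubC size_enum_ord.
have p0 : p != 0 by rewrite -size_poly_gt0 sp.
have rt i : root p (r i).
  by rewrite rootE Ep hornerZ horner_prod (bigD1 i) //= hornerXsubC subrr mul0r mulr0.
have dp i : p^`().[r i] = L * \prod_(j | j != i) (r i - r j).
  rewrite Ep derivZ hornerZ (bigD1 i) //= derivM derivXsubC mul1r hornerD hornerM.
  rewrite hornerXsubC subrr mul0r addr0 horner_prod; congr (_ * _).
  by apply: eq_bigr => j _; rewrite hornerXsubC.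
have [inj|/injectivePn[i [j ne Er]]] := boolP (injectiveb r); last first.
  have -> : \prod_i \prod_(j | j != i) (r i - r j) = 0.
    apply/eqP/prodf_eq0; exists i => //; apply/prodf_eq0; exists j.
      by rewrite eq_sym.
    by rewrite Er subrr.
  rewrite mulr0; apply/eqP; rewrite resultant_eq0.
  apply: (@root_size_gt1 _ (r i)); first by rewrite gcdp_eq0 (negPf p0).
  rewrite root_gcd rt rootE dp (bigD1 j) /= 1?eq_sym // Er subrr mul0r mulr0 eqxx //.
have sq : (size p^`()).-1 = d.-1 by rewrite size_deriv_char0 sp.
have := @sylvester_vandermonde p p^`() L; rewrite sq.
have Ed : (size p).-1 = d by rewrite sp.
rewrite Ed => /(_ r p0 Ep) /=.
have dV : \det (Vandermonde d (\row_i r i)) != 0.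
  rewrite det_Vandermonde; apply/prodf_neq0 => i _; apply/prodf_neq0 => j lt.
  rewrite !mxE subr_eq0; apply/eqP => /(injectiveP _ inj) E.
  by rewrite E ltnn in lt.
rewrite mulrA [L ^+ _ * _]mulrC -[RHS]mulrA [RHS]mulrC => /(mulIf dV) H.
set sg := (-1) ^+ _ in H *.
have s0 : sg != 0 by rewrite /sg signr_eq0.
apply: (mulIf s0); rewrite H (eq_bigr _ (fun i _ => dp i)) big_split /=.
rewrite prodr_const card_ord exprD.
have sg2 : sg * sg = 1 by rewrite -expr2 sqrr_sign.
set Q := \prod_(i < d) _; clearbody Q sg.
by rewrite -[LHS]mul1r -sg2 -!mulrA; congr (_ * _); rewrite mulrC -!mulrA.
Qed.

Lemma det_Vandermonde_sqr d (r : 'I_d -> R) : exists b : bool,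
  \prod_i \prod_(j | j != i) (r i - r j) =
    (-1) ^+ b * \det (Vandermonde d (\row_i r i)) ^+ 2.
Proof.
rewrite det_Vandermonde; under [X in X ^+ 2]eq_bigr do under eq_bigr do rewrite !mxE.
pose P (p : 'I_d * 'I_d) := (p.1 < p.2)%N.
have sw : involutive (fun p : 'I_d * 'I_d => (p.2, p.1)) by case.
rewrite !pair_big_dep /= (bigID P) /=.
rewrite (eq_bigl P) => [|p]; last first.
  by rewrite /P; case: ltnP; rewrite ?andbF //= andbT => lt; rewrite -val_eqE /= gtn_eqF.
have -> : \prod_(p : 'I_d * 'I_d | P p) (r p.1 - r p.2) =
   (-1) ^+ #|P| * \prod_(p : 'I_d * 'I_d | P p) (r p.2 - r p.1).
  rewrite -prodr_const -big_split /=; apply: eq_bigr => p _.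
  by rewrite mulN1r opprB.
have -> : \prod_(p : 'I_d * 'I_d | (p.2 != p.1) && ~~ P p) (r p.1 - r p.2) =
   \prod_(p : 'I_d * 'I_d | P p) (r p.2 - r p.1).
  rewrite (reindex_inj (inv_inj sw)) /=; apply: eq_bigl => -[i j].
  by rewrite /P /= -leqNgt -val_eqE /= ltn_neqAle.
exists (odd #|P|); rewrite -signr_odd -mulrA expr2 //.
Qed.

End Discriminant.

(** * Families of polynomials with a monomial discriminant *)

(** The leading coefficients must survive so that the Sylvester matrices keep their size. *)
Lemma rmorph_resultant (R S : nzRingType) (f : {rmorphism R -> S}) (p q : {poly R}) :
  f (lead_coef p) != 0 -> f (lead_coef q) != 0 ->
  f (resultant p q) = resultant (map_poly f p) (map_poly f q).
Proof.
move=> fp fq; rewrite /resultant /Sylvester_mx !size_map_poly_id0 //.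
rewrite -det_map_mx /= map_col_mx; congr (\det (col_mx _ _)).
  by apply: map_lin1_mx => v; rewrite map_poly_rV rmorphM /= map_rVpoly.
by apply: map_lin1_mx => v; rewrite map_poly_rV rmorphM /= map_rVpoly.
Qed.

Lemma prim_root_exists (C : numClosedFieldType) n : (0 < n)%N ->
  exists z : C, n.-primitive_root z.
Proof.
pose p : {poly C} := 'X^n - 1; have [r Dp] := closed_field_poly_normal p.
move=> n_gt0; rewrite (monicP _) ?monicXnsubC // scale1r in Dp.
have rn1 : all n.-unity_root r by apply/allP=> z; rewrite -root_prod_XsubC -Dp.
have sz_r : (n < (size r).+1)%N.
  by rewrite -(size_prod_XsubC r id) -Dp size_XnsubC.
have [|z] := hasP (has_prim_root n_gt0 rn1 _ sz_r); last by exists z.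
by rewrite -separable_prod_XsubC -Dp separable_Xn_sub_1 // pnatr_eq0 -lt0n.
Qed.

Lemma fps_char0 (C : numFieldType) n : n.+1%:R != 0 :> fps C.
Proof.
by rewrite -(rmorph_nat (@fcst C)); apply/eqP => /(congr1 (@fev C)) /eqP; rewrite fev_fcst rmorph0 pnatr_eq0.
Qed.

Lemma fc_frot (K : fieldType) (z : K) f n : fc (frot z f) n = z ^+ n * fc f n.
Proof. by []. Qed.

Section Separation.
Variables (C : numClosedFieldType) (Om : Type).
Local Notation fps := (fps C).
Local Notation ft := (ft C).
Local Notation bser := (@bser C Om).
Local Notation bnd := (@bnd C Om).
Let SR := bser_ring C Om.
Let BR := bnd_ring C Om.

Lemma bser_inv (g : Om -> fps) c : 0 < c -> (forall w, c <= `|fc (g w) 0|) ->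
  bser g -> bser (fun w => (g w)^-1).
Proof.
move=> c0 gc bg; have g0 w : fc (g w) 0 != 0.
  by rewrite -normr_gt0 (lt_le_trans c0).
have bi := bnd_inv c0 gc.
have E w : g w * (g w)^-1 = 1 by rewrite mulrV // fps_unitE.
elim/ltn_ind => n IH.
have -> : (fun w => fc (g w)^-1 n) = (fun w => (fc (g w) 0)^-1 *
    ((n == 0%N)%:R - \sum_(i < n) fc (g w) i.+1 * fc (g w)^-1 (n - i.+1))).
  apply: funext => w; have := congr1 (fun f => fc f n) (E w).
  rewrite fcM big_ord_recl subn0 fc1 => <-.
  rewrite /bump /= addrK mulrA mulVf // mul1r //.
apply: frM => //; apply: frB => //; first exact: bnd_cst.
by apply: fr_sum => // i _; apply: frM => //; apply: IH; rewrite ltn_subrL /= (leq_ltn_trans _ (ltn_ord i)).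
Qed.

Lemma fc_fsub_mull N (f : fps) i : fc (fsubS N f) (N.+1 * i) = fc f i.
Proof. by rewrite /fsubS /fsub fcE dvdn_mulr // mulKn. Qed.

Lemma fc_fsub0 N (f : fps) : fc (fsubS N f) 0 = fc f 0.
Proof. by rewrite -[RHS](@fc_fsub_mull N) muln0. Qed.

Lemma bser_fsub N (g : Om -> fps) : bser g -> bser (fun w => fsubS N (g w)).
Proof.
by move=> bg n; rewrite /fsubS /fsub; under eq_fun do rewrite fcE; case: (_ %| _)%N; [exact: bg|exact: bnd_cst].
Qed.

Lemma frot_fsub N (z : C) (f : fps) : z ^+ N.+1 = 1 -> frot z (fsubS N f) = fsubS N f.
Proof.
move=> z1; apply: fpsP => n; rewrite fc_frot /fsubS /fsub !fcE.
by case: ifP => [/dvdnP[k ->]|_]; rewrite ?mulr0 // mulnC exprM z1 expr1n mul1r.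
Qed.

Lemma frot_t (z : C) q (v : fps) :
  frot z (ft ^+ q * v) = ft ^+ q * (fcst (z ^+ q) * frot z v).
Proof.
apply: fpsP => n; rewrite fc_tM fcstM !fc_frot fc_tM; case: ltnP => le.
  by rewrite mulr0.
by rewrite mulrA -exprD subnKC.
Qed.

(* Newton polygon: the coefficients of [L \prod_i (X - t ^ q_i v_i)] of weight
   less than [\sum_i q_i], where [X] has weight [M], vanish, and one of that
   weight is [+- L(0)] times the product of the leading terms of slope < M. *)
Lemma newton_weight d M (L : fps) (q : 'I_d -> nat) (v : 'I_d -> fps) :
  (forall i, q i <= M)%N ->
  let P := L *: \prod_i ('X - (ft ^+ q i * v i)%:P) in
  let s := (\sum_i q i)%N in
  (forall j n, (n < s)%N -> fc (P`_j * ft ^+ (M * j)) n = 0) /\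
  (exists J, `|fc (P`_J * ft ^+ (M * J)) s| =
     `|fc L 0| * \prod_(i | (q i < M)%N) `|fc (v i) 0|).
Proof.
move=> qM P s.
(* [g] comes from [P] by putting [t ^ M * X] for X and dividing the i-th factor by [t ^ q i]. *)
pose g := L *: \prod_i ((ft ^+ (M - q i)) *: 'X - (v i)%:P).
have E j : P`_j * ft ^+ (M * j) = ft ^+ s * g`_j.
  transitivity ((P \Po (ft ^+ M *: 'X))`_j).
    rewrite comp_polyE coef_sum.
    have E0 (i : nat) : (P`_i *: (ft ^+ M *: 'X) ^+ i)`_j =
        P`_i * (ft ^+ (M * i) * (j == i)%:R).
      by rewrite exprZn [LHS]coefZ [X in _ * X]coefZ coefXn exprM.
    under eq_bigr do rewrite E0.
    have [lt|le] := ltnP j (size P); last first.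
      rewrite nth_default // mul0r big1 // => i _.
      by rewrite gtn_eqF ?mulr0 // (leq_trans (ltn_ord i) le).
    rewrite (bigD1 (Ordinal lt)) //= eqxx mulr1 big1 ?addr0 // => i ne.
    by rewrite (_ : (j == i) = false) ?mulr0 // eq_sym; apply: negbTE.
  have -> : P \Po (ft ^+ M *: 'X) = ft ^+ s *: g; last by rewrite coefZ.
  rewrite /P /g comp_polyZ scalerA mulrC -scalerA; congr (_ *: _).
  rewrite rmorph_prod /= /s -prodrXr -scaler_prod; apply: eq_bigr => i _.
  rewrite comp_polyB comp_polyX comp_polyC scalerBr scalerA -exprD subnKC //.
  by congr (_ - _); rewrite -mul_polyC polyCM.
split=> [j n lt|]; first by rewrite E fc_tM lt.
(* At [t = 0] the factors of slope below [M] become constants and the others stay monic of degree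
   one; [J] counts the latter, so the J-th coefficient is the leading one. *)
pose J := #|[pred i : 'I_d | ~~ (q i < M)%N]|; exists J.
rewrite E fc_tM ltnn subnn.
have -> : fc g`_J 0 = (map_poly (@fev C) g)`_J by rewrite coef_map.
have -> : map_poly (@fev C) g = (fc L 0 * \prod_(i | (q i < M)%N) - fc (v i) 0) *:
    \prod_(i | ~~ (q i < M)%N) ('X - (fc (v i) 0)%:P).
  rewrite /g map_polyZ rmorph_prod /= -scalerA; congr (_ *: _).
  rewrite (bigID (fun i => (q i < M)%N)) /= -mul_polyC rmorph_prod /=.
  congr (_ * _); apply: eq_bigr => i.
    move=> lt; rewrite rmorphB /= map_polyZ map_polyX map_polyC /= rmorphXn /= fev_t.
    by rewrite expr0n subn_eq0 leqNgt lt /= scale0r sub0r polyCN.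
  rewrite -leqNgt => le; have -> : (M - q i = 0)%N by apply/eqP; rewrite subn_eq0.
  by rewrite expr0 scale1r map_polyXsubC.
have -> : \prod_(i | ~~ (q i < M)%N) ('X - (fc (v i) 0)%:P) =
    \prod_(i <- enum [pred i : 'I_d | ~~ (q i < M)%N]) ('X - (fc (v i) 0)%:P).
  by rewrite big_enum.
rewrite coefZ.
have -> : (\prod_(i <- enum [pred i : 'I_d | ~~ (q i < M)%N]) ('X - (fc (v i) 0)%:P))`_J = 1.
  rewrite /J cardE -[size _]/((size _).+1.-1) -(size_prod_XsubC _ (fun i => fc (v i) 0)).
  by rewrite -lead_coefE lead_coef_prod_XsubC.
rewrite mulr1 normrM normr_prod; congr (_ * _).
by apply: eq_bigr => i _; rewrite normrN.
Qed.

Variables (d e : nat) (G : Om -> {poly fps}) (u : Om -> fps) (c : C).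
Hypothesis d0 : (0 < d)%N.
Hypothesis sG : forall w, size (G w) = d.+1.
Hypothesis bG : forall j, bser (fun w => (G w)`_j).
Hypothesis c0 : 0 < c.
Hypothesis lG : forall w, c <= `|fc (lead_coef (G w)) 0|.
Hypothesis rG : forall w, resultant (G w) (G w)^`() = ft ^+ e * u w.
Hypothesis uc : forall w, c <= `|fc (u w) 0|.

Let lead0 w : fc (lead_coef (G w)) 0 != 0.
Proof. by rewrite -normr_gt0 (lt_le_trans c0). Qed.

Lemma puiseux_family : exists N, exists zeta : Om -> 'I_d -> fps, forall w,
  map_poly (@fsubS C N) (G w) =
    fsubS N (lead_coef (G w)) *: \prod_i ('X - (zeta w i)%:P).
Proof.
have [N HN] := puiseux C d; exists N.
suff : forall w, exists z : 'I_d -> fps, map_poly (@fsubS C N) (G w) =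
    fsubS N (lead_coef (G w)) *: \prod_i ('X - (z i)%:P) by move=> /choice[z Hz]; exists z.
move=> w; pose f := (lead_coef (G w))^-1 *: G w.
have ul : lead_coef (G w) \is a GRing.unit by rewrite fps_unitE.
have l0 : (lead_coef (G w))^-1 != 0.
  by rewrite invr_eq0 lead_coef_eq0 -size_poly_gt0 sG.
have mf : f \is monic by rewrite monicE lead_coefZ mulVr.
have sf : size f = d.+1 by rewrite size_scale.
have [rs Ers] := HN f mf (eq_leq sf).
have Er : size rs = d.
  have := size_map_poly_id0 (f := @fsubS C N) (p := f).
  rewrite (monicP mf) rmorph1 oner_neq0 => /(_ isT); rewrite Ers sf.
  by rewrite size_prod_XsubC => -[].
exists (fun i => rs`_i).
have -> : G w = lead_coef (G w) *: f by rewrite scalerA mulrV // scale1r.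
rewrite map_polyZ Ers lead_coefZ (monicP mf) mulr1; congr (_ *: _).
by rewrite (big_nth 0) big_mkord Er.
Qed.

Variables (N : nat) (zeta : Om -> 'I_d -> fps).
Hypothesis Gz : forall w, map_poly (@fsubS C N) (G w) =
    fsubS N (lead_coef (G w)) *: \prod_i ('X - (zeta w i)%:P).

Let lN0 w : fsubS N (lead_coef (G w)) != 0.
Proof.
apply/eqP => /(congr1 (fun f => fc f (N.+1 * 0))); rewrite fc_fsub_mull => /eqP.
by rewrite (negPf (lead0 w)).
Qed.

Lemma bser_roots_poly j : bser (fun w => (\prod_i ('X - (zeta w i)%:P))`_j).
Proof.
have -> : (fun w => (\prod_i ('X - (zeta w i)%:P))`_j) =
    (fun w => fsubS N ((lead_coef (G w))^-1 * (G w)`_j)).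
  apply: funext => w; apply: (mulfI (lN0 w)).
  by rewrite -coefZ -Gz coef_map -rmorphM mulrA mulrV ?fps_unitE // mul1r.
apply: bser_fsub; apply: (frM SR _ (bG j)); apply: (bser_inv c0 lG).
have -> : (fun w => lead_coef (G w)) = (fun w => (G w)`_d).
  by apply: funext => w; rewrite lead_coefE sG.
exact: bG.
Qed.

(** Up to sign, the resultant is a power of the leading coefficient times the square of the
    Vandermonde determinant. Comparing orders in t and constant terms after the substitution gives
    both the common exponent, half of [N.+1 * e], and the lower bound. *)
Lemma det_roots_lower : exists k, exists h : Om -> fps, exists2 c1, 0 < c1 &
  forall w, \det (Vandermonde d (\row_i zeta w i)) = ft ^+ k * h w /\
     c1 <= `|fc (h w) 0|.
Proof.
pose L w := fsubS N (lead_coef (G w)).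
have fs0 (f : fps) : fc (fsubS N f) 0 = fc f 0 by rewrite -{1}(muln0 N.+1) fc_fsub_mull.
have E w : exists b : bool, L w ^+ (d.-1 + d) *
    \det (Vandermonde d (\row_i zeta w i)) ^+ 2 =
    ft ^+ (N.+1 * e) * ((-1) ^+ b * fsubS N (u w)).
  have [b Hb] := det_Vandermonde_sqr (zeta w).
  have := resultant_deriv (@fps_char0 C) d0 (lN0 w) (Gz w); rewrite Hb.
  have -> : resultant (map_poly (@fsubS C N) (G w)) (map_poly (@fsubS C N) (G w))^`() =
      fsubS N (resultant (G w) (G w)^`()).
    rewrite deriv_map; symmetry; apply: rmorph_resultant; first exact: lN0.
    rewrite lead_coefE size_deriv_char0; last exact: fps_char0.
    rewrite sG coef_deriv -(prednK d0) /= prednK // rmorphMn /= -mulr_natr.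
    rewrite mulf_neq0 //; first by have := lN0 w; rewrite lead_coefE sG.
    by rewrite -(prednK d0) fps_char0.
  rewrite rG rmorphM rmorphXn /= fsub_t -exprM => H.
  exists (sylvester_sign d.-1 d (+) b).
  rewrite [RHS]mulrCA H signr_addb; set s1 := (-1) ^+ sylvester_sign _ _.
  set s2 := (-1) ^+ b; have s11 : s1 * s1 = 1 by rewrite -expr2 sqrr_sign.
  have s22 : s2 * s2 = 1 by rewrite -expr2 sqrr_sign.
  clearbody s1 s2.
  transitivity ((s1 * s1) * (s2 * s2) * (L w ^+ (d.-1 + d) *
    \det (Vandermonde d (\row_i zeta w i)) ^+ 2)).
    by rewrite s11 s22 !mul1r.
  by rewrite /L; ring.
have [lB lB1 HlB] := bnd_max (fun _ : unit => bG d 0).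
pose b := c / lB ^+ (d.-1 + d).
have lBp : 0 < lB ^+ (d.-1 + d) by rewrite exprn_gt0 // (lt_le_trans ltr01).
have bp : 0 < b by rewrite divr_gt0.
exists (N.+1 * e)./2.
(* From [b <= |h| ^ 2] follows [b / (1 + b) <= |h|], whether [|h|] is below or above 1; no square
   root is needed. *)
suff /choice[h Hh] : forall w, exists h : fps,
   \det (Vandermonde d (\row_i zeta w i)) = ft ^+ (N.+1 * e)./2 * h /\
     b / (1 + b) <= `|fc h 0|.
  by exists h, (b / (1 + b)); rewrite ?divr_gt0 ?addr_gt0.
move=> w; have [sg Hsg] := E w.
have u0 : fc (u w) 0 != 0 by rewrite -normr_gt0 (lt_le_trans c0).
have R0 : fc ((-1) ^+ sg * fsubS N (u w)) 0 != 0.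
  rewrite fcM0 fs0 mulf_neq0 //; case: (sg); rewrite ?expr0 ?expr1 ?fcN ?oppr_eq0 oner_eq0 //.
have dn0 : \det (Vandermonde d (\row_i zeta w i)) != 0.
  apply/eqP => H; move: Hsg; rewrite H expr0n mulr0 => /esym/tX_mul0 H'.
  by rewrite H' fc0 eqxx in R0.
have [k [h [Ek h0]]] := fps_ord dn0.
have := Hsg; rewrite Ek exprMn -exprM mulrCA => /tX_ord_uniq[] //.
  have Lw : fc (L w) 0 != 0 by rewrite /L fs0 lead0.
  have fX (f : fps) n : fc f 0 != 0 -> fc (f ^+ n) 0 != 0.
    by move=> f0; rewrite -/(fev _) rmorphXn expf_neq0.
  by rewrite fcM0 mulf_neq0 ?fX.
move=> Ek2 Eh; exists h; rewrite -Ek2 muln2 doubleK; split=> //.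
have H : b <= `|fc h 0| ^+ 2.
  rewrite ler_pdivrMr // (le_trans (uc w)) //.
  have := congr1 (fun f => `|fc f 0|) Eh; rewrite !fcM0 fs0 !normrM.
  have -> : `|fc ((-1) ^+ sg : fps) 0| = 1.
    by case: (sg); rewrite ?expr0 ?expr1 ?fcN ?normrN fc1 normr1.
  rewrite mul1r => <-; rewrite -!/(fev _) !rmorphXn !normrX /= mulrC /fev.
  rewrite -expr2; apply: ler_wpM2l; first exact: exprn_ge0.
  rewrite lerXn2r ?nnegrE // ?(le_trans ler01) // /L fs0 lead_coefE sG.
  exact: (HlB tt w).
rewrite ler_pdivrMr ?addr_gt0 //.
have [le1|ge1] := real_leP (normr_real (fc h 0)) (real1 C).
  rewrite (le_trans H) // expr2 ler_wpM2l // (le_trans le1) // lerDl ltW //.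
rewrite (le_trans _ (_ : 1 * (1 + b) <= _)) //.
  by rewrite mul1r lerDr.
by rewrite ler_wpM2r // ?ltW // addr_gt0.
Qed.

Lemma root_red_zeta w z : root (map_poly (@fev C) (G w)) z ->
  exists i, z = fc (zeta w i) 0.
Proof.
have -> : map_poly (@fev C) (G w) =
    map_poly (@fev C) (map_poly (@fsubS C N) (G w)).
  by apply/polyP => j; rewrite !coef_map /= /fev fc_fsub0.
have lz : fev (fsubS N (lead_coef (G w))) != 0 by rewrite /fev fc_fsub0 lead0.
rewrite Gz map_polyZ rootZ //.
rewrite rmorph_prod /= rootE horner_prod => /eqP/eqP/prodf_eq0[i _].
by rewrite map_polyXsubC hornerXsubC subr_eq0 => /eqP ->; exists i.
Qed.

Variable c1 : C.
Hypothesis c10 : 0 < c1.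
Hypothesis zc1 : forall w i j q v, i != j -> zeta w i - zeta w j = ft ^+ q * v ->
  fc v 0 != 0 -> c1 <= `|fc v 0|.

(** The substitution of [z * t] for t, with [z] a primitive root of unity of order [N.+1], permutes
    the roots and fixes constants. Hence [(z ^ q - 1) * v] starts the difference of two roots, and
    [z ^ q - 1] is nonzero of modulus at most 2. For [q = 0] the difference of [zeta w i] and
    [zeta w l] itself is used. *)
Lemma lead_lower w l i q v : (q <= N.+1)%N ->
  zeta w i - fcst (fc (zeta w l) 0) = ft ^+ q * v -> (q < N.+1)%N ->
  fc v 0 != 0 -> c1 / 2%:R <= `|fc v 0|.
Proof.
move=> qN E lt v0; rewrite ler_pdivrMr ?ltr0n //.
have v2 : `|fc v 0| <= `|fc v 0| * 2%:R by rewrite ler_peMr // ler1n.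
have [q0|q0] := posnP q.
  apply: le_trans v2; have il : i != l.
    apply: contraNneq v0 => il; have := congr1 (fun f => fc f 0) E.
    by rewrite q0 expr0 mul1r fcB fc_fcst il subrr => <-.
  have -> : fc v 0 = fc (zeta w i - zeta w l) 0.
    have := congr1 (fun f => fc f 0) E.
    by rewrite q0 expr0 mul1r !fcB fc_fcst => <-.
  apply: (@zc1 w i l 0%N) => //; first by rewrite expr0 mul1r.
  have := congr1 (fun f => fc f 0) E.
  by rewrite q0 expr0 mul1r !fcB fc_fcst => ->.
have [z pz] := prim_root_exists C (ltn0Sn N).
have zq : z ^+ q - 1 != 0.
  rewrite subr_eq0 -(expr0 z) (eq_prim_root_expr pz) mod0n modn_small //.
  by rewrite -lt0n.
have zn : `|z| = 1.
  have := prim_expr_order pz => /(congr1 Num.norm); rewrite normrX normr1 => /eqP.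
  by rewrite pexpr_eq1 // => /eqP.
have [j Ej] : exists j, frot z (zeta w i) = zeta w j.
  have H : \prod_j ('X - (zeta w j)%:P) =
      map_poly (frot z) (\prod_j ('X - (zeta w j)%:P)).
    have fl : frot z (fsubS N (lead_coef (G w))) = fsubS N (lead_coef (G w)).
      by apply: frot_fsub; exact: prim_expr_order pz.
    have := congr1 (map_poly (frot z)) (Gz w); rewrite map_polyZ /= fl.
    have -> : map_poly (frot z) (map_poly (fsubS N) (G w)) = map_poly (fsubS N) (G w).
      apply/polyP => k; rewrite !coef_map /=.
      by apply: frot_fsub; exact: prim_expr_order pz.
    rewrite Gz => /(congr1 (fun p : {poly fps} => p)) H.
    apply/polyP => k; have := congr1 (fun p : {poly fps} => p`_k) H.
    by rewrite !coefZ => /(mulfI (lN0 w)).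
  have : (\prod_j ('X - (zeta w j)%:P)).[frot z (zeta w i)] = 0.
    rewrite H rmorph_prod horner_prod (bigD1 i) //= map_polyXsubC hornerXsubC.
    by rewrite subrr mul0r.
  rewrite horner_prod => /eqP/prodf_eq0[j _]; rewrite hornerXsubC subr_eq0 => /eqP.
  by exists j.
have E2 : zeta w j - zeta w i = ft ^+ q * (fcst (z ^+ q) * frot z v - v).
  rewrite mulrBr -E -frot_t -E rmorphB /= Ej.
  have -> : frot z (fcst (fc (zeta w l) 0)) = fcst (fc (zeta w l) 0).
    apply: fpsP => n; rewrite fc_frot fc_fcst; case: n => [|n]; rewrite ?mul1r ?mulr0 //.
  by rewrite opprB addrA subrK.
have E3 : fc (fcst (z ^+ q) * frot z v - v) 0 = (z ^+ q - 1) * fc v 0.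
  by rewrite fcB fcstM fc_frot expr0 mul1r mulrBl mul1r.
have ne : j != i.
  apply/eqP => ji; move: E2; rewrite ji subrr => /esym/tX_mul0 /(congr1 (fun f => fc f 0)).
  by rewrite E3 => /eqP; rewrite mulf_eq0 (negPf zq) (negPf v0).
have := zc1 ne E2; rewrite E3 mulf_neq0 // => /(_ isT) H; apply: (le_trans H).
rewrite normrM mulrC; apply: ler_wpM2l => //.
by rewrite (le_trans (ler_normB _ _)) // normrX zn expr1n normr1.
Qed.

(** Coefficient of [t ^ i * y ^ j] in the expansion of [g] at [z + y]. *)
Definition kap (g : {poly fps}) (z : C) i j : C :=
  fc (g \Po ('X + (fcst z)%:P))`_j i.

(** Give t and y the weight [M], in units of the M-th root of t. By [newton_weight] the lowest
    weight occurring is the sum of the slopes cut off at [M], and it is attained by a coefficient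
    whose modulus is that of the leading coefficient times the leading terms of slope below [M];
    [lead_lower] bounds the latter from below. *)
Lemma newton_lower w z k m : 0 < m -> m <= 1 -> m <= c1 / 2%:R -> root (map_poly (@fev C) (G w)) z ->
  (exists i j, (i + j < k)%N /\ kap (G w) z i j != 0) ->
  exists i j, (i + j < k)%N /\
    c * m ^+ d <= `|kap (G w) z i j|.
Proof.
move=> m0 m1 mc /root_red_zeta[l El] [i [j [ijk nz]]].
set M := N.+1; pose L := fsubS N (lead_coef (G w)).
(* Roots of order at least [M] are recorded with slope exactly [M]; their second component may then
   vanish at 0, hence the guard. *)
have /choice[qv Hqv] (a : 'I_d) : exists qv : nat * fps, [/\ (qv.1 <= M)%N,
    zeta w a - fcst z = ft ^+ qv.1 * qv.2 & (qv.1 < M)%N -> fc qv.2 0 != 0].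
  have [->|/fps_ord[q [v [-> v0]]]] := eqVneq (zeta w a - fcst z) 0.
    by exists (M, 0); rewrite mulr0 /= leqnn ltnn.
  have [le|lt] := leqP q M; first by exists (q, v).
  exists (M, ft ^+ (q - M) * v); rewrite /= ltnn mulrA -exprD subnKC ?leqnn //.
  exact: ltnW.
have [|H1 [J HJ]] := @newton_weight d M L (fun a => (qv a).1) (fun a => (qv a).2).
  by move=> a; have [] := Hqv a.
set P := _ *: _ in H1 HJ; set s := (\sum_a _)%N in H1 HJ.
pose Gt := G w \Po ('X + (fcst z)%:P).
have EP b : P`_b = fsubS N Gt`_b.
  have -> : P = map_poly (@fsubS C N) Gt.
    rewrite /Gt map_comp_poly Gz rmorphD /= map_polyX map_polyC /=.
    have -> : fsubS N (fcst z) = fcst z.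
      apply: fpsP => n; rewrite /fsubS /fsub fcE !fc_fcst.
      case: n => [|n]; first by rewrite dvdn0 div0n.
      by case: ifP => // /dvdnP[[|b']] // ->; rewrite mulnK.
    rewrite comp_polyZ /P /L; congr (_ *: _); rewrite rmorph_prod /=.
    apply: eq_bigr => a _; rewrite comp_polyB comp_polyX comp_polyC.
    by have [_ <- _] := Hqv a; rewrite polyCB opprB addrA addrAC.
  by rewrite coef_map.
have Ek a b : kap (G w) z a b = fc (P`_b * ft ^+ (M * b)) (M * (a + b)).
  rewrite EP mulrC fc_tM ltnNge leq_mul2l leq_addl orbT /=.
  by rewrite -mulnBr addnK fc_fsub_mull.
have sk : (s <= M * (i + j))%N.
  by rewrite leqNgt; apply/negP => /(H1 j); rewrite -Ek; apply/eqP.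
have prod_ge : m ^+ d <= \prod_(a | ((qv a).1 < M)%N) `|fc (qv a).2 0|.
  apply: (@le_trans _ _ (\prod_(a | ((qv a).1 < M)%N) m)).
    rewrite prodr_const; apply: ler_wiXn2l => //; first exact: ltW.
    by rewrite -[X in (_ <= X)%N](card_ord d) max_card.
  apply: ler_prod => a lt; rewrite ltW //=; apply: (le_trans mc).
  have [q1 q2 q3] := Hqv a; rewrite El in q2.
  exact: lead_lower q1 q2 lt (q3 lt).
have Hs : c * m ^+ d <= `|fc (P`_J * ft ^+ (M * J)) s|.
  rewrite HJ; apply: ler_pM => //; [exact: ltW|exact/exprn_ge0/ltW|].
  by rewrite /L fc_fsub0.
have nz2 : fc (P`_J * ft ^+ (M * J)) s != 0.
  by rewrite -normr_gt0 (lt_le_trans _ Hs) // mulr_gt0 // exprn_gt0.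
have Js : (M * J <= s)%N.
  by rewrite leqNgt; apply: contra nz2 => lt; rewrite mulrC fc_tM lt.
(* A nonzero coefficient of a series in [t ^ M] sits at a multiple of [M], so the weight [s] is a
   genuine total degree times [M]. *)
have /dvdnP[s' Es] : (M %| s)%N.
  move: nz2; rewrite mulrC fc_tM ltnNge Js /= EP /fsubS /fsub fcE.
  case: ifP => [dv _|]; last by rewrite eqxx.
  by rewrite -(subnK Js) dvdn_add // dvdn_mulr.
have Js' : (J <= s')%N by rewrite -(leq_pmul2l (ltn0Sn N)) [(_ * s')%N]mulnC -Es.
exists (s' - J)%N, J; rewrite Ek subnK // [(M * s')%N]mulnC -Es; split=> //.
apply: leq_ltn_trans ijk; rewrite -(leq_pmul2l (ltn0Sn N)) [(_ * s')%N]mulnC -Es //.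
Qed.

End Separation.

(* The last clause says, quantitatively, that the order of [G w] at [(0, z)] is
   read off coefficients that are uniformly large. *)
Theorem separation (C : numClosedFieldType) (Om : Type) d e
    (G : Om -> {poly fps C}) (u : Om -> fps C) (c : C) :
  (0 < d)%N -> (forall w, size (G w) = d.+1) ->
  (forall j, bser (fun w => (G w)`_j)) -> 0 < c ->
  (forall w, c <= `|fc (lead_coef (G w)) 0|) ->
  (forall w, resultant (G w) (G w)^`() = ft C ^+ e * u w) ->
  (forall w, c <= `|fc (u w) 0|) ->
  exists2 c' : C, 0 < c' & forall w,
    (forall z z', root (map_poly (@fev C) (G w)) z ->
       root (map_poly (@fev C) (G w)) z' -> z != z' -> c' <= `|z - z'|) /\
    (forall z k, root (map_poly (@fev C) (G w)) z ->
      (exists i j, (i + j < k)%N /\ kap (G w) z i j != 0) ->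
      exists i j, (i + j < k)%N /\ c' <= `|kap (G w) z i j|).
Proof.
move=> d0 sG bG c0 lG rG uc.
have [N [zeta Gz]] := puiseux_family sG c0 lG.
have [k [h [c1 c10 H1]]] := det_roots_lower d0 sG bG c0 lG rG uc Gz.
have [c2 c20 H2] := lead_diff_lower_bound (bser_roots_poly sG bG c0 lG Gz)
  (fun w => proj1 (H1 w)) c10 (fun w => proj2 (H1 w)).
(* Since the order of [C] is partial, [x / (1 + x)] and [a * b / (a + b)] stand in for minima of
   positive elements. *)
pose m := (c2 / 2%:R) / (1 + c2 / 2%:R).
have c22 : 0 < c2 / 2%:R by rewrite divr_gt0 ?ltr0n.
have s0 : 0 < 1 + c2 / 2%:R by rewrite addr_gt0.
have m0 : 0 < m by rewrite divr_gt0.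
have m1 : m <= 1 by rewrite ler_pdivrMr // mul1r lerDr.
have mc : m <= c2 / 2%:R by rewrite ler_pdivrMr // ler_peMr ?ltW // ltrDl.
pose b := c * m ^+ d; have b0 : 0 < b by rewrite mulr_gt0 // exprn_gt0.
pose c' := c2 * b / (c2 + b).
have s1 : 0 < c2 + b by rewrite addr_gt0.
exists c'; first by rewrite divr_gt0 // mulr_gt0.
have le2 : c' <= c2 by rewrite ler_pdivrMr // ler_wpM2l ?ltW // ltrDr.
have leb : c' <= b by rewrite ler_pdivrMr // mulrC ler_wpM2l ?ltW // ltrDl.
move=> w; split=> [z z' rz rz' ne|z k' rz H].
  have [i Ei] := root_red_zeta c0 lG Gz rz; have [j Ej] := root_red_zeta c0 lG Gz rz'.
  apply: (le_trans le2); rewrite Ei Ej -fcB; apply: (H2 w i j 0%N).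
  - by apply: contraNneq ne => ij; rewrite Ei Ej ij.
  - by rewrite expr0 mul1r.
  - by rewrite fcB subr_eq0 -Ei -Ej.
have [i [j [ij Hij]]] := newton_lower c0 lG Gz H2 m0 m1 mc rz H.
by exists i, j; split=> //; apply: le_trans leb Hij.
Qed.

(** * The reversed polynomial *)

(** [X ^ d * p(1 / X)] for the formal degree [d]; a nonzero constant term of [p] makes [d] its exact
    degree. *)
Definition revp (R : nzRingType) d (p : {poly R}) : {poly R} :=
  \poly_(j < d.+1) p`_(d - j).

Lemma size_revp (R : nzRingType) d (p : {poly R}) : p`_0 != 0 -> size (revp d p) = d.+1.
Proof. by move=> p0; rewrite size_poly_eq // subnn. Qed.

Lemma lead_coef_revp (R : nzRingType) d (p : {poly R}) :
  p`_0 != 0 -> lead_coef (revp d p) = p`_0.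
Proof. by move=> p0; rewrite lead_coefE size_revp //= coef_poly ltnSn subnn. Qed.

Lemma map_revp (R S : nzRingType) (f : {rmorphism R -> S}) d (p : {poly R}) :
  map_poly f (revp d p) = revp d (map_poly f p).
Proof.
apply/polyP => j; rewrite coef_map /revp [in LHS]coef_poly [in RHS]coef_poly.
by case: ifP => _; [rewrite coef_map|exact: rmorph0].
Qed.

Lemma revp_prod (R : comNzRingType) (rs : seq R) :
  revp (size rs) (\prod_(z <- rs) ('X - z%:P)) = \prod_(z <- rs) (1 - z *: 'X).
Proof.
elim: rs => [|z rs IH].
  rewrite !big_nil; apply/polyP => j; rewrite coef_poly !coef1.
  by case: j => [|j] //=; rewrite subnn.
rewrite !big_cons -IH /=; set q := \prod_(_ <- _) _.
have sq : size q = (size rs).+1 by rewrite size_prod_XsubC.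
have EL k : (('X - z%:P) * q)`_k = (if k == 0%N then 0 else q`_k.-1) - z * q`_k.
  by rewrite mulrBl coefB coefXM coefCM.
have ER (r : {poly R}) k : ((1 - z *: 'X) * r)`_k =
    r`_k - z * (if k == 0%N then 0 else r`_k.-1).
  by rewrite mulrBl mul1r coefB -scalerAl coefZ coefXM.
apply/polyP => j; rewrite ER [LHS]coef_poly EL /revp; case: j => [|j] /=.
  by rewrite coef_poly subn0 /= mulr0 [q`_(size rs).+1]nth_default ?sq // mulr0 subn0.
rewrite !coef_poly subSS !ltnS; case: (ltngtP j (size rs)) => [lt|gt|->].
- by rewrite subn_eq0 leqNgt lt /= subnS.
- by rewrite mulr0 subr0.
- by rewrite subnn.
Qed.

Fact resultant_revp_aux (K : fieldType) (s a A L P T : K) : T != 0 ->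
  s * (a * (A * T)) * (P / T) * L = a * (s * (L * A) * P).
Proof. by move=> T0; field. Qed.

Section ReversedResultant.
Variable C : numClosedFieldType.

Lemma resultant_revp d (p : {poly C}) l : size p = d.+2 -> p.[l] != 0 ->
  let F := revp d.+1 (p \Po ('X + l%:P)) in
  resultant F F^`() * lead_coef p = p.[l] * resultant p p^`().
Proof.
move=> sp pl F; have p0 : p != 0 by rewrite -size_poly_gt0 sp.
have lp : lead_coef p != 0 by rewrite lead_coef_eq0.
have [rs Ep] := closed_field_poly_normal p.
have srs : size rs = d.+1.
  by have := congr1 (fun q : {poly C} => size q) Ep; rewrite size_scale // size_prod_XsubC sp => -[].
pose y (i : 'I_d.+1) := rs`_i; pose t i := y i - l.
have Ep' : p = lead_coef p *: \prod_i ('X - (y i)%:P).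
  by rewrite {1}Ep (big_nth 0) big_mkord srs.
have EQ : p \Po ('X + l%:P) = lead_coef p *: \prod_(z <- map t (enum 'I_d.+1)) ('X - z%:P).
  rewrite {1}Ep' comp_polyZ rmorph_prod /= big_map big_enum; congr (_ *: _).
  apply: eq_bigr => i _; rewrite comp_polyB comp_polyX comp_polyC /t polyCB; ring.
have EF : F = lead_coef p *: \prod_i (1 - t i *: 'X).
  have -> : F = lead_coef p *: revp d.+1 (\prod_(z <- map t (enum 'I_d.+1)) ('X - z%:P)).
    rewrite /F EQ; apply/polyP => j; rewrite coefZ !coef_poly.
    by case: ifP => _; rewrite ?mulr0 // coefZ.
  have := revp_prod (map t (enum 'I_d.+1)); rewrite size_map size_enum_ord => ->.
  by rewrite big_map big_enum.
have Epl : p.[l] = lead_coef p * \prod_i (- t i).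
  rewrite {1}Ep' hornerZ horner_prod; congr (_ * _); apply: eq_bigr => i _.
  by rewrite hornerXsubC opprB.
have t0 i : t i != 0.
  apply: contraNneq pl => ti; rewrite Epl (bigD1 i) //= ti oppr0 mul0r mulr0 //.
have EF' : F = p.[l] *: \prod_i ('X - (t i)^-1%:P).
  rewrite EF Epl -scalerA; congr (_ *: _); rewrite -scaler_prod.
  apply: eq_bigr => i _; rewrite scalerBr -[_ *: (_)%:P]mul_polyC -polyCM mulNr mulfV //.
  by rewrite polyCN opprK scaleNr addrC.
have char0 n : n.+1%:R != 0 :> C by rewrite pnatr_eq0.
rewrite (resultant_deriv char0 (ltn0Sn d) pl EF') (resultant_deriv char0 (ltn0Sn d) lp Ep').
pose T := \prod_i t i; have T0 : T != 0 by apply/prodf_neq0.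
pose Pi := \prod_i \prod_(j | j != i) (t i - t j).
have -> : \prod_i \prod_(j | j != i) (y i - y j) = Pi.
  apply: eq_bigr => i _; apply: eq_bigr => j _; rewrite /t; ring.
have -> : \prod_i \prod_(j | j != i) ((t i)^-1 - (t j)^-1) = Pi / T ^+ d.*2.
  have E1 : \prod_i \prod_(j | j != i) ((t i)^-1 - (t j)^-1) =
     (\prod_i \prod_(j | j != i) (t j - t i)) /
     (\prod_i \prod_(j | j != i) (t i * t j)).
    rewrite -prodf_div; apply: eq_bigr => i _; rewrite -prodf_div.
    apply: eq_bigr => j _; field; rewrite ?t0 //.
  rewrite E1; congr (_ / _).
    rewrite (exchange_big_dep predT) //= /Pi; apply: eq_bigr => i _.
    by apply: eq_bigl => j; rewrite eq_sym.
  transitivity (\prod_i (t i ^+ d * (T / t i))).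
    apply: eq_bigr => i _; rewrite big_split /= prodr_const cardC1 card_ord /=.
    have -> : T = t i * \prod_(j | j != i) t j by rewrite /T (bigD1 i).
    by rewrite [t i * _]mulrC mulfK.
  rewrite big_split prodrXl -/T /= prodf_div prodr_const card_ord -/T.
  by rewrite -addnn exprD exprSr mulfK.
have Epl2 : p.[l] ^+ d.*2 = lead_coef p ^+ d.*2 * T ^+ d.*2.
  rewrite Epl exprMn prodrN; congr (_ * _); rewrite exprMn -/T.
  by rewrite -exprM mulnC exprM -mul2n exprM sqrrN !expr1n mul1r.
have Ed : (d.+1.-1 + d.+1 = d.*2.+1)%N by rewrite /= addnS addnn.
rewrite Ed !exprS Epl2; apply: resultant_revp_aux; exact: expf_neq0.
Qed.
End ReversedResultant.

(** * Orders of multivariate polynomials along lines *)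

Lemma mpoly_ring_ind k (R : comNzRingType) (P : {mpoly R[k]} -> Prop) :
  (forall c, P c%:MP) -> (forall i, P 'X_i) ->
  (forall p q, P p -> P q -> P (p + q)) -> (forall p q, P p -> P q -> P (p * q)) ->
  forall p, P p.
Proof.
move=> PC PX PD PM; have P1 : P 1 by rewrite -mpolyC1.
elim/mpolyind => [|c m p _ _ Pp]; first by rewrite -mpolyC0.
apply: PD => //; rewrite -mul_mpolyC; apply: (PM) => //.
rewrite mpolyXE_id; apply: (big_ind P P1 PM) => i _.
by elim: (m i) => [|n IH]; rewrite ?expr0 // exprS; apply: PM.
Qed.

Lemma poly_eq0_inf (R : numDomainType) (q : {poly R}) (t : nat -> R) :
  injective t -> (forall n, q.[t n] = 0) -> q = 0.
Proof.
move=> ti H; apply/eqP; apply: contraT => q0.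
have := @max_poly_roots _ q [seq t i | i <- iota 0 (size q)] q0.
rewrite size_map size_iota ltnn => -> //.
  by apply/allP => x /mapP[i _ ->]; rewrite rootE H.
by rewrite map_inj_uniq ?iota_uniq.
Qed.

Section Line.
Variables (R : realFieldType) (k : nat).
Implicit Types (v w : 'I_k -> R) (p q : {mpoly R[k]}).

Definition line v w : {mpoly R[k]} -> {poly R} :=
  mmap (@polyC R) (fun i => (v i)%:P + w i *: 'X).

HB.instance Definition _ v w := GRing.RMorphism.copy (line v w) (line v w).

Lemma lineC v w c : line v w c%:MP = c%:P.
Proof. by rewrite /line mmapC. Qed.
Lemma lineX v w i : line v w 'X_i = (v i)%:P + w i *: 'X.
Proof. by rewrite /line mmapX mmap1U. Qed.

Lemma line_horner v w p t : (line v w p).[t] = p.@[fun i => v i + w i * t].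
Proof.
elim/mpoly_ring_ind: p => [c|i|p q|p q].
- by rewrite lineC hornerC mevalC.
- by rewrite lineX mevalXU !hornerE.
- by rewrite rmorphD hornerD mevalD => -> ->.
- by rewrite rmorphM hornerM mevalM => -> ->.
Qed.

Lemma line_coef0 v w p : (line v w p)`_0 = p.@[v].
Proof.
rewrite -horner_coef0 line_horner; apply: meval_eq => i.
by rewrite mulr0 addr0.
Qed.

Lemma line_coef1 v w p : (line v w p)`_1 = \sum_i w i * (p^`M(i)).@[v].
Proof.
elim/mpoly_ring_ind: p => [c|i|p q IHp IHq|p q IHp IHq].
- by rewrite lineC coefC big1 //= => i _; rewrite mderivC meval0 mulr0.
- rewrite lineX coefD coefC add0r coefZ coefX mulr1 (bigD1 i) //= big1 ?addr0.
    rewrite mderivX mnm1E eqxx scale1r (_ : U_(i) - U_(i) = 0)%MM.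
      by rewrite mpolyX0 meval1 mulr1.
    by apply/mnmP => j; rewrite mnmBE subnn mnm0E.
  move=> j ne; rewrite mderivX mnm1E eq_sym (negPf ne) scale0r meval0 mulr0 //.
- rewrite rmorphD coefD IHp IHq -big_split; apply: eq_bigr => i _ /=.
  by rewrite mderivD mevalD mulrDr.
- rewrite rmorphM coefM big_ord_recl big_ord_recl big_ord0 addr0 /= /bump /= subn0.
  rewrite subnn addn0 !line_coef0 IHp IHq mulr_sumr mulr_suml -big_split.
  apply: eq_bigr => i _ /=; rewrite mderivM mevalD !mevalM; ring.
Qed.

Lemma mnm_neq0 (a : 'X_{1..k}) : a != 0%MM -> exists i, a i != 0%N.
Proof.
move=> a0; apply: contrapT => H; case/eqP: a0; apply/mnmP => i; rewrite mnm0E.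
by apply/eqP; case: eqP => // /eqP ne; case: H; exists i.
Qed.

Lemma mnm_ind (P : 'X_{1..k} -> Prop) : P 0%MM ->
  (forall i m, P m -> P (U_(i) + m)%MM) -> forall m, P m.
Proof.
move=> P0 PS m; have [n] := ubnP (mdeg m); elim: n m => // n IH m.
have [->//|m0 lt] := eqVneq m 0%MM.
have [i mi] := mnm_neq0 m0.
have Em : m = (U_(i) + (m - U_(i)))%MM.
  rewrite addmC submK //; apply/mnm_lepP => j; rewrite mnm1E.
  by case: eqP => // <-; rewrite lt0n.
have := congr1 mdeg Em; rewrite mdegD mdeg1 add1n => Ed.
by rewrite Em; apply: PS; apply: IH; rewrite -ltnS -Ed.
Qed.

Lemma meval_at0 q : q.@[fun=> 0] = q@_0.
Proof.
have H a : a != 0%MM -> q@_a * \prod_i (0 : R) ^+ a i = 0.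
  move=> /mnm_neq0[i ai].
  by rewrite (bigD1 i) //= expr0n (negPf ai) mul0r mulr0.
rewrite mevalE; have [in0|nin] := boolP (0%MM \in msupp q).
  rewrite (bigD1_seq 0%MM) //= big1 ?mulr1 => [|i _]; last by rewrite mnm0E.
  by rewrite big1 ?addr0.
rewrite memN_msupp_eq0 // big_seq big1 // => a am.
by apply: H; apply: contraNneq nin => <-.
Qed.

(** Restricting to coordinate lines shows that every partial derivative vanishes everywhere as well;
    at 0 these are nonzero multiples of the coefficients. *)
Lemma mpoly_eq0_vanish p : (forall v, p.@[v] = 0) -> p = 0.
Proof.
move=> H; have {}H m : forall v, (p^`M[m]).@[v] = 0.
  elim/mnm_ind: m => [|i m IH] v; first by rewrite mderivm0m.
  rewrite addmC mderivmDm mderivmU1m; set q := p^`M[m] in IH *.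
  have E : line v (fun j => (j == i)%:R) q = 0.
    apply: (@poly_eq0_inf _ _ (fun n => n%:R)) => [a b /eqP|n].
      by rewrite eqr_nat => /eqP.
    by rewrite line_horner.
  have := line_coef1 v (fun j => (j == i)%:R) q; rewrite E coef0 (bigD1 i) //=.
  rewrite eqxx mul1r big1 ?addr0 // => j /negPf ->; by rewrite mul0r.
apply/mpolyP => m; rewrite mcoeff0; have := H m (fun=> 0).
rewrite meval_at0.
rewrite mcoeff_mderivm addm0 => /eqP; rewrite mulrn_eq0 => /orP[|/eqP //].
rewrite -leqn0 leqNgt prodn_gt0 // => i; rewrite ffactnn; exact: fact_gt0.
Qed.

Definition mshift v p : {mpoly R[k]} := p \mPo [tuple 'X_i + (v i)%:MP | i < k].

Lemma mshiftX v i : mshift v 'X_i = 'X_i + (v i)%:MP.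
Proof. by rewrite /mshift comp_mpolyXU -tnth_nth tnth_mktuple. Qed.

Lemma mderiv_shift v p i : (mshift v p)^`M(i) = mshift v (p^`M(i)).
Proof.
elim/mpoly_ring_ind: p => [c|j|p q IHp IHq|p q IHp IHq].
- by rewrite /mshift comp_mpolyC !mderivC comp_mpoly0.
- rewrite mshiftX mderivD mderivC addr0 mderivX /mshift comp_mpolyZ mnm1E.
  case: eqP => [->|_]; last by rewrite !scale0r.
  rewrite (_ : U_(i) - U_(i) = 0)%MM; first by rewrite mpolyX0 comp_mpoly1.
  by apply/mnmP => l; rewrite mnmBE subnn mnm0E.
- by rewrite /mshift comp_mpolyD !mderivD comp_mpolyD -/(mshift _ _) IHp -/(mshift _ _) IHq.
- rewrite /mshift rmorphM !mderivM rmorphD !rmorphM /=.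
  by rewrite -!/(mshift _ _) IHp IHq.
Qed.

Lemma mderivm_shift v p a : (mshift v p)^`M[a] = mshift v (p^`M[a]).
Proof.
elim/mnm_ind: a p => [|i m IH] p; first by rewrite !mderivm0m.
by rewrite !mderivmDm !mderivmU1m mderiv_shift IH.
Qed.

Lemma mcoeff_shift v p a :
  (mshift v p)@_a *+ \prod_i (a i)`! = (p^`M[a]).@[v].
Proof.
transitivity (((mshift v p)^`M[a]).@[fun=> 0]).
  rewrite meval_at0 mcoeff_mderivm addm0; congr (_ *+ _).
  by apply: eq_bigr => i _; rewrite ffactnn.
rewrite mderivm_shift /mshift comp_mpoly_meval; apply: meval_eq => i.
by rewrite tnth_mktuple mevalD mevalXU mevalC add0r.
Qed.

Lemma line_shift v w p : line v w p = line (fun=> 0) w (mshift v p).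
Proof.
elim/mpoly_ring_ind: p => [c|j|p q IHp IHq|p q IHp IHq].
- by rewrite /mshift comp_mpolyC !lineC.
- by rewrite mshiftX rmorphD /= !lineX lineC add0r addrC.
- by rewrite /mshift comp_mpolyD !rmorphD -!/(mshift _ _) /= IHp IHq.
- by rewrite /mshift !rmorphM -!/(mshift _ _) /= IHp IHq.
Qed.

Definition hom_part n p : {mpoly R[k]} :=
  \sum_(m <- msupp p | mdeg m == n) p@_m *: 'X_[m].

Lemma line0_coef w p n : (line (fun=> 0) w p)`_n = (hom_part n p).@[w].
Proof.
rewrite /line /mmap coef_sum /hom_part raddf_sum /= [RHS]big_mkcond /=.
apply: eq_bigr => m _; rewrite coefCM.
have -> : mmap1 (fun i => (0 : R)%:P + w i *: 'X) m =
    (\prod_i w i ^+ m i) *: 'X^(mdeg m).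
  rewrite /mmap1 mdegE -prodrXr -scaler_prod; apply: eq_bigr => i _.
  by rewrite add0r exprZn.
rewrite coefZ coefXn eq_sym; case: eqP => _; last by rewrite !mulr0.
by rewrite mulr1 mevalZ mevalX.
Qed.

Lemma mcoeff_hom_part n p a : (hom_part n p)@_a = if mdeg a == n then p@_a else 0.
Proof.
rewrite /hom_part big_mkcond raddf_sum /=.
have [ain|nin] := boolP (a \in msupp p); last first.
  rewrite memN_msupp_eq0 // if_same big_seq big1 // => m min.
  case: ifP => _; last exact: mcoeff0.
  rewrite mcoeffZ mcoeffX; case: eqP => [E|_]; last by rewrite mulr0.
  by rewrite -E min in nin.
rewrite (bigD1_seq a) //= big1 ?addr0 => [|m ma].
  by case: ifP => _; rewrite ?mcoeff0 // mcoeffZ mcoeffX eqxx mulr1.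
by case: ifP => _; rewrite ?mcoeff0 // mcoeffZ mcoeffX (negPf ma) mulr0.
Qed.

(** Once [v] is moved to the origin, the i-th coefficient along [w] is the value at [w] of the
    homogeneous part of degree [i], which is zero as soon as all its values are. *)
Theorem order_ge_line v p n :
  (forall a : 'X_{1..k}, (mdeg a < n)%N -> (p^`M[a]).@[v] = 0) <->
  (forall w i, (i < n)%N -> (line v w p)`_i = 0).
Proof.
split=> [H w i lt|H a lt].
  rewrite line_shift line0_coef.
  have -> : hom_part i (mshift v p) = 0; last exact: meval0.
  apply/mpolyP => a; rewrite mcoeff_hom_part mcoeff0; case: eqP => // Ei.
  have /eqP := mcoeff_shift v p a; rewrite H ?Ei // mulrn_eq0 => /orP[|/eqP //].
  rewrite -leqn0 leqNgt prodn_gt0 // => j; exact: fact_gt0.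
have E : hom_part (mdeg a) (mshift v p) = 0.
  by apply: mpoly_eq0_vanish => w; rewrite -line0_coef -line_shift H.
have := congr1 (fun q => q@_a) E; rewrite mcoeff_hom_part eqxx mcoeff0 => E0.
by rewrite -mcoeff_shift E0 mul0rn.
Qed.

(** On the line from [a] to a point where [p] does not vanish, [p] has finitely many zeros, while
    the parameters [t n] are infinitely many and all land in the box. *)
Lemma mpoly_nonvanishing p (a : 'I_k -> R) r : p != 0 -> 0 < r ->
  exists x, (forall i, `|x i - a i| < r) /\ p.@[x] != 0.
Proof.
move=> p0 r0; have [x0 nz] : exists x, p.@[x] != 0.
  apply: contrapT => H; case/eqP: p0; apply: mpoly_eq0_vanish => v.
  by apply/eqP; case: eqP => // /eqP ne; case: H; exists v.
pose w i := x0 i - a i; pose B := \sum_i `|w i| + 1.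
have B0 : 0 < B by rewrite ltr_wpDl // sumr_ge0.
have wB i : `|w i| < B.
  by rewrite /B (bigD1 i) //= -addrA ltrDl ltr_wpDl // sumr_ge0.
have q0 : line a w p != 0.
  apply: contraNneq nz => E; have := line_horner a w p 1; rewrite E horner0 => ->.
  by apply/eqP/meval_eq => i; rewrite mulr1 /w addrC subrK.
pose t (n : nat) := r / (B * n.+1%:R).
have [n tn] : exists n, (line a w p).[t n] != 0.
  apply: contrapT => H; case/eqP: q0; apply: (@poly_eq0_inf _ _ t) => [i j E|n].
    have : (B * i.+1%:R)^-1 = (B * j.+1%:R)^-1.
      by apply: (mulfI (lt0r_neq0 r0)); exact: E.
    move/invr_inj/(mulfI (lt0r_neq0 B0))/eqP; rewrite eqr_nat eqSS => /eqP //.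
  by apply/eqP; case: eqP => // /eqP ne; case: H; exists n.
exists (fun i => a i + w i * t n); split; last by rewrite -line_horner.
move=> i; rewrite addrC addKr normrM /t normrM normfV normrM.
rewrite (gtr0_norm r0) (gtr0_norm B0) normr_nat mulrA ltr_pdivrMr ?mulr_gt0 ?ltr0n //.
rewrite mulrC ltr_pM2l //; apply: (lt_le_trans (wB i)).
by apply: ler_peMr; [exact: ltW|rewrite ler1n].
Qed.

End Line.

(** * Local separation of the roots of [P] *)

Section LocalSeparation.
Variables (R : realType) (m : nat).
Local Notation C := (R[i] : numClosedFieldType).
Local Notation iota := (real_complex R : R -> C).
Implicit Types (P : {poly {mpoly R[m]}}) (D : {mpoly R[m]}) (p w v : 'I_m -> R).

Definition evC p : {mpoly R[m]} -> C := iota \o meval p.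
HB.instance Definition _ p := GRing.RMorphism.on (evC p).

Definition translate l P : {poly {mpoly R[m]}} := P \Po ('X + (l%:MP)%:P).

(* The substitution [x_n = l + 1 / z]: the polynomial in [z] whose projective
   roots correspond to those of [P], with leading coefficient [P(x, l)]. *)
Definition Frev l P := revp (size P).-1 (translate l P).

Lemma translate_coef0 l P : (translate l P)`_0 = P.[l%:MP].
Proof. by rewrite -horner_coef0 horner_comp !hornerE. Qed.

Lemma lead_Frev l P : P.[l%:MP] != 0 -> lead_coef (Frev l P) = P.[l%:MP].
Proof. by move=> H; rewrite lead_coef_revp translate_coef0. Qed.

Lemma size_Frev l P : P.[l%:MP] != 0 -> size (Frev l P) = (size P).-1.+1.
Proof. by move=> H; rewrite size_revp // translate_coef0. Qed.

Lemma mpoly_char0 n : n.+1%:R != 0 :> {mpoly R[m]}.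
Proof.
rewrite -mpolyC_nat; apply/eqP => /eqP; rewrite mpolyC_eq0 pnatr_eq0 //.
Qed.

Lemma rmorph_resultant_deriv (T : idomainType) (f : {rmorphism {mpoly R[m]} -> T})
    (q : {poly {mpoly R[m]}}) : (forall n, n.+1%:R != 0 :> T) ->
  (1 < size q)%N -> f (lead_coef q) != 0 ->
  f (resultant q q^`()) = resultant (map_poly f q) (map_poly f q)^`().
Proof.
move=> ch sq fq; rewrite deriv_map; apply: rmorph_resultant => //.
rewrite lead_coefE (size_deriv_char0 mpoly_char0) coef_deriv.
case: (size q) sq (lead_coefE q) => [|[|n]] //= _ E.
by rewrite rmorphMn /= -E -mulr_natr mulf_neq0.
Qed.

Lemma disc_rev l P D d : size P = d.+2 -> is_disc P D -> P.[l%:MP] != 0 ->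
  P.[l%:MP] * D = (-1) ^+ (d.+1 * d)./2 * resultant (Frev l P) (Frev l P)^`().
Proof.
move=> sP; rewrite /is_disc sP /= => HD b0.
have P0 : P != 0 by rewrite -size_poly_gt0 sP.
have lP0 : lead_coef P != 0 by rewrite lead_coef_eq0.
apply/eqP; rewrite -subr_eq0; set E := _ - _.
(* After multiplication by both leading coefficients only points where neither vanishes matter, and
   there resultants commute with evaluation. *)
apply: contraT => E0; suff : E * (lead_coef P * P.[l%:MP]) = 0.
  by move/eqP; rewrite !mulf_eq0 (negPf E0) (negPf lP0) (negPf b0).
apply: mpoly_eq0_vanish => x; apply: (fmorph_inj (real_complex R)).
rewrite rmorph0 -[LHS]/(evC x _) rmorphM rmorphM /=.
have [->|l0] := eqVneq (evC x (lead_coef P)) 0; first by rewrite mul0r mulr0.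
have [->|bx0] := eqVneq (evC x P.[l%:MP]) 0; first by rewrite !mulr0.
have chC n : n.+1%:R != 0 :> C by rewrite pnatr_eq0.
suff -> : evC x E = 0 by rewrite mul0r.
pose p := map_poly (evC x) P.
have sp : size p = d.+2 by rewrite size_map_poly_id0.
have lp : lead_coef p = evC x (lead_coef P) by rewrite lead_coef_map_id0 ?rmorph0.
have pl : p.[iota l] = evC x P.[l%:MP].
  by rewrite -horner_map /= /evC /= mevalC.
have EF : map_poly (evC x) (Frev l P) = revp d.+1 (p \Po ('X + (iota l)%:P)).
  rewrite /Frev sP map_revp /translate map_comp_poly rmorphD /= map_polyX map_polyC.
  by rewrite /= /evC /= mevalC.
apply: (mulIf l0); rewrite mul0r /E rmorphB mulrBl.
apply/eqP; rewrite subr_eq0; apply/eqP.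
have EP : evC x (lead_coef P) * evC x D =
    evC x ((-1) ^+ (d.+1 * d)./2) * resultant p p^`().
  by rewrite -rmorphM HD rmorphM (rmorph_resultant_deriv chC) ?sP.
have EFr : evC x (resultant (Frev l P) (Frev l P)^`()) * evC x (lead_coef P) =
    evC x P.[l%:MP] * resultant p p^`().
  rewrite (rmorph_resultant_deriv chC) ?size_Frev ?sP ?lead_Frev // EF -lp.
  by rewrite (resultant_revp sp) ?pl.
rewrite !rmorphM -[RHS]mulrA [X in _ = _ * X]EFr -[LHS]mulrA [X in _ * X = _]mulrC EP.
by rewrite mulrCA.
Qed.

Definition cline p v : {mpoly R[m]} -> {poly C} := map_poly iota \o line p v.
HB.instance Definition _ p v := GRing.RMorphism.on (cline p v).

(* [kapp F p v z i j] is the coefficient of [s ^ i y ^ j] in F(p + s v, z + y). *)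
Definition kapp (F : {poly {mpoly R[m]}}) p v (z : C) i j : C :=
  ((map_poly (cline p v) F \Po ('X + z%:P%:P))`_j)`_i.

Definition config := (('I_m -> R) * ('I_m -> R) * C)%type.
Implicit Types x y : config.

Definition inbox (M : R) x :=
  [/\ forall i, `|x.1.1 i| <= M, forall i, `|x.1.2 i| <= M & `|x.2| <= iota M].
Definition cclose x y (r : R) :=
  [/\ forall i, `|x.1.1 i - y.1.1 i| <= r, forall i, `|x.1.2 i - y.1.2 i| <= r &
      `|x.2 - y.2| <= iota r].

(** Boundedness is part of the definition because products of Lipschitz functions need it. *)
Definition lip M (f : config -> C) := exists L B : C, [/\ 0 <= L,
  forall x, inbox M x -> `|f x| <= B &
  forall x y r, inbox M x -> inbox M y -> cclose x y r -> `|f x - f y| <= L * iota r].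

Lemma cclose_ge0 x y r : cclose x y r -> 0 <= iota r.
Proof. by case=> _ _; apply: le_trans. Qed.

Lemma lip_ring M : family_ring (lip M).
Proof.
split.
- by exists 0, 0; split=> [//|x _|x y r _ _ _]; rewrite ?subrr normr0 ?mul0r.
- by exists 0, 1; split=> [//|x _|x y r _ _ _]; rewrite ?normr1 // subrr normr0 mul0r.
- move=> f [L [B [L0 HB HL]]]; exists L, B; split=> // x; first by rewrite normrN; apply: HB.
  by move=> y r ix iy c; rewrite -opprD normrN; apply: HL.
- move=> f g [L [B [L0 HB HL]]] [L' [B' [L0' HB' HL']]].
  exists (L + L'), (B + B'); split=> [|x ix|x y r ix iy c]; first exact: addr_ge0.
    by rewrite (le_trans (ler_normD _ _)) // lerD ?HB ?HB'.
  rewrite opprD addrACA mulrDl (le_trans (ler_normD _ _)) // lerD //.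
    exact: HL.
  exact: HL'.
- move=> f g [L [B [L0 HB HL]]] [L' [B' [L0' HB' HL']]].
  have [[x0 ix0]|nobox] := pselect (exists x, inbox M x); last first.
    by exists 0, 0; split=> // [x ix|x y r ix]; case: nobox; exists x.
  have B0 : 0 <= B by apply: le_trans (HB _ ix0).
  have B0' : 0 <= B' by apply: le_trans (HB' _ ix0).
  exists (B * L' + L * B'), (B * B'); split=> [|x ix|x y r ix iy c].
  + by rewrite addr_ge0 // mulr_ge0.
  + by rewrite normrM ler_pM // ?HB ?HB'.
  have -> : f x * g x - f y * g y = f x * (g x - g y) + (f x - f y) * g y by ring.
  rewrite (le_trans (ler_normD _ _)) // !normrM mulrDl; apply: lerD.
    by rewrite -mulrA; apply: ler_pM => //; [exact: HB|exact: HL'].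
  by rewrite mulrAC; apply: ler_pM => //; [exact: HL|exact: HB'].
Qed.

Lemma lip_cst M c : lip M (fun=> c).
Proof.
exists 0, `|c|; split=> // x y r _ _ /cclose_ge0 r0.
by rewrite subrr normr0 mul0r.
Qed.

Lemma norm_iota (a : R) : `|iota a| = iota `|a|.
Proof. by rewrite normc_def /= expr0n /= addr0 sqrtr_sqr. Qed.

Lemma ler_iota (a b : R) : (iota a <= iota b) = (a <= b).
Proof. by rewrite lecR. Qed.

Lemma lip_pt M i : lip M (fun x => iota (x.1.1 i)).
Proof.
exists 1, (iota M); split=> // [x [H _ _]|x y r _ _ [H _ _]].
  by rewrite norm_iota ler_iota.
by rewrite -rmorphB norm_iota mul1r ler_iota.
Qed.

Lemma lip_dir M i : lip M (fun x => iota (x.1.2 i)).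
Proof.
exists 1, (iota M); split=> // [x [_ H _]|x y r _ _ [_ H _]].
  by rewrite norm_iota ler_iota.
by rewrite -rmorphB norm_iota mul1r ler_iota.
Qed.

Lemma lip_root M : lip M (fun x => x.2).
Proof. by exists 1, (iota M); split=> // [x [_ _ H]|x y r _ _ [_ _ H]]; rewrite ?mul1r. Qed.

Let lipP M (f : config -> {poly C}) := forall n, lip M (fun x => (f x)`_n).
Let lipP_ring M : family_ring (lipP M) := fr_poly (lip_ring M).
Let lipPP M (f : config -> {poly {poly C}}) := forall n, lipP M (fun x => (f x)`_n).
Let lipPP_ring M : family_ring (lipPP M) := fr_poly (lipP_ring M).

Lemma lip_polyC M f : lip M f -> lipP M (fun x => (f x)%:P).
Proof.
move=> Hf n; have -> : (fun x => (f x)%:P`_n) = (fun x => if n == 0%N then f x else 0).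
  by apply: funext => x; rewrite coefC.
by case: (n == 0%N) => //; apply: lip_cst.
Qed.

Lemma lipP_polyC M f : lipP M f -> lipPP M (fun x => (f x)%:P).
Proof.
move=> Hf n k; have -> : (fun x => (f x)%:P`_n`_k) = (fun x => if n == 0%N then (f x)`_k else 0).
  by apply: funext => x; rewrite coefC; case: ifP => _; rewrite ?coef0.
by case: (n == 0%N); [exact: Hf|apply: lip_cst].
Qed.

Lemma lip_line M c : lipP M (fun x => cline x.1.1 x.1.2 c).
Proof.
elim/mpoly_ring_ind: c => [c|i|p q Hp Hq|p q Hp Hq].
- have -> : (fun x => cline x.1.1 x.1.2 c%:MP) = (fun=> (iota c)%:P).
    by apply: funext => x; rewrite /cline /= lineC map_polyC.
  exact/lip_polyC/lip_cst.
- have -> : (fun x => cline x.1.1 x.1.2 'X_i) =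
     (fun x => (iota (x.1.1 i))%:P + (iota (x.1.2 i))%:P * 'X).
    apply: funext => x; rewrite /cline /= lineX rmorphD /= map_polyC map_polyZ.
    by rewrite map_polyX mul_polyC.
  apply: (frD (lipP_ring M)); first exact/lip_polyC/lip_pt.
  apply: (frM (lipP_ring M)); first exact/lip_polyC/lip_dir.
  by move=> n; apply: lip_cst.
- have -> : (fun x => cline x.1.1 x.1.2 (p + q)) =
     (fun x => cline x.1.1 x.1.2 p + cline x.1.1 x.1.2 q).
    by apply: funext => x; rewrite rmorphD.
  exact: (frD (lipP_ring M)).
- have -> : (fun x => cline x.1.1 x.1.2 (p * q)) =
     (fun x => cline x.1.1 x.1.2 p * cline x.1.1 x.1.2 q).
    by apply: funext => x; rewrite rmorphM.
  exact: (frM (lipP_ring M)).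
Qed.

Lemma lip_kapp M F i j : lip M (fun x => kapp F x.1.1 x.1.2 x.2 i j).
Proof.
suff H : lipPP M (fun x => map_poly (cline x.1.1 x.1.2) F \Po ('X + x.2%:P%:P)).
  exact: H.
have -> : (fun x => map_poly (cline x.1.1 x.1.2) F \Po ('X + x.2%:P%:P)) =
  (fun x => \sum_(k < size F) (cline x.1.1 x.1.2 F`_k)%:P * ('X + x.2%:P%:P) ^+ k).
  apply: funext => x; rewrite -{1}[F]coefK poly_def rmorph_sum /= raddf_sum /=.
  apply: eq_bigr => k _; rewrite map_polyZ map_polyXn comp_polyZ.
  rewrite rmorphXn /= comp_polyX.
  by rewrite mul_polyC.
apply: (fr_sum (lipPP_ring M)) => k _; apply: (frM (lipPP_ring M)).
  exact/lipP_polyC/lip_line.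
apply: (frX (lipPP_ring M)); apply: (frD (lipPP_ring M)).
  by move=> n l; apply: lip_cst.
exact/lipP_polyC/lip_polyC/lip_root.
Qed.

Lemma ge0_iota (z : C) : 0 <= z -> exists2 a : R, 0 <= a & z = iota a.
Proof.
move=> z0; exists (complex.Re z); last by rewrite RRe_real // ger0_real.
by rewrite -ler_iota RRe_real ?ger0_real.
Qed.

Lemma lip_nonzero M f x0 : lip M f -> inbox M x0 -> f x0 != 0 ->
  exists2 r : R, 0 < r & forall x, inbox M x -> cclose x x0 r -> `|f x0| / 2%:R <= `|f x|.
Proof.
move=> [L [B [/ge0_iota[a a0 ->] _ HL]]] i0 nz.
have [b b0 Eb] := ge0_iota (normr_ge0 (f x0)).
have bp : 0 < b by rewrite lt0r b0 andbT; apply: contraNneq nz => b00; rewrite -normr_eq0 Eb b00.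
pose r := b / (2%:R * (1 + a)).
have a1 : 0 < 1 + a by rewrite ltr_wpDr.
exists r; first by rewrite divr_gt0 // mulr_gt0 // ltr0n.
move=> x ix cl; have := HL x x0 r ix i0 cl; rewrite -rmorphM.
have le : a * r <= b / 2%:R.
  rewrite /r mulrA ler_pdivrMr ?mulr_gt0 ?ltr0n // mulrA divfK ?pnatr_eq0 //.
  by rewrite mulrC ler_wpM2l // lerDr.
move=> H; have {}H : `|f x - f x0| <= `|f x0| / 2%:R.
  by rewrite (le_trans H) // Eb -[2%:R](rmorph_nat (real_complex R)) -fmorphV -rmorphM ler_iota.
have T : `|f x0| <= `|f x| + `|f x - f x0|.
  rewrite -{1}(subKr (f x) (f x0)) (le_trans (ler_normB _ _)) //.
rewrite -(lerD2r (`|f x0| / 2%:R)) -mulrDl -mulr2n -[_ *+ 2]mulr_natr mulfK ?pnatr_eq0 //.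
by rewrite (le_trans T) // lerD2l.
Qed.

Lemma cline_coef0 p v c : (cline p v c)`_0 = evC p c.
Proof. by rewrite /cline /= coef_map line_coef0. Qed.

Definition fline p v : {mpoly R[m]} -> fps C := @fpoly C \o cline p v.
HB.instance Definition _ p v := GRing.RMorphism.on (fline p v).

Lemma fline0 p v c : fc (fline p v c) 0 = evC p c.
Proof. exact: cline_coef0. Qed.

(** Points of [S] are only assumed to have order at least [e]; that the coefficient of [t ^ e] stays
    away from 0 near [(s, v0)] is continuity. Indexing the family of [separation] by all nearby
    pairs [(p, v)] makes [c] independent of them. *)
Theorem local_separation P D l d e s (S : ('I_m -> R) -> Prop) (a0 : 'X_{1..m}) :
  size P = d.+2 -> is_disc P D -> evC s P.[l%:MP] != 0 ->
  (forall p, S p -> forall a : 'X_{1..m}, (mdeg a < e)%N -> (D^`M[a]).@[p] = 0) ->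
  S s -> mdeg a0 = e -> (D^`M[a0]).@[s] != 0 ->
  exists v0, exists2 r0 : R, 0 < r0 & exists2 c : C, 0 < c &
  forall p v, S p -> near_pt s p r0 -> near_pt v0 v r0 ->
  [/\ evC p P.[l%:MP] != 0,
    forall z z', root (map_poly (evC p) (Frev l P)) z ->
      root (map_poly (evC p) (Frev l P)) z' -> z != z' -> c <= `|z - z'| &
    forall z k, root (map_poly (evC p) (Frev l P)) z ->
      (exists i j, (i + j < k)%N /\ kapp (Frev l P) p v z i j != 0) ->
      exists i j, (i + j < k)%N /\ c <= `|kapp (Frev l P) p v z i j|].
Proof.
move=> sP HD b0s De Ss a0e Da0; set b0 := P.[l%:MP] in b0s *.
have b00 : b0 != 0 by apply: contraNneq b0s => ->; rewrite rmorph0.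
have [v0 Dv0] : exists v0, (line s v0 D)`_e != 0.
  apply: contrapT => H; case/eqP: Da0.
  apply: (proj2 (order_ge_line s D e.+1)); last by rewrite a0e.
  move=> w i; rewrite ltnS leq_eqVlt => /orP[/eqP ->|lt].
    by apply/eqP; case: eqP => // /eqP ne; case: H; exists w.
  exact: (proj1 (order_ge_line s D e) (De s Ss)).
pose M := \sum_i `|s i| + \sum_i `|v0 i| + 1.
have sM i p : near_pt s p 1 -> `|p i| <= M.
  move=> np; rewrite -(subrK (s i) (p i)) (le_trans (ler_normD _ _)) // addrC.
  apply: lerD; last exact/ltW/np.
  by rewrite (bigD1 i) //= -addrA lerDl addr_ge0 ?sumr_ge0.
have vM i p : near_pt v0 p 1 -> `|p i| <= M.
  move=> np; rewrite -(subrK (v0 i) (p i)) (le_trans (ler_normD _ _)) // addrC.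
  apply: lerD; last exact/ltW/np.
  by rewrite [X in _ <= _ + X](bigD1 i) //= addrCA lerDl addr_ge0 ?sumr_ge0.
have n1 q : near_pt q q 1 by move=> i; rewrite subrr normr0.
have M0 : 0 <= M by rewrite !addr_ge0 ?sumr_ge0.
have inb p v : near_pt s p 1 -> near_pt v0 v 1 -> inbox M (p, v, 0).
  move=> np nv; split=> [i|i|] /=; [exact: sM|exact: vM|].
  by rewrite normr0 -(rmorph0 (real_complex R)) ler_iota.
have cl p v r : near_pt s p r -> near_pt v0 v r -> 0 <= r -> cclose (p, v, 0) (s, v0, 0) r.
  move=> np nv r0; split=> [i|i|] /=; [exact/ltW/np|exact/ltW/nv|].
  by rewrite subrr normr0 -(rmorph0 (real_complex R)) ler_iota.
pose fb (x : config) := (cline x.1.1 x.1.2 b0)`_0.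
pose fu (x : config) := (cline x.1.1 x.1.2 D)`_e.
have [||r1 r10 H1] := @lip_nonzero M fb (s, v0, 0) (@lip_line M b0 0%N).
- exact: inb.
- by rewrite /fb cline_coef0.
have [||r2 r20 H2] := @lip_nonzero M fu (s, v0, 0) (@lip_line M D e).
- exact: inb.
- by rewrite /fu /cline /= coef_map /= fmorph_eq0.
have nb : 0 < `|fb (s, v0, 0)| / 2%:R by rewrite divr_gt0 ?ltr0n // normr_gt0 /fb cline_coef0.
have nu : 0 < `|fu (s, v0, 0)| / 2%:R.
  by rewrite divr_gt0 ?ltr0n // normr_gt0 /fu /cline /= coef_map /= fmorph_eq0.
set cb := `|fb _| / _ in H1 nb; set cu := `|fu _| / _ in H2 nu.
pose r0 := Num.min 1 (Num.min r1 r2).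
have r00 : 0 < r0 by rewrite !lt_min ltr01 r10 r20.
pose Om := {x : ('I_m -> R) * ('I_m -> R) |
  [/\ S x.1, near_pt s x.1 r0 & near_pt v0 x.2 r0]}.
have Hb (x : Om) : cb <= `|fb (sval x, 0)|.
  case: x => [[p v] [/= Sp np nv]]; apply: H1.
    by apply: inb => i; [apply: lt_le_trans (np i) _|apply: lt_le_trans (nv i) _];
      rewrite ge_min lexx.
  by apply: cl; [move=> i; apply: lt_le_trans (np i) _|
    move=> i; apply: lt_le_trans (nv i) _|exact: ltW];
    rewrite /r0 ge_min ge_min lexx orbT.
have Hu (x : Om) : cu <= `|fu (sval x, 0)|.
  case: x => [[p v] [/= Sp np nv]]; apply: H2.
    by apply: inb => i; [apply: lt_le_trans (np i) _|apply: lt_le_trans (nv i) _];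
      rewrite ge_min lexx.
  by apply: cl; [move=> i; apply: lt_le_trans (np i) _|
    move=> i; apply: lt_le_trans (nv i) _|exact: ltW];
    rewrite /r0 ge_min ge_min lexx !orbT.
pose F := Frev l P.
pose G (o : Om) := map_poly (fline (sval o).1 (sval o).2) F.
have lF : lead_coef F = b0 by exact: lead_Frev.
have sF : size F = d.+2 by rewrite size_Frev // sP.
have Pb0 (o : Om) : fline (sval o).1 (sval o).2 b0 != 0.
  have := Hb o; rewrite /fb /= => H; apply/eqP => E.
  have := congr1 (fun f => fc f 0) E; rewrite fline0 -(cline_coef0 _ (sval o).2) fc0 => E0.
  by have := lt_le_trans nb H; rewrite E0 normr0 ltxx.
have sG (o : Om) : size (G o) = d.+2 by rewrite size_map_poly_id0 ?lF.
have lG (o : Om) : lead_coef (G o) = fline (sval o).1 (sval o).2 b0.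
  by rewrite lead_coef_map_id0 ?lF ?rmorph0.
pose u' (o : Om) : fps C :=
  Fps (fun n => fc (fline (sval o).1 (sval o).2 D) (n + e)).
have Eu (o : Om) : fline (sval o).1 (sval o).2 D = ft C ^+ e * u' o.
  apply: fps_divt => n lt; case: o => [[p v] [/= Sp np nv]].
  rewrite /fline /cline /= /fc /= coef_map /=.
  by rewrite (proj1 (order_ge_line p D e) (De p Sp)) ?rmorph0.
pose sg : fps C := (-1) ^+ (d.+1 * d)./2.
pose u (o : Om) : fps C := sg * (fline (sval o).1 (sval o).2 b0 * u' o).
have rG (o : Om) : resultant (G o) (G o)^`() = ft C ^+ e * u o.
  rewrite -(rmorph_resultant_deriv (@fps_char0 C)) ?lF ?sF //; last exact: Pb0.
  have E : fline (sval o).1 (sval o).2 b0 * fline (sval o).1 (sval o).2 D =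
      sg * fline (sval o).1 (sval o).2 (resultant F F^`()).
    rewrite /sg -(rmorph_sign (fline (sval o).1 (sval o).2)) -!rmorphM.
    by congr (fline _ _ _); rewrite (disc_rev sP HD b00).
  rewrite Eu in E.
  have sg2 : sg * sg = 1 by rewrite -expr2 sqrr_sign.
  by rewrite /u mulrCA [ft C ^+ e * _]mulrCA E mulrA sg2 mul1r.
have cc : 0 < cb * cu by rewrite mulr_gt0.
have ub (o : Om) : cb * cu <= `|fc (u o) 0|.
  rewrite /u !fcM0 !normrM fline0.
  have -> : `|fc sg 0| = 1.
    by rewrite -[fc sg 0]/(fev sg) /sg rmorph_sign normr_sign.
  rewrite mul1r; apply: ler_pM; [exact: ltW|exact: ltW| |exact: (Hu o)].
  by rewrite -(cline_coef0 _ (sval o).2); apply: (Hb o).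
pose c1 := cb * (cb * cu) / (cb + cb * cu).
have s1 : 0 < cb + cb * cu by rewrite addr_gt0.
have c10 : 0 < c1 by rewrite divr_gt0 // mulr_gt0.
have le1 : c1 <= cb by rewrite ler_pdivrMr // ler_wpM2l ?ltW // ltrDr.
have le2 : c1 <= cb * cu.
  by rewrite ler_pdivrMr // mulrC ler_wpM2l ?ltW // ltrDl.
have bG j : bser (fun o => (G o)`_j).
  move=> n; have [L [B [_ HB _]]] := @lip_line M F`_j n.
  exists B => -[[p v] [/= Sp np nv]].
  rewrite /G coef_map; apply: (HB (p, v, 0)); apply: inb => i.
    by apply: lt_le_trans (np i) _; rewrite ge_min lexx.
  by apply: lt_le_trans (nv i) _; rewrite ge_min lexx.
have [] := @separation C Om d.+1 e G u c1 (ltn0Sn d) sG bG c10 _ rG.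
- move=> o; rewrite lG fline0 -(cline_coef0 _ (sval o).2).
  exact: le_trans le1 (Hb o).
- by move=> o; apply: le_trans le2 (ub o).
move=> c c0 H; exists v0, r0 => //; exists c => // p v Sp np nv.
pose o : Om := exist _ (p, v) (And3 Sp np nv).
have EG0 : map_poly (@fev C) (G o) = map_poly (evC p) F.
  apply/polyP => j; rewrite !coef_map /= /fev fline0 //.
have Ek z i j : kap (G o) z i j = kapp F p v z i j.
  rewrite /kap /kapp.
  have -> : G o \Po ('X + (fcst z)%:P) =
      map_poly (@fpoly C) (map_poly (cline p v) F \Po ('X + z%:P%:P)).
    rewrite map_comp_poly rmorphD /= map_polyX map_polyC /=.
    by congr (_ \Po _); apply/polyP => k; rewrite !coef_map.
  by rewrite coef_map.
have [HA HB] := H o; rewrite EG0 in HA HB; split.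
- have := Hb o; rewrite /fb /= cline_coef0 => h; rewrite -normr_gt0.
  exact: lt_le_trans nb h.
- exact: HA.
move=> z k rz [i [j [ij nz]]]; have [|i' [j' [ij' H']]] := HB z k rz.
  by exists i, j; rewrite Ek.
by exists i', j'; rewrite -Ek.
Qed.

End LocalSeparation.

(** * The homogenized polynomial *)

Section HomForm.
Variable B : comNzRingType.
Implicit Types (p : {poly B}) (u v l z : B).

Definition hom d p u v := \sum_(k < d.+1) p`_k * u ^+ k * v ^+ (d - k).

Lemma hom_shift d p l u v : (size p <= d.+1)%N ->
  hom d (p \Po ('X + l%:P)) u v = hom d p (u + l * v) v.
Proof.
move=> sp; have -> : p \Po ('X + l%:P) = \sum_(k < d.+1) p`_k *: ('X + l%:P) ^+ k.
  have {1}-> : p = \poly_(k < d.+1) p`_k.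
    apply/polyP => k; rewrite coef_poly; case: ltnP => // le.
    by rewrite nth_default // (leq_trans sp).
  rewrite poly_def raddf_sum; apply: eq_bigr => k _ /=.
  by rewrite comp_polyZ rmorphXn /= comp_polyX.
rewrite /hom; under eq_bigr do rewrite coef_sum !mulr_suml.
rewrite exchange_big /=; apply: eq_bigr => k _.
have kd : (k <= d)%N by rewrite -ltnS.
transitivity (p`_k * \sum_(i < d.+1) (('X + l%:P) ^+ k)`_i * u ^+ i * v ^+ (d - i)).
  by rewrite mulr_sumr; apply: eq_bigr => i _; rewrite coefZ -!mulrA.
rewrite -mulrA; congr (_ * _).
rewrite addrC exprDn (eq_bigr (fun i : 'I_d.+1 => \sum_(j < k.+1)
   (if i == j :> nat then l ^+ (k - j) *+ 'C(k, j) * u ^+ j * v ^+ (d - j) else 0))); last first.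
  move=> i _; rewrite coef_sum !mulr_suml; apply: eq_bigr => j _.
  rewrite -polyC_exp mulrC coefMn mulrC coefCM coefXn; case: eqP => [->|_].
    by rewrite mulr1.
  by rewrite mulr0 mul0rn !mul0r.
rewrite exchange_big /= addrC exprDn mulr_suml; apply: eq_bigr => j _.
have jd : (j < d.+1)%N by apply: leq_trans (ltn_ord j) _.
rewrite (bigD1 (Ordinal jd)) //= eqxx big1 ?addr0 => [|i ne]; last first.
  by case: eqP => // E; case/eqP: ne; apply: val_inj.
have jk : (j <= k)%N by rewrite -ltnS.
have -> : (d - j = (k - j) + (d - k))%N by lia.
rewrite exprD exprMn !mulrnAl; congr (_ *+ _); ring.
Qed.

Lemma hom_rev d p u v : hom d (revp d p) u v = hom d p v u.
Proof.
rewrite /hom (reindex_inj rev_ord_inj); apply: eq_bigr => k _ /=.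
have kd : (k <= d)%N by rewrite -ltnS.
by rewrite coef_poly subSS ltnS leq_subr subKn // mulrAC.
Qed.

(** Translation by [l], exchange of the variables and translation by [z] are each a linear
    substitution in the binary form. *)
Theorem hom_taylor d p l z u v : (size p <= d.+1)%N ->
  hom d p (u + l * v) v =
  hom d (revp d (p \Po ('X + l%:P)) \Po ('X + z%:P)) (v - z * u) u.
Proof.
move=> sp; rewrite -hom_shift // -hom_rev hom_shift ?size_poly //.
by rewrite subrK.
Qed.

End HomForm.

Lemma rmorph_hom (B S : comNzRingType) (f : {rmorphism B -> S}) d (p : {poly B}) u v :
  f (hom d p u v) = hom d (map_poly f p) (f u) (f v).
Proof.
rewrite /hom rmorph_sum; apply: eq_bigr => k _.
by rewrite !rmorphM !rmorphXn /= coef_map.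
Qed.


Section HomogH.
Variables (R : realType) (m : nat).
Implicit Types (P : {poly {mpoly R[m]}}) (x p w : 'I_m -> R).

Lemma rmorph_homogH (S : comNzRingType) (f : {rmorphism {mpoly R[m + 2]} -> S})
    (g : {rmorphism {mpoly R[m]} -> S}) d P :
  (forall c, f (liftc c) = g c) ->
  f (homogH d P) = hom d (map_poly g P) (f 'X_(var_xn m)) (f 'X_(var_y m)).
Proof.
move=> E; rewrite /homogH /hom rmorph_sum; apply: eq_bigr => k _.
by rewrite !rmorphM !rmorphXn /= E coef_map.
Qed.

Lemma liftcX i : liftc ('X_i : {mpoly R[m]}) = 'X_(lshift 2 i).
Proof. by rewrite /liftc comp_mpolyXU -tnth_nth tnth_mktuple. Qed.

Lemma rmorph_liftc (S : comNzRingType) (f : {rmorphism {mpoly R[m + 2]} -> S})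
    (g : {rmorphism {mpoly R[m]} -> S}) :
  (forall c, f c%:MP = g c%:MP) -> (forall i, f 'X_(lshift 2 i) = g 'X_i) ->
  forall c, f (liftc c) = g c.
Proof.
move=> HC HX; elim/mpoly_ring_ind => [c|i|p q Hp Hq|p q Hp Hq].
- by rewrite /liftc comp_mpolyC HC.
- by rewrite liftcX HX.
- by rewrite /liftc !rmorphD /= -!/(liftc _) Hp Hq.
- by rewrite /liftc !rmorphM /= -!/(liftc _) Hp Hq.
Qed.

Lemma split_lshift i : split (lshift 2 i : 'I_(m + 2)) = inl i.
Proof. exact: (unsplitK (inl i)). Qed.
Lemma split_rshift (j : 'I_2) : split (rshift m j : 'I_(m + 2)) = inr j.
Proof. exact: (unsplitK (inr j)). Qed.

Lemma pt3_l x u v i : pt3 x u v (lshift 2 i) = x i.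
Proof. by rewrite /pt3 split_lshift. Qed.
Lemma pt3_xn x u v : pt3 x u v (var_xn m) = u.
Proof. by rewrite /pt3 split_rshift. Qed.
Lemma pt3_y x u v : pt3 x u v (var_y m) = v.
Proof. by rewrite /pt3 split_rshift. Qed.

Lemma pt3_eta (W : 'I_(m + 2) -> R) :
  W = pt3 (fun i => W (lshift 2 i)) (W (var_xn m)) (W (var_y m)).
Proof.
apply: funext => i; rewrite /pt3; case: splitP => j E.
  by congr W; apply: val_inj.
case: eqP => [j0|j0]; congr W; apply: val_inj => /=; rewrite E ?j0 //.
by case: j j0 {E} => [[|[|]]] //= ? /eqP; rewrite -val_eqE.
Qed.

Lemma line_homogH d P p u v w a b :
  line (pt3 p u v) (pt3 w a b) (homogH d P) =
  hom d (map_poly (line p w) P) (u%:P + a *: 'X) (v%:P + b *: 'X).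
Proof.
rewrite (@rmorph_homogH _ (line (pt3 p u v) (pt3 w a b)) (line p w)).
  by rewrite /= !lineX !pt3_xn !pt3_y.
by apply: rmorph_liftc => [c|i] /=; rewrite ?lineC // !lineX !pt3_l.
Qed.

Definition evform x : {mpoly R[m]} -> {mpoly R[2]} := @mpolyC 2 R \o meval x.
HB.instance Definition _ x := GRing.RMorphism.on (evform x).

Lemma Eval_form_homogH d P x : Eval_form x (homogH d P) =
  hom d (map_poly (evform x) P) 'X_(ord0 : 'I_2) 'X_(ord_max : 'I_2).
Proof.
rewrite /Eval_form; set t := [tuple _ | _ < _].
have tX i : 'X_i \mPo t = tnth t i by rewrite comp_mpolyXU -tnth_nth.
rewrite (@rmorph_homogH _ (comp_mpoly t) (evform x)).
  by rewrite /= !tX !tnth_mktuple /var_xn /var_y !split_rshift.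
apply: rmorph_liftc => [c|i] /=; first by rewrite comp_mpolyC /evform /= mevalC.
by rewrite tX tnth_mktuple split_lshift /evform /= mevalXU.
Qed.

Lemma Eval_form_meval d P x (w : R * R) :
  (Eval_form x (homogH d P)).@[fun i : 'I_2 => if i == ord0 then w.1 else w.2] =
  hom d (Eval x P) w.1 w.2.
Proof.
rewrite Eval_form_homogH (rmorph_hom (meval _)) /= !mevalXU /=; congr (hom _ _ _ _).
by apply/polyP => k; rewrite -map_poly_comp /= !coef_map /= /evform /= mevalC.
Qed.

Lemma map_Frev (S : comNzRingType) (g : {rmorphism {mpoly R[m]} -> S}) l P :
  map_poly g (Frev l P) = revp (size P).-1 (map_poly g P \Po ('X + (g l%:MP)%:P)).
Proof.
by rewrite /Frev map_revp /translate map_comp_poly rmorphD /= map_polyX map_polyC.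
Qed.

Lemma hom_Frev (S : comNzRingType) (g : {rmorphism {mpoly R[m]} -> S}) l P z u v :
  hom (size P).-1 (map_poly g P) (u + g l%:MP * v) v =
  hom (size P).-1 (map_poly g (Frev l P) \Po ('X + z%:P)) (v - z * u) u.
Proof.
rewrite map_Frev -hom_taylor // (leq_trans (size_poly _ _)) //.
exact: leqSpred.
Qed.

(* The affine coordinate z of the projective point (u : v) is v / (u - l v). *)
Lemma Eval_form_root l P x (w : R * R) : nonzero2 w -> (P.[l%:MP]).@[x] != 0 ->
  ((Eval_form x (homogH (size P).-1 P)).@[fun i : 'I_2 => if i == ord0 then w.1 else w.2] = 0
   <-> w.1 - l * w.2 != 0 /\ root (Eval x (Frev l P)) (w.2 / (w.1 - l * w.2))).
Proof.
move=> w0 b0; rewrite Eval_form_meval; set U := w.1 - _; set d := (size P).-1.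
have Ew z : hom d (Eval x P) w.1 w.2 =
    hom d (Eval x (Frev l P) \Po ('X + z%:P)) (w.2 - z * U) U.
  have := hom_Frev (meval x) l P z U w.2; rewrite /= mevalC /U subrK //.
(* [U = 0] is the point [(l : 1)], at infinity for z, where the form is [P.[l]] times a power of
   [w.2] and does not vanish. *)
have [U0|U0] := eqVneq U 0.
  split; last by case; rewrite ?eqxx.
  rewrite (Ew 0) addr0 comp_polyXr U0 mulr0 subr0 /hom big_ord_recr big1 /=.
    rewrite add0r subnn mulr1 => /eqP; rewrite mulf_eq0 expf_eq0.
    have -> : (Eval x (Frev l P))`_d = (P.[l%:MP]).@[x].
      rewrite /Eval coef_map /Frev coef_poly ltnSn subnn.
      by rewrite translate_coef0.
    rewrite (negPf b0) /= => /andP[_ /eqP w20]; case: w0.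
    move/eqP: U0; rewrite subr_eq0 w20 mulr0 => /eqP w10.
    by rewrite [w]surjective_pairing w10 w20.
  by move=> i _; rewrite expr0n subn_eq0 leqNgt ltn_ord mulr0.
rewrite (Ew (w.2 / U)) divfK // subrr /hom big_ord_recl expr0 mulr1 subn0 big1 ?addr0.
  rewrite -horner_coef0 horner_comp hornerD hornerX hornerC add0r rootE.
  split=> [/eqP|[_ /eqP ->]]; last by rewrite mul0r.
  by rewrite mulf_eq0 expf_eq0 (negPf U0) andbF orbF.
by move=> i _; rewrite expr0n mulr0 mul0r.
Qed.

(** The representative, normalised by [u - l * v = 1], of the point [x_n = l + 1 / z]; for [z = 0]
    it is the point at infinity [(1 : 0)]. *)
Definition theta l (z : R) : R * R := (l * z + 1, z).

Lemma theta_nonzero l z : nonzero2 (theta l z).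
Proof. by case=> + z0; rewrite z0 mulr0 add0r => /eqP; rewrite oner_eq0. Qed.

Lemma theta_U l z : (theta l z).1 - l * (theta l z).2 = 1.
Proof. by rewrite /= addrC addKr. Qed.

Lemma proj_root_mult_theta l P x z mu :
  let f := Eval x (Frev l P) \Po ('X + z%:P) in
  (mu <= (size P).-1)%N -> (0 < mu)%N ->
  (forall j, (j < mu)%N -> f`_j = 0) -> f`_mu != 0 ->
  proj_root_mult (Eval_form x (homogH (size P).-1 P)) (theta l z) mu.
Proof.
move=> f mud mu0 flow fmu; set d := (size P).-1 in mud *.
set g := Eval_form _ _; set lf := lin_form (theta l z).1 (theta l z).2.
pose X0 : {mpoly R[2]} := 'X_(ord0 : 'I_2); pose X1 : {mpoly R[2]} := 'X_(ord_max : 'I_2).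
pose U := X0 - l%:MP * X1.
pose ev : {mpoly R[2]} -> R := meval (fun i : 'I_2 => if i == ord0 then (theta l z).1 else (theta l z).2).
have evU : ev U = 1 by rewrite /ev /U mevalB mevalM mevalC !mevalXU /= addrC addKr.
have Elf : lf = - (X1 - z%:MP * U).
  rewrite /lf /lin_form /= /U -!mul_mpolyC rmorphD rmorphM /= mpolyC1.
  rewrite -/X0 -/X1; ring.
have evl : ev lf = 0.
  by rewrite Elf /ev mevalN mevalB mevalM -/(ev U) evU mevalC mevalXU /= mulr1 subrr oppr0.
have lf0 : lf != 0.
  apply/eqP => E; have : ev (lf + U) = 1 by rewrite E add0r.
  have : lf.@[fun i : 'I_2 => if i == ord0 then 0 else 1] = 0 by rewrite E meval0.
  rewrite Elf /U mevalN mevalB mevalM mevalB mevalM !mevalC !mevalXU /=.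
  have : lf.@[fun i : 'I_2 => if i == ord0 then 1 else 0] = 0 by rewrite E meval0.
  rewrite Elf /U mevalN mevalB mevalM mevalB mevalM !mevalC !mevalXU /=.
  rewrite !mulr0 !mulr1 sub0r !subr0 mulr1 opprK => -> /eqP.
  by rewrite mul0r subr0 oppr_eq0 oner_eq0.
have Eg : g = \sum_(j < d.+1) (f`_j)%:MP * (- lf) ^+ j * U ^+ (d - j).
  rewrite /g Eval_form_homogH -[X in hom _ _ X _](subrK (l%:MP * X1) X0).
  have := hom_Frev (evform x) l P z%:MP U X1.
  have El : evform x l%:MP = l%:MP by rewrite /evform /= mevalC.
  rewrite /= El => ->; have -> : X1 - z%:MP * U = - lf by rewrite Elf opprK.
  apply: eq_bigr => j _; congr (_ * _ * _).
  have -> : map_poly (evform x) (Frev l P) \Po ('X + (z%:MP)%:P) =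
      map_poly (@mpolyC 2 R) f.
    rewrite /f map_comp_poly rmorphD /= map_polyX map_polyC /=; congr (_ \Po _).
    by apply/polyP => i; rewrite !coef_map.
  by rewrite coef_map.
pose h := \sum_(j < d.+1 | (mu <= j)%N) (f`_j)%:MP * (-1) ^+ j * lf ^+ (j - mu) * U ^+ (d - j).
have Egh : g = lf ^+ mu * h.
  rewrite Eg /h mulr_sumr [RHS]big_mkcond /=; apply: eq_bigr => j _.
  case: leqP => [le|lt]; last by rewrite flow // mul0r mul0r.
  have -> : (- lf) ^+ j = (-1) ^+ j * (lf ^+ mu * lf ^+ (j - mu)).
    by rewrite -exprD subnKC // [LHS]exprNn.
  by rewrite !mulrA; congr (_ * _ * _); rewrite mulrC mulrA.
have md : (mu < d.+1)%N by [].
have evh : ev h = (-1) ^+ mu * f`_mu.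
  rewrite /h /ev rmorph_sum /= (bigD1 (Ordinal md)) //= subnn expr0 mulr1.
  rewrite !mevalM mevalC rmorph_sign rmorphXn /= -/(ev U) evU expr1n mulr1.
  rewrite big1 => [|j /andP[le ne]]; first by rewrite addr0 mulrC.
  have lt : (mu < j)%N by rewrite ltn_neqAle le andbT eq_sym.
  rewrite !mevalM [meval _ (lf ^+ _)]rmorphXn /= -/(ev lf) evl expr0n subn_eq0 leqNgt lt.
  by rewrite mulr0 mul0r.
have h0 : ev h != 0 by rewrite evh mulf_neq0 ?signr_eq0.
split.
- rewrite Egh mulf_neq0 ?expf_neq0 //; apply: contraNneq h0 => ->.
  by rewrite /ev meval0.
- rewrite -/(ev g) Egh /ev mevalM rmorphXn /= -/(ev lf) evl expr0n.
  by rewrite (gtn_eqF mu0) mul0r.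
- by exists h.
case=> q; rewrite -/lf Egh exprSr -mulrA => /(mulfI (expf_neq0 mu lf0)) Eh.
by move: h0; rewrite Eh /ev mevalM -/(ev lf) evl mul0r eqxx.
Qed.

Lemma coefM_low (S : comNzRingType) (a b : {poly S}) n :
  (forall i, (i < n)%N -> a`_i = 0) -> forall i, (i < n)%N -> (a * b)`_i = 0.
Proof.
move=> H i lt; rewrite coefM big1 // => j _.
by rewrite H ?mul0r // (leq_ltn_trans _ lt) // -ltnS.
Qed.

Lemma coefMcX (S : comNzRingType) (a : {poly S}) c j i :
  (a * (c *: 'X) ^+ j)`_i = if (j <= i)%N then c ^+ j * a`_(i - j) else 0.
Proof. by rewrite exprZn -scalerAr coefZ coefMXn; case: ltnP; rewrite ?mulr0. Qed.

(** Along any direction the homogenised polynomial is the expansion of [Frev l P] with extra factors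
    that are powers of [1 + (a - l * b) * t]; being units, they do not lower the order. Directions
    with [a = l * b] remove them and give the converse. *)
Theorem order_ge_homogH l P p z n :
  (forall a : 'X_{1..m + 2}, (mdeg a < n)%N ->
     ((homogH (size P).-1 P)^`M[a]).@[pt3 p (theta l z).1 (theta l z).2] = 0) <->
  (forall w i j, (i + j < n)%N -> kapp (Frev l P) p w (real_complex R z) i j = 0).
Proof.
set d := (size P).-1; set H := homogH d P.
pose f w := map_poly (line p w) (Frev l P) \Po ('X + (z%:P)%:P).
have Ek w i j : kapp (Frev l P) p w (real_complex R z) i j = real_complex R (f w)`_j`_i.
  rewrite /kapp.
  have -> : map_poly (cline p w) (Frev l P) \Po ('X + ((real_complex R z)%:P)%:P) =
      map_poly (map_poly (real_complex R)) (f w).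
    rewrite /f map_comp_poly rmorphD /= map_polyX map_polyC /= map_polyC /=.
    by congr (_ \Po _); apply/polyP => k; rewrite !coef_map.
  by rewrite !coef_map.
have EL w a b : line (pt3 p (theta l z).1 (theta l z).2) (pt3 w a b) H =
    \sum_(j < d.+1) (f w)`_j * ((b - z * (a - l * b)) *: 'X) ^+ j *
       (1 + (a - l * b) *: 'X) ^+ (d - j).
  rewrite line_homogH; set U := 1 + (a - l * b) *: 'X.
  have -> : (theta l z).1%:P + a *: 'X = U + line p w l%:MP * ((theta l z).2%:P + b *: 'X).
    rewrite lineC /U /= polyCD polyCM polyC1 -!mul_polyC polyCB polyCM; ring.
  rewrite (hom_Frev _ _ _ (z%:P)); apply: eq_bigr => j _; congr (_ * _ ^+ _ * _).
  rewrite /U /= -!mul_polyC !(polyCB, polyCM); ring.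
rewrite order_ge_line; split=> [HL w i j ijn|HK W i lt].
  rewrite Ek; apply/eqP; rewrite fmorph_eq0; apply/eqP.
  have [jd|dj] := leqP j d; last first.
    rewrite [(f w)`_j]nth_default ?coef0 // /f size_comp_poly2 ?size_XaddC //.
    exact: leq_trans (size_poly _ _) (leq_trans (size_poly _ _) dj).
  (* The value of [q] at [b] is the coefficient of index [i + j] along the direction
     [(w, l * b, b)]; letting [b] run over the integers separates the powers of y. *)
  pose q : {poly R} := \sum_(k < d.+1 | (k <= i + j)%N) (f w)`_k`_(i + j - k) *: 'X^k.
  have q0 : q = 0.
    apply: (@poly_eq0_inf _ _ (fun n => n%:R)) => [a b /eqP|b].
      by rewrite eqr_nat => /eqP.
    have := HL (pt3 w (l * b%:R) b%:R) (i + j)%N ijn; rewrite EL subrr mulr0 subr0.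
    rewrite scale0r addr0 coef_sum => <-; rewrite /q horner_sum [LHS]big_mkcond /=.
    apply: eq_bigr => k _; rewrite expr1n mulr1 coefMcX.
    case: leqP => // _; by rewrite hornerZ hornerXn mulrC.
  have jd' : (j < d.+1)%N by [].
  have := congr1 (fun r : {poly R} => r`_j) q0; rewrite coef0 /q coef_sum.
  rewrite (bigD1 (Ordinal jd')) /= ?leq_addl // coefZ coefXn eqxx mulr1 addnK.
  rewrite big1 ?addr0 // => k /andP[_ ne]; rewrite coefZ coefXn.
  by case: eqP => [E|_]; [case/eqP: ne; apply: val_inj|rewrite mulr0].
rewrite (pt3_eta W) EL coef_sum big1 // => j _.
apply: (@coefM_low _ _ _ n) lt => k kn; rewrite coefMcX; case: leqP => // jk.
have := HK (fun i => W (lshift 2 i)) (k - j)%N j; rewrite subnK // => /(_ kn).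
by rewrite Ek => /eqP; rewrite fmorph_eq0 => /eqP ->; rewrite mulr0.
Qed.

End HomogH.

(** * Tracking the roots *)

Lemma shift_prod_coef (K : idomainType) (rs : seq K) (c z : K) : c != 0 ->
  let f := (c *: \prod_(x <- rs) ('X - x%:P)) \Po ('X + z%:P) in
  (forall j, (j < count_mem z rs)%N -> f`_j = 0) /\ f`_(count_mem z rs) != 0.
Proof.
move=> c0 f; pose g := \prod_(x <- rs | x != z) ('X - (x - z)%:P).
have -> : f = c *: ('X^(count_mem z rs) * g).
  rewrite /f comp_polyZ rmorph_prod /=; congr (_ *: _).
  rewrite (bigID (fun x => x == z)) /=; congr (_ * _).
    rewrite (eq_bigr (fun=> 'X)) => [|x /eqP ->]; last first.
      by rewrite comp_polyB comp_polyX comp_polyC addrK.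
    by rewrite big_const_seq iter_mulr mulr1.
  apply: eq_bigr => x _; rewrite comp_polyB comp_polyX comp_polyC polyCB; ring.
split=> [j lt|]; first by rewrite coefZ coefXnM lt mulr0.
rewrite coefZ coefXnM ltnn subnn mulf_neq0 //.
rewrite -horner_coef0 /g horner_prod prodf_seq_neq0; apply/allP => x _.
apply/implyP => xz; rewrite hornerXsubC sub0r oppr_eq0 subr_eq0 //.
Qed.

Lemma sum_count_undup (T : eqType) (rs : seq T) :
  (\sum_(x <- undup rs) count_mem x rs)%N = size rs.
Proof.
rewrite -[RHS](perm_size (perm_count_undup rs)).
by rewrite size_flatten /shape -map_comp sumnE big_map; apply: eq_bigr => x _; rewrite /= size_nseq.
Qed.

Lemma seq_radius (R : realFieldType) (T : eqType) (s : seq T) (Q : T -> R -> Prop) :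
  (forall x r r', Q x r -> r' <= r -> Q x r') ->
  (forall x, x \in s -> exists2 r, 0 < r & Q x r) ->
  exists2 r, 0 < r & forall x, x \in s -> Q x r.
Proof.
move=> mono; elim: s => [|x s IH] H; first by exists 1.
have [r r0 Hr] := H x (mem_head _ _).
have [|r' r0' Hr'] := IH; first by move=> y ys; apply: H; rewrite inE ys orbT.
exists (Num.min r r'); first by rewrite lt_min r0.
move=> y; rewrite inE => /predU1P[->|ys]; first by apply: mono Hr _; rewrite ge_min lexx.
by apply: mono (Hr' y ys) _; rewrite ge_min lexx orbT.
Qed.

Section Tracking.
Variables (R : realType) (m : nat).
Local Notation C := (R[i] : numClosedFieldType).
Local Notation iota := (real_complex R : R -> C).
Variables (F : {poly {mpoly R[m]}}) (d : nat).
Hypothesis sF : size F = d.+1.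
Let b0 := lead_coef F.
Implicit Types (p w v : 'I_m -> R).

Definition Fp p : {poly C} := map_poly (evC p) F.

Lemma kapp0 p w z j : kapp F p w z 0 j = (Fp p \Po ('X + z%:P))`_j.
Proof.
rewrite /kapp -horner_coef0 -[LHS]/(horner_eval 0 _) -coef_map map_comp_poly.
rewrite rmorphD /= map_polyX map_polyC /=.
have -> : map_poly (horner_eval 0) (map_poly (cline p w) F) = Fp p.
  by apply/polyP => k; rewrite !coef_map /= -(cline_coef0 p w) -horner_coef0.
by rewrite /horner_eval hornerC.
Qed.

Lemma kapp00 p w z : kapp F p w z 0 0 = (Fp p).[z].
Proof. by rewrite kapp0 -horner_coef0 horner_comp !hornerE. Qed.

Lemma size_Fp p : evC p b0 != 0 -> size (Fp p) = d.+1.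
Proof. by move=> H; rewrite size_map_poly_id0. Qed.

Lemma Fp_split p : evC p b0 != 0 -> exists2 rs, size rs = d &
  Fp p = evC p b0 *: \prod_(x <- rs) ('X - x%:P).
Proof.
move=> H; have [rs Ers] := closed_field_poly_normal (Fp p).
have lF : lead_coef (Fp p) = evC p b0 by rewrite lead_coef_map_id0 // rmorph0.
rewrite lF in Ers; exists rs => //.
have := congr1 (fun q : {poly C} => size q) Ers.
by rewrite size_scale // size_prod_XsubC size_Fp // => -[].
Qed.

(* The coefficients of [Fp p / b0 p] are bounded near [s]. *)
Lemma roots_bounded s : evC s b0 != 0 -> exists M r : R, 0 < r /\
  forall p z, near_pt s p r -> evC p b0 != 0 /\ (root (Fp p) z -> `|z| <= iota M).
Proof.
move=> bs; pose M := \sum_i `|s i| + 1.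
have M0 : 0 <= M by rewrite addr_ge0 ?sumr_ge0.
have n1 : near_pt s s 1 by move=> i; rewrite subrr normr0.
have inb p : near_pt s p 1 -> inbox M (p, s, 0 : C).
  move=> np; split=> [i|i|] /=; last by rewrite normr0 -(rmorph0 (real_complex R)) ler_iota.
    rewrite -(subrK (s i) (p i)) (le_trans (ler_normD _ _)) // addrC.
    apply: lerD; last exact/ltW/np.
    by rewrite (bigD1 i) //= lerDl sumr_ge0.
  by rewrite /M (bigD1 i) //= -addrA lerDl addr_ge0 ?sumr_ge0.
have := @lip_nonzero R m M (fun x => (cline x.1.1 x.1.2 b0)`_0) (s, s, 0) (@lip_line R m M b0 0%N) (inb s n1).
rewrite /= cline_coef0 => /(_ bs) [r r0 Hr].
pose r1 := Num.min 1 r; have r10 : 0 < r1 by rewrite lt_min ltr01.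
have r1r p : near_pt s p r1 -> near_pt s p 1 /\ `|evC s b0| / 2%:R <= `|evC p b0|.
  move=> np; have n1p : near_pt s p 1.
    by move=> i; apply: lt_le_trans (np i) _; rewrite ge_min lexx.
  split=> //; have := Hr (p, s, 0) (inb p n1p); rewrite /= cline_coef0; apply.
  split=> [i|i|] /=; last by rewrite subrr normr0 -(rmorph0 (real_complex R)) ler_iota ltW.
    by apply: ltW; apply: lt_le_trans (np i) _; rewrite ge_min lexx orbT.
  by rewrite subrr normr0 ltW.
have h0 : 0 < `|evC s b0| / 2%:R by rewrite divr_gt0 ?ltr0n // normr_gt0.
have pb p : near_pt s p r1 -> evC p b0 != 0.
  by move=> /r1r[_ H]; rewrite -normr_gt0 (lt_le_trans h0).
pose Om := {pz : ('I_m -> R) * C | near_pt s pz.1 r1 /\ root (Fp pz.1) pz.2}.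
have : bnd (fun o : Om => (sval o).2).
  apply: (@bnd_root C Om (fun o => (evC (sval o).1 b0)^-1 *: Fp (sval o).1) d).
  - case=> [[p z] [/= np _]]; have b := pb p np.
    by rewrite monicE lead_coefZ lead_coef_map_id0 ?rmorph0 // mulVf.
  - case=> [[p z] [/= np _]]; have b := pb p np.
    by rewrite size_scale ?invr_eq0 // size_Fp.
  - move=> j; have -> : (fun o : Om => ((evC (sval o).1 b0)^-1 *: Fp (sval o).1)`_j) =
       (fun o : Om => (evC (sval o).1 b0)^-1 * evC (sval o).1 F`_j).
      by apply: funext => o; rewrite coefZ coef_map.
    apply: (frM (bnd_ring _ _)).
      apply: (bnd_inv h0); case=> [[p z] [/= np _]].
      by have [] := r1r p np.
    have [L [B [_ HB _]]] := @lip_line R m M F`_j 0%N.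
    exists B => -[[p z] [/= np _]]; rewrite -(cline_coef0 p s).
    by apply: (HB (p, s, 0)); apply: inb; have [] := r1r p np.
  - case=> [[p z] [/= np rz]]; have b := pb p np.
    by rewrite rootZ ?invr_eq0.
case=> B HB; have [b b0' Eb] := ge0_iota (normr_ge0 B).
exists b, r1; split=> // p z np; split=> [|rz]; first exact: pb.
have := HB (exist _ (p, z) (conj np rz)) => /= H.
by rewrite -Eb (@ger0_norm _ B) // (le_trans _ H).
Qed.

Lemma kapp_close M i j (e : R) : 0 < e -> exists2 r, 0 < r &
  forall x y : config R m, inbox M x -> inbox M y -> cclose x y r ->
  `|kapp F x.1.1 x.1.2 x.2 i j - kapp F y.1.1 y.1.2 y.2 i j| < iota e.
Proof.
move=> e0; have [L [B [/ge0_iota[a a0 ->] _ HL]]] := lip_kapp M F i j.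
have a1 : 0 < 1 + a by rewrite ltr_wpDr.
exists (e / (1 + a)); first exact: divr_gt0.
move=> x y ix iy cl; apply: le_lt_trans (HL x y _ ix iy cl) _.
rewrite -rmorphM ltcR mulrCA gtr_pMr // ltr_pdivrMr // mul1r.
by rewrite ltrDr.
Qed.

Lemma near_ptW p q (r r' : R) : near_pt p q r -> r <= r' -> near_pt p q r'.
Proof. by move=> H le i; apply: lt_le_trans (H i) le. Qed.

Lemma inbox_near s v (w : C) (b : R) : exists M, forall p v' z, near_pt s p 1 ->
  near_pt v v' 1 -> `|z - w| <= iota b -> inbox M (p, v', z).
Proof.
have [a a0 Ea] := ge0_iota (normr_ge0 w).
exists (\sum_i `|s i| + \sum_i `|v i| + 1 + a + `|b|) => p v' z np nv nz.
have S0 : 0 <= \sum_i `|s i| by apply: sumr_ge0.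
have V0 : 0 <= \sum_i `|v i| by apply: sumr_ge0.
have B0 := normr_ge0 b.
split=> [i|i|] /=.
- have le : `|s i| <= \sum_i `|s i| by rewrite (bigD1 i) //= lerDl sumr_ge0.
  have := ler_normD (p i - s i) (s i); rewrite subrK; have := np i; lra.
- have le : `|v i| <= \sum_i `|v i| by rewrite (bigD1 i) //= lerDl sumr_ge0.
  have := ler_normD (v' i - v i) (v i); rewrite subrK; have := nv i; lra.
have := ler_normD (z - w) w; rewrite subrK => /le_trans -> //.
rewrite Ea (le_trans (lerD nz (lexx _))) // -rmorphD ler_iota.
have := ler_norm b; lra.
Qed.

(** If every root of [Fp F p0] were at distance at least [e] from [z], the value there would be at
    least [|b0| * e ^ d]; but it is close to the value 0 of [Fp F p], as [z] is bounded. This fixes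
    the tolerance. *)
Lemma roots_proximity p0 (e : R) : evC p0 b0 != 0 -> 0 < e ->
  exists2 r, 0 < r & forall p z, near_pt p0 p r -> root (Fp p) z ->
  exists2 w, root (Fp p0) w & `|z - w| < iota e.
Proof.
move=> b e0; have [B [r1 [r10 HB]]] := roots_bounded b.
have [M HM] := inbox_near p0 p0 0 B.
have n1 (q : 'I_m -> R) : near_pt q q 1 by move=> i; rewrite subrr normr0.
have [rs srs Ers] := Fp_split b.
have [c c0 Ec] := ge0_iota (normr_ge0 (evC p0 b0)).
have cp : 0 < c by rewrite lt0r c0 andbT; apply: contraNneq b => c00; rewrite -normr_eq0 Ec c00.
have [r2 r20 Hr2] := @kapp_close M 0 0 (c * e ^+ d) (mulr_gt0 cp (exprn_gt0 _ e0)).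
exists (Num.min 1 (Num.min r1 r2)); first by rewrite !lt_min ltr01 r10.
move=> p z np rz.
have np1 : near_pt p0 p 1 by apply: near_ptW np _; rewrite ge_min lexx.
have np2 : near_pt p0 p r1 by apply: near_ptW np _; rewrite !ge_min lexx orbT.
have np3 : near_pt p0 p r2 by apply: near_ptW np _; rewrite !ge_min lexx !orbT.
have zB : `|z - 0| <= iota B by rewrite subr0; apply: (proj2 (HB p z np2)).
have := Hr2 (p, p0, z) (p0, p0, z) (HM _ _ _ np1 (n1 _) zB) (HM _ _ _ (n1 _) (n1 _) zB).
rewrite /= !kapp00 (rootP rz) sub0r normrN Ers hornerZ horner_prod normrM Ec => H.
have {H} : iota c * `|\prod_(x <- rs) ('X - x%:P).[z]| < iota (c * e ^+ d).
  apply: H; split=> [i|i|] /=; first exact/ltW/np3.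
    by rewrite subrr normr0 ltW.
  by rewrite subrr normr0 -(rmorph0 (real_complex R)) ler_iota ltW.
have cC : 0 < iota c by rewrite ltcR.
rewrite rmorphM (ltr_pM2l cC) normr_prod rmorphXn /= => lt.
have [[w wr H]|none] := pselect (exists2 w, w \in rs & `|z - w| < iota e).
  by exists w => //; rewrite rootZ // root_prod_XsubC.
case/idP: (lt_geF lt); rewrite -srs.
have : forall x, x \in rs -> iota e <= `|z - x|.
  move=> x xr; rewrite real_leNgt ?ger0_real //; last by rewrite lecR ltW.
  by apply/negP => H; apply: none; exists x.
elim: (rs) => [|x t IH] H; first by rewrite big_nil.
rewrite big_cons /= exprS hornerXsubC; apply: ler_pM.
- by rewrite lecR ltW.
- by rewrite exprn_ge0 // lecR ltW.
- exact: H (mem_head _ _).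
by apply: IH => y yt; apply: H; rewrite inE yt orbT.
Qed.

End Tracking.
(** Double counting: the elements of [ts] related to a given [w] number at most its multiplicity, by
    [inj] and [le]; by [cov] the totals agree, so equality holds everywhere. *)
Lemma matching (T : eqType) (rs ts : seq T) (E : rel T) : size rs = size ts ->
  (forall x, x \in ts -> exists2 w, w \in rs & E x w) ->
  (forall w x x', w \in rs -> x \in ts -> x' \in ts -> E x w -> E x' w -> x = x') ->
  (forall w x, w \in rs -> x \in ts -> E x w -> (count_mem x ts <= count_mem w rs)%N) ->
  forall w, w \in rs -> exists x, [/\ x \in ts, E x w & count_mem x ts = count_mem w rs].
Proof.
move=> sz cov inj le; pose n w := count (E^~ w) ts.
have nE w x : w \in rs -> x \in ts -> E x w -> n w = count_mem x ts.
  move=> wr xt xw; apply: eq_in_count => x' xt' /=.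
  by apply/idP/eqP => [x'w|->] //; apply: inj x'w xw.
have nle w : w \in rs -> (n w <= count_mem w rs)%N.
  move=> wr; case: (boolP (has (E^~ w) ts)) => [/hasP[x xt xw]|].
    by rewrite (nE w x) //; apply: le.
  by rewrite has_count -leqNgt leqn0 => /eqP; rewrite -/(n w) => ->.
have sum : (\sum_(w <- undup rs) count_mem w rs <= \sum_(w <- undup rs) n w)%N.
  rewrite sum_count_undup sz /n.
  under eq_bigr do rewrite -sum1_count big_mkcond.
  rewrite exchange_big /= -sum1_size big_seq [X in (_ <= X)%N]big_seq.
  apply: leq_sum => x xt; have [w wr xw] := cov x xt.
  by rewrite (big_rem w) ?mem_undup //= xw leq_addr.
have eqn w : w \in rs -> n w = count_mem w rs.
  move=> wr; apply/eqP; rewrite eqn_leq nle //=.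
  have wu : w \in undup rs by rewrite mem_undup.
  move: sum; rewrite !(big_rem w wu) /=; set A := (\sum_(_ <- _) count_mem _ _)%N.
  set B := (\sum_(_ <- _) n _)%N; have : (B <= A)%N.
    rewrite /A /B big_seq [X in (_ <= X)%N]big_seq; apply: leq_sum => y yr.
    by apply: nle; rewrite -mem_undup (mem_rem yr).
  by move: (n w) (count_mem w rs) => *; lia.
move=> w wr; have : has (E^~ w) ts.
  by rewrite has_count -/(n w) eqn // -has_count has_pred1.
by move=> /hasP[x xt xw]; exists x; split; rewrite // -(nE w x) // eqn.
Qed.

(** * Continuation of the real roots near [s] *)

Section Local.
Variables (R : realType) (m : nat).
Local Notation C := (R[i] : numClosedFieldType).
Local Notation iota := (real_complex R : R -> C).
Variables (F : {poly {mpoly R[m]}}) (d : nat).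
Hypothesis sF : size F = d.+1.
Let b0 := lead_coef F.
Implicit Types (p w v : 'I_m -> R).
Variables (T : ('I_m -> R) -> Prop) (s v0 : 'I_m -> R) (r0 c : R).
Hypotheses (Ts : T s) (r0_gt0 : 0 < r0) (c_gt0 : 0 < c).
Hypothesis sep : forall p v, T p -> near_pt s p r0 -> near_pt v0 v r0 ->
  [/\ evC p b0 != 0,
    forall z z', root (Fp F p) z -> root (Fp F p) z' -> z != z' -> iota c <= `|z - z'| &
    forall z k, root (Fp F p) z ->
      (exists i j, (i + j < k)%N /\ kapp F p v z i j != 0) ->
      exists i j, (i + j < k)%N /\ iota c <= `|kapp F p v z i j|].

Definition ordge p (z : C) k := forall w i j, (i + j < k)%N -> kapp F p w z i j = 0.

Lemma kapp_real p w (a : R) i j : kapp F p w (iota a) i j =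
  iota (hom_part i (mshift p (F \Po ('X + (a%:MP)%:P))`_j)).@[w].
Proof.
rewrite -line0_coef -line_shift /kapp.
have -> : map_poly (cline p w) F \Po ('X + (iota a)%:P%:P) =
   map_poly (cline p w) (F \Po ('X + (a%:MP)%:P)).
  rewrite map_comp_poly rmorphD /= map_polyX map_polyC /=.
  by rewrite -[cline p w a%:MP]/(map_poly iota (line p w a%:MP)) lineC map_polyC.
by rewrite coef_map -[LHS]/((map_poly iota (line p w _))`_i) coef_map.
Qed.

Let quarter (e : R) : 0 < e -> 4%:R * e <= c ->
  [/\ e + e <= c, 2%:R * e <= c & e + e + e <= c].
Proof. by move=> *; split; lra. Qed.

Let near_refl (q : 'I_m -> R) (r : R) : 0 < r -> near_pt q q r.
Proof. by move=> r0' i; rewrite subrr normr0. Qed.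

(** For fixed [i] and [j] the coefficient is a polynomial in the direction, hence zero if it
    vanishes near [v0]. Separation is available only for such directions. *)
Lemma ordge_real_v p (a r : R) k : 0 < r ->
  (forall v, near_pt v0 v r -> forall i j, (i + j < k)%N -> kapp F p v (iota a) i j = 0) ->
  ordge p (iota a) k.
Proof.
move=> r_gt0 H w i j ij; rewrite kapp_real; apply/eqP; apply: contraT => nz.
set q := hom_part _ _ in nz *.
have q0 : q != 0 by apply: contraNneq nz => ->; rewrite meval0 rmorph0.
have [v [nv /eqP[]]] := mpoly_nonvanishing v0 q0 r_gt0.
by apply: (fmorph_inj (real_complex R)); rewrite rmorph0 -(H v nv i j ij) kapp_real.
Qed.

(** A coefficient that is nonzero at [s] stays nonzero nearby. Conversely, coefficients of low
    degree vanishing at [s] are smaller than [c] nearby, and separation then forces all of them to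
    vanish. *)
Lemma order_local (w : C) k : root (Fp F s) w -> exists2 r, 0 < r &
  forall p (a : R), T p -> near_pt s p r -> `|iota a - w| <= iota r -> root (Fp F p) (iota a) ->
  (ordge p (iota a) k <-> ordge s w k).
Proof.
move=> rw; have [Os|nOs] := pselect (ordge s w k); last first.
  have [v [i [j [ij nz]]]] : exists v i j, (i + j < k)%N /\ kapp F s v w i j != 0.
    apply: contrapT => H; apply: nOs => v i j ij; apply/eqP; apply: contraT => nz.
    by case: H; exists v, i, j.
  have [M HM] := inbox_near s v w 1.
  have [|//|r r_gt0 Hr] := @lip_nonzero R m M _ (s, v, w) (lip_kapp M F i j).
    by apply: HM; rewrite ?subrr ?normr0 ?lecR //; apply: near_refl.
  exists (Num.min 1 r); first by rewrite lt_min ltr01.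
  move=> p a Tp np na _; split; last by move/nOs.
  move=> Op; exfalso; suff : `|kapp F s v w i j| / 2%:R <= 0.
    by apply/negP; rewrite -normr_gt0 in nz; rewrite lt_geF; [|exact: divr_gt0 nz (ltr0n _ 2)].
  rewrite -[X in _ <= X](normr0 C) -(Op v i j ij).
  apply: (Hr (p, v, iota a)); last split=> [l|l|] /=.
  - apply: HM; [apply: near_ptW np _; rewrite ge_min lexx //|exact: near_refl|].
    by apply: le_trans na _; rewrite lecR ge_min lexx.
  - by apply/ltW/(near_ptW np); rewrite ge_min lexx orbT.
  - by rewrite subrr normr0 ltW.
  by apply: le_trans na _; rewrite lecR ge_min lexx orbT.
have [M HM] := inbox_near s v0 w 1.
pose Q (ij : nat * nat) r := forall p v z, near_pt s p 1 -> near_pt v0 v 1 ->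
  `|z - w| <= iota 1 -> near_pt s p r -> `|z - w| <= iota r ->
  `|kapp F p v z ij.1 ij.2 - kapp F s v w ij.1 ij.2| < iota c.
have [||r r_gt0 HQ] := @seq_radius R _ [seq (i, j) | i <- seq.iota 0 k, j <- seq.iota 0 k] Q.
- move=> ij r r' H le p v z np1 nv nz1 np nz; apply: H => //.
  + exact: near_ptW np le.
  + by apply: le_trans nz _; rewrite lecR.
- move=> ij _; have [r r_gt0 Hr] := kapp_close F M ij.1 ij.2 c_gt0.
  exists r => // p v z np1 nv nz1 np nz.
  apply: (Hr (p, v, z) (s, v, w)).
  + exact: HM.
  + by apply: HM; rewrite ?subrr ?normr0 ?lecR //; apply: near_refl.
  split=> [l|l|] //=; first exact/ltW/np.
  by rewrite subrr normr0 ltW.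
pose r1 := Num.min 1 (Num.min r r0).
exists r1; first by rewrite !lt_min ltr01 r_gt0.
move=> p a Tp np na ra; split; first by move=> _; exact: Os.
move=> _; have r2_gt0 : 0 < Num.min 1 r0 by rewrite lt_min ltr01.
apply: (ordge_real_v r2_gt0) => v nv i j ij; apply/eqP; apply: contraT => nz.
have nv1 : near_pt v0 v 1 by apply: near_ptW nv _; rewrite ge_min lexx.
have nv0 : near_pt v0 v r0 by apply: near_ptW nv _; rewrite ge_min lexx orbT.
have np0 : near_pt s p r0 by apply: near_ptW np _; rewrite !ge_min lexx !orbT.
have [_ _ /(_ _ k ra)[|i' [j' [ij' /le_gtF]]]] := sep Tp np0 nv0.
  by exists i, j.
have := HQ (i', j') _ p v (iota a); rewrite /= (Os v i' j' ij') subr0 => -> //.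
- by rewrite allpairs_f // mem_iota /= add0n (leq_ltn_trans _ ij') ?leq_addr ?leq_addl.
- by apply: near_ptW np _; rewrite ge_min lexx.
- by apply: le_trans na _; rewrite lecR ge_min lexx.
- by apply: near_ptW np _; rewrite !ge_min lexx !orbT.
by apply: le_trans na _; rewrite lecR !ge_min lexx !orbT.
Qed.
Let np0 : near_pt s s r0. Proof. exact: near_refl. Qed.
Let nv0 : near_pt v0 v0 r0. Proof. exact: near_refl. Qed.

Lemma root_sep p (z z' y : C) (e e' : R) : T p -> near_pt s p r0 -> root (Fp F p) z ->
  root (Fp F p) z' -> `|z - y| < iota e -> `|z' - y| < iota e' -> e + e' <= c -> z = z'.
Proof.
move=> Tp np rz rz' h h' ec; apply/eqP; apply: contraT => ne.
have [_ /(_ z z' rz rz' ne) H _] := sep Tp np nv0.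
have : iota c < iota c.
  apply: (le_lt_trans H); apply: (@lt_le_trans _ _ (iota (e + e'))); last by rewrite lecR.
  rewrite -(subrK y z) -addrA -[y - z']opprB rmorphD.
  by apply: le_lt_trans (ler_normB _ _) _; apply: ltrD.
by rewrite ltxx.
Qed.

Lemma local_match rs : Fp F s = evC s b0 *: \prod_(x <- rs) ('X - x%:P) -> size rs = d ->
  exists2 e, 0 < e /\ 4%:R * e <= c & exists2 r, 0 < r /\ r <= r0 & forall p, T p -> near_pt s p r ->
  exists ts, [/\ Fp F p = evC p b0 *: \prod_(x <- ts) ('X - x%:P),
    forall x, x \in ts -> exists2 w : C, w \in rs & `|x - w| < iota e,
    forall w : C, w \in rs -> exists x, [/\ x \in ts, `|x - w| < iota e & count_mem x ts = count_mem w rs] &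
    forall (w : C) a k, w \in rs -> iota a \in ts -> `|iota a - w| < iota e -> (k <= d)%N ->
      ordge p (iota a) k <-> ordge s w k].
Proof.
move=> Ers srs; have [bs _ _] := sep Ts np0 nv0.
(* Upper semicontinuity of multiplicity: the first nonzero Taylor coefficient at [w] stays nonzero,
   so a nearby root cannot have larger multiplicity. *)
pose Qm (w : C) r := forall p (z : C), near_pt s p r -> `|z - w| <= iota r ->
  kapp F p s z 0 (count_mem w rs) != 0.
pose Qo (w : C) k r := forall p a, T p -> near_pt s p r -> `|iota a - w| <= iota r ->
  root (Fp F p) (iota a) -> (ordge p (iota a) k <-> ordge s w k).
pose Q (w : C) r := Qm w r /\ forall k, (k <= d)%N -> Qo w k r.
have Qmle (w : C) r r' : Qm w r -> r' <= r -> Qm w r'.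
  move=> H le p z np nz; apply: H; first exact: near_ptW np le.
  by apply: le_trans nz _; rewrite lecR.
have Qole (w : C) k r r' : Qo w k r -> r' <= r -> Qo w k r'.
  move=> H le p a Tp np na; apply: H => //; first exact: near_ptW np le.
  by apply: le_trans na _; rewrite lecR.
have [||r1 r1_gt0 HQ] := @seq_radius R C rs Q.
- move=> w r r' [H1 H2] le; split; first exact: Qmle H1 le.
  by move=> k kd; apply: Qole (H2 k kd) le.
- move=> w wr; have rw : root (Fp F s) w by rewrite Ers rootZ // root_prod_XsubC.
  have [|k _|r2 r2_gt0 Ho] := @seq_radius R nat (seq.iota 0 d.+1) (Qo w).
  + by move=> k r r'; apply: Qole.
  + exact: order_local.
  have [r3 r3_gt0 Hm] : exists2 r, 0 < r & Qm w r.
    have [M HM] := inbox_near s s w 1.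
    have nz : kapp F s s w 0 (count_mem w rs) != 0.
      by rewrite kapp0 Ers; apply: (proj2 (shift_prod_coef _ _ bs)).
    have [|//|r r_gt0 Hr] := @lip_nonzero R m M _ (s, s, w) (lip_kapp M F 0 (count_mem w rs)).
      by apply: HM; rewrite ?subrr ?normr0 ?lecR //; apply: near_refl.
    exists (Num.min 1 r); first by rewrite lt_min ltr01.
    have h : 0 < `|kapp F s s w 0 (count_mem w rs)| / 2%:R.
      by rewrite -normr_gt0 in nz; exact: divr_gt0 nz (ltr0n _ 2).
    move=> p z np nz'; rewrite -normr_gt0; apply: (lt_le_trans h).
    apply: (Hr (p, s, z)); last split=> [l|l|] /=.
    - apply: HM; [apply: near_ptW np _; rewrite ge_min lexx //|exact: near_refl|].
      by apply: le_trans nz' _; rewrite lecR ge_min lexx.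
    - by apply/ltW/(near_ptW np); rewrite ge_min lexx orbT.
    - by rewrite subrr normr0 ltW.
    by apply: le_trans nz' _; rewrite lecR ge_min lexx orbT.
  exists (Num.min r2 r3); first by rewrite lt_min r2_gt0.
  split; first by apply: Qmle Hm _; rewrite ge_min lexx orbT.
  move=> k kd; apply: Qole (Ho k _) _; first by rewrite mem_iota.
  by rewrite ge_min lexx.
(* The factor 4 leaves room for sums of up to three distances below [e]. *)
pose e := Num.min r1 (c / 4%:R).
have e_gt0 : 0 < e by rewrite lt_min r1_gt0 divr_gt0 ?ltr0n.
have er1 : e <= r1 by rewrite ge_min lexx.
have ec : 4%:R * e <= c by rewrite mulrC -ler_pdivlMr ?ltr0n // ge_min lexx orbT.
exists e => //; have [r2 r2_gt0 Hp] := roots_proximity sF bs e_gt0.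
exists (Num.min r0 (Num.min r1 r2)).
  by rewrite !lt_min r0_gt0 r1_gt0 ge_min lexx.
move=> p Tp np.
have npr0 : near_pt s p r0 by apply: near_ptW np _; rewrite ge_min lexx.
have npr1 : near_pt s p r1 by apply: near_ptW np _; rewrite !ge_min lexx orbT.
have npr2 : near_pt s p r2 by apply: near_ptW np _; rewrite !ge_min lexx !orbT.
have [bp _ _] := sep Tp npr0 nv0.
have [ts sts Ets] := Fp_split sF bp.
have Rp x : (root (Fp F p) x) = (x \in ts) by rewrite Ets rootZ // root_prod_XsubC.
have cov x : x \in ts -> exists2 w : C, w \in rs & `|x - w| < iota e.
  rewrite -Rp => rx; have [w rw lt] := Hp p x npr2 rx; exists w => //.
  by move: rw; rewrite Ers rootZ // root_prod_XsubC.
have le1 (x w : C) : `|x - w| < iota e -> `|x - w| <= iota r1.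
  by move=> lt; apply: ltW; apply: lt_le_trans lt _; rewrite lecR.
exists ts; split; [exact: Ets|exact: cov| |].
- have Hm := @matching C rs ts (fun x y : C => `|x - y| < iota e).
  move=> w wr; have [||||x [xt xw xc]] := Hm _ _ _ _ w wr; last by exists x; split.
  + by rewrite srs.
  + exact: cov.
  + move=> y x x' yr xt xt' h h'; apply: (root_sep Tp npr0 _ _ h h'); rewrite ?Rp //.
    by have [] := quarter e_gt0 ec.
  move=> y x yr xt h; rewrite leqNgt; apply/negP => lt.
  have [/(_ p x npr1 (le1 _ _ h)) + _] := HQ y yr.
  by rewrite kapp0 Ets (proj1 (shift_prod_coef ts x bp)) // eqxx.
move=> w a k wr at_ h kd; have [_ /(_ k kd) H] := HQ w wr.
by apply: H => //; [exact: le1|rewrite Rp].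
Qed.
Lemma conj_iota (a : R) : (iota a)^* = iota a.
Proof. by rewrite conj_Creal // realE !lecR le_total. Qed.

Lemma root_conj p (z : C) : root (Fp F p) z -> root (Fp F p) z^*.
Proof.
have -> : root (Fp F p) z^* = root (map_poly Num.conj (Fp F p)) z^*.
  congr root; rewrite -[RHS]map_poly_comp; apply: eq_map_poly => c' /=.
  by rewrite conj_iota.
by rewrite mapf_root.
Qed.

Lemma conj_id_real (z : C) : z^* = z -> iota (complex.Re z) = z.
Proof. by move=> zz; apply: RRe_real; apply/CrealP. Qed.

(** The conjugate root is equally close to the real number [a], so separation identifies it with
    [z]. *)
Lemma root_near_real p (z : C) (a e : R) : T p -> near_pt s p r0 -> root (Fp F p) z ->
  `|z - iota a| < iota e -> 2%:R * e <= c -> iota (complex.Re z) = z.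
Proof.
move=> Tp np rz lt ec; apply: conj_id_real; apply: (root_sep Tp np (root_conj rz) rz _ lt).
  by rewrite -(conj_iota a) -rmorphB norm_conjC; exact: lt.
by rewrite -mulr2n -mulr_natl.
Qed.

Theorem root_tracking : exists k (zeta : 'I_k -> ('I_m -> R) -> R) (mu : 'I_k -> nat) (r : R),
  0 < r /\ forall p, T p -> near_pt s p r ->
  [/\ forall a, root (Fp F p) (iota a) <-> exists l, a = zeta l p,
    forall l l', zeta l p = zeta l' p -> l = l',
    forall l, [/\ (0 < mu l <= d)%N,
      forall j, (j < mu l)%N -> (Fp F p \Po ('X + (iota (zeta l p))%:P))`_j = 0 &
      (Fp F p \Po ('X + (iota (zeta l p))%:P))`_(mu l) != 0],
    forall l e, 0 < e -> exists2 r', 0 < r' &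
      forall q, T q -> near_pt s q r -> near_pt p q r' -> `|zeta l q - zeta l p| < e &
    forall l n, ordge p (iota (zeta l p)) n <-> ordge s (iota (zeta l s)) n].
Proof.
have [bs _ _] := sep Ts np0 nv0.
have [rs srs Ers] := Fp_split sF bs.
have Rs z : root (Fp F s) z = (z \in rs) by rewrite Ers rootZ // root_prod_XsubC.
have [e [e_gt0 ec] [r [r_gt0 rr0] H]] := local_match Ers srs.
(* The distinct real roots at [s]; they index the sections. *)
pose wr := [seq z <- undup rs | iota (complex.Re z) == z].
pose wl (l : 'I_(size wr)) := tnth (in_tuple wr) l.
have wlr l : wl l \in rs.
  by have := mem_tnth l (in_tuple wr); rewrite mem_filter mem_undup => /andP[].
have wlE l : iota (complex.Re (wl l)) = wl l.
  by have := mem_tnth l (in_tuple wr); rewrite mem_filter => /andP[/eqP].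
pose good l p a := [/\ root (Fp F p) (iota a), `|iota a - wl l| < iota e,
  forall j, (j < count_mem (wl l) rs)%N -> (Fp F p \Po ('X + (iota a)%:P))`_j = 0,
  (Fp F p \Po ('X + (iota a)%:P))`_(count_mem (wl l) rs) != 0 &
  forall n, (n <= d)%N -> ordge p (iota a) n <-> ordge s (wl l) n].
have nr p : near_pt s p r -> near_pt s p r0 by move=> np; apply: near_ptW np rr0.
have /choice[zeta0 Hz0] (lp : 'I_(size wr) * ('I_m -> R)) :
    exists a, T lp.2 -> near_pt s lp.2 r -> good lp.1 lp.2 a.
  case: lp => l p /=; have [[Tp np]|n] := pselect (T p /\ near_pt s p r); last first.
    by exists 0 => Tp np; case: n.
  have [ts [Ets _ Hm Ho]] := H p Tp np.
  have [x [xt xl xc]] := Hm (wl l) (wlr l).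
  have [bp _ _] := sep Tp (nr p np) nv0.
  have rx : root (Fp F p) x by rewrite Ets rootZ // root_prod_XsubC.
  have xE : iota (complex.Re x) = x.
    apply: (@root_near_real p x (complex.Re (wl l)) e Tp (nr p np) rx).
      by rewrite wlE.
    by have [] := quarter e_gt0 ec.
  exists (complex.Re x) => _ _; rewrite /good xE -xc Ets; split.
  - by rewrite -Ets.
  - exact: xl.
  - exact: (proj1 (shift_prod_coef ts x bp)).
  - exact: (proj2 (shift_prod_coef ts x bp)).
  by move=> n nd; rewrite -xE; apply: Ho; rewrite ?xE.
pose zeta l p := zeta0 (l, p).
have Hz l p : T p -> near_pt s p r -> good l p (zeta l p) by move=> Tp np; exact: (Hz0 (l, p)).
have nss : near_pt s s r by apply: near_refl.
exists (size wr), zeta, (fun l => count_mem (wl l) rs), r; split; first exact: r_gt0.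
move=> p Tp np.
have mud l : (0 < count_mem (wl l) rs <= d)%N.
  by rewrite -has_count has_pred1 wlr -srs count_size.
split.
- move=> a; split=> [ra|[l ->]]; last by have [] := Hz l p Tp np.
  have [ts [Ets Hc _ _]] := H p Tp np.
  have [bp _ _] := sep Tp (nr p np) nv0.
  have [w wr' aw] : exists2 w : C, w \in rs & `|iota a - w| < iota e.
    by apply: Hc; move: ra; rewrite Ets rootZ // root_prod_XsubC.
  have wE : iota (complex.Re w) = w.
    apply: (@root_near_real s w a e Ts np0); rewrite ?Rs //; first by rewrite distrC.
    by have [] := quarter e_gt0 ec.
  have : w \in wr by rewrite mem_filter wE eqxx mem_undup.
  move=> /(tnthP (in_tuple wr))[l El]; exists l; apply: (fmorph_inj (real_complex R)).
  have [rz zl _ _ _] := Hz l p Tp np.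
  apply: (@root_sep p _ _ w e e Tp (nr p np) ra rz aw); first by rewrite El; exact: zl.
  by have [] := quarter e_gt0 ec.
- move=> l l' E; have [_ zl _ _ _] := Hz l p Tp np; have [_ zl' _ _ _] := Hz l' p Tp np.
  rewrite E distrC in zl; rewrite distrC in zl'.
  have : wl l = wl l'.
    apply: (root_sep Ts np0 _ _ zl zl'); rewrite ?Rs //.
    by have [] := quarter e_gt0 ec.
  rewrite /wl !(tnth_nth 0) => /eqP; rewrite nth_uniq ?filter_uniq ?undup_uniq //.
  by move/eqP/val_inj.
- by move=> l; have [_ _ z1 z2 _] := Hz l p Tp np; split.
(* Continuity is needed at every [p], not only at [s]. A root [w] at [p] close to [zeta l q] is
   within [e + e] of [wl l], and [zeta l p] within [e], so separation at [p] makes them equal. *)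
- move=> l e1 e1_gt0; have [bp _ _] := sep Tp (nr p np) nv0.
  have e2_gt0 : 0 < Num.min e1 e by rewrite lt_min e1_gt0.
  have [r' r'_gt0 Hp] := roots_proximity sF bp e2_gt0.
  exists r' => // q Tq nq npq; have [rq ql _ _ _] := Hz l q Tq nq.
  have [w rw qw] := Hp q _ npq rq.
  have [rz zl _ _ _] := Hz l p Tp np.
  suff E : w = iota (zeta l p).
    rewrite E -rmorphB norm_iota ltcR in qw.
    by apply: lt_le_trans qw _; rewrite ge_min lexx.
  have qw' : `|w - iota (zeta l q)| < iota e.
    by rewrite distrC (lt_le_trans qw) // lecR ge_min lexx orbT.
  apply: (@root_sep p w _ (wl l) (e + e) e Tp (nr p np) rw rz _ zl).
    rewrite -(subrK (iota (zeta l q)) w) -addrA rmorphD.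
    by apply: le_lt_trans (ler_normD _ _) _; apply: ltrD.
  by have [] := quarter e_gt0 ec.
move=> l n; have [_ _ _ kp Hp] := Hz l p Tp np; have [_ _ _ ks Hs] := Hz l s Ts nss.
(* For [n] above [d] both sides fail: the Taylor coefficient whose index is the multiplicity, at
   most [d], is nonzero. *)
have [nd|dn] := leqP n d; first exact: iff_trans (Hp n nd) (iff_sym (Hs n nd)).
have nge q : (Fp F q \Po ('X + (iota (zeta l q))%:P))`_(count_mem (wl l) rs) != 0 ->
    ~ ordge q (iota (zeta l q)) n.
  move=> nz /(_ q 0%N (count_mem (wl l) rs)); rewrite kapp0 => E.
  case/eqP: nz; apply: E; apply: leq_ltn_trans dn.
  by have /andP[] := mud l.
by split=> [/(nge p kp)|/(nge s ks)].
Qed.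
End Local.
(** * Local connectedness of submanifolds *)

Lemma unit_interval_connected (R : realType) (A B : R -> Prop) :
  (forall t, 0 <= t <= 1 -> A t \/ B t) -> (forall t, 0 <= t <= 1 -> ~ (A t /\ B t)) ->
  (forall t, 0 <= t <= 1 -> A t -> exists2 r, 0 < r &
     forall u, 0 <= u <= 1 -> `|u - t| < r -> A u) ->
  (forall t, 0 <= t <= 1 -> B t -> exists2 r, 0 < r &
     forall u, 0 <= u <= 1 -> `|u - t| < r -> B u) ->
  A 0 -> B 1 -> False.
Proof.
move=> AB nAB oA oB A0 B1.
pose E t := 0 <= t <= 1 /\ forall u, 0 <= u <= t -> A u.
have E0 : E 0.
  split; rewrite ?lexx ?ler01 // => u; rewrite -eq_le => /eqP <- //.
have ub : classical_sets.has_sup E by split; [exists 0|exists 1 => t [/andP[]]].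
have s01 : 0 <= sup E <= 1.
  apply/andP; split; first exact: (sup_upper_bound ub E0).
  by apply: ge_sup; [exists 0|move=> t [/andP[]]].
have [As|Bs] := AB _ s01.
  have [r r0 Hr] := oA _ s01 As; have [t [_ tA] lt] := sup_adherent r0 ub.
  have [s1|s1] := leP 1 (sup E).
    have E1 : sup E = 1 by apply/eqP; rewrite eq_le s1; case/andP: s01 => _ ->.
    by apply: (nAB (sup E) s01); rewrite {2}E1.
  pose v := Num.min 1 (sup E + r / 2%:R).
  have vs : sup E < v by rewrite lt_min s1 ltrDl divr_gt0 ?ltr0n.
  have v0 : 0 <= v by case/andP: s01 => s0 _; apply: le_trans s0 (ltW vs).
  have v1 : v <= 1 by rewrite ge_min lexx.
  have vr : v <= sup E + r / 2%:R by rewrite ge_min lexx orbT.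
  have : E v.
    split=> [|u /andP[u0 uv]]; first by rewrite v0 v1.
    have [ut|tu] := leP u t; first by apply: tA; rewrite u0 ut.
    apply: Hr; first by rewrite u0 (le_trans uv v1).
    by rewrite ltr_norml; apply/andP; split; lra.
  by move/(sup_upper_bound ub); rewrite leNgt vs.
have [r r0 Hr] := oB _ s01 Bs; have [t tE lt] := sup_adherent r0 ub.
have [t01 tA] := tE; have ts := sup_upper_bound ub tE.
apply: (nAB t t01); split; first by apply: tA; case/andP: t01 => -> _ /=; rewrite lexx.
apply: Hr => //; rewrite ltr_norml; apply/andP; split; lra.
Qed.

Section Manifold.
Variables (R : realType) (k : nat).
Implicit Types (p q x y : 'I_k -> R) (S U : ('I_k -> R) -> Prop).

(* The terms of the series at [x], except the constant one, are at most [t]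
   times the terms at the corner of a polydisc of convergence. *)
Lemma analytic_continuous (f : ('I_k -> R) -> R) a : analytic_at f a ->
  forall e, 0 < e -> exists2 r, 0 < r & forall x, near_pt a x r -> `|f x - f a| < e.
Proof.
move=> [c [r r_gt0 H]] e e_gt0; pose rho := r / 2%:R.
have rho_gt0 : 0 < rho by rewrite divr_gt0 ?ltr0n.
have rhor : rho < r by rewrite /rho; lra.
have nr : near_pt a (fun i => a i + rho) r.
  by move=> i; rewrite addrC addKr gtr0_norm.
have [[M HM] _] := H _ nr.
have M0 : 0 <= M by apply: le_trans (HM 0%N); apply: sumr_ge0.
pose t := Num.min 1 (e / (4%:R * (1 + M))).
have M1 : 0 < 4%:R * (1 + M) by rewrite mulr_gt0 ?ltr0n // ltr_wpDr.
have t_gt0 : 0 < t by rewrite lt_min ltr01 divr_gt0.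
have t1 : t <= 1 by rewrite ge_min lexx.
have tM : t * M <= e / 4%:R.
  have : t * (4%:R * (1 + M)) <= e by rewrite -ler_pdivlMr // ge_min lexx orbT.
  by move: t_gt0; nra.
exists (t * rho); first exact: mulr_gt0.
move=> x nx.
have nxr : near_pt a x r.
  move=> i; apply: lt_le_trans (nx i) _; apply: le_trans (ltW rhor).
  by rewrite ler_piMl // ltW.
have naa : near_pt a a r by move=> i; rewrite subrr normr0.
have e4 : 0 < e / 4%:R by rewrite divr_gt0 ?ltr0n.
have [N1 HN1] := (proj2 (H x nxr)) _ e4; have [N2 HN2] := (proj2 (H a naa)) _ e4.
pose N := maxn N1 N2; have := HN1 N (leq_maxl _ _); have := HN2 N (leq_maxr _ _).
suff : `|box_sum N c a x - box_sum N c a a| <= t * M.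
  move: (box_sum N c a x) (box_sum N c a a) => bx ba h1 h2 h3.
  have -> : f x - f a = (bx - ba) + (ba - f a) - (bx - f x) by ring.
  apply: le_lt_trans (ler_normB _ _) _.
  by have := ler_normD (bx - ba) (ba - f a); lra.
apply: (@le_trans _ _ (t * box_abs_sum N c a (fun i => a i + rho))); last first.
  by rewrite ler_pM2l.
rewrite /box_sum /box_abs_sum -sumrB mulr_sumr (le_trans (ler_norm_sum _ _ _)) //.
apply: ler_sum => g _; rewrite -mulrBr !normrM mulrCA; apply: ler_wpM2l => //.
have -> : `|\prod_i (a i + rho - a i) ^+ g i| = \prod_i rho ^+ g i.
  rewrite normr_prod; apply: eq_bigr => i _.
  by rewrite addrC addKr normrX gtr0_norm.
have pr i : 0 <= rho ^+ g i by rewrite exprn_ge0 // ltW.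
have xr i : `|x i - a i| ^+ g i <= rho ^+ g i.
  apply: lerXn2r; rewrite ?nnegrE ?(ltW rho_gt0) //.
  by apply: le_trans (ltW (nx i)) _; rewrite ler_piMl // ltW.
have [g0|] := boolP [forall i, nat_of_ord (g i) == 0%N].
  rewrite !big1 ?subrr ?normr0 ?mulr1 ?(ltW t_gt0) // => i _;
    by rewrite (eqP (forallP g0 i)).
rewrite negb_forall => /existsP[i gi].
have -> : \prod_i (a i - a i) ^+ g i = 0.
  by rewrite (bigD1 i) //= subrr expr0n (negPf gi) mul0r.
rewrite subr0 normr_prod (bigD1 i) //= [X in _ <= t * X](bigD1 i) //= mulrA.
apply: ler_pM; rewrite ?normr_ge0 ?prodr_ge0 //.
  rewrite normrX; apply: (@le_trans _ _ ((t * rho) ^+ g i)).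
    have tr : 0 <= t * rho by rewrite ltW // mulr_gt0.
    by apply: lerXn2r; rewrite ?nnegrE // ltW.
  rewrite exprMn; apply: ler_wpM2r => //.
  by case: (nat_of_ord (g i)) gi => // n _; rewrite exprS ler_piMr ?(ltW t_gt0) // exprn_ile1 ?(ltW t_gt0).
apply: ler_prod => j _; rewrite normr_ge0 normrX; exact: xr.
Qed.

Lemma analytic_map_continuous U (phi : ('I_k -> R) -> 'I_k -> R) a : analytic_map_on U phi -> U a ->
  forall e, 0 < e -> exists2 r, 0 < r & forall x, near_pt a x r -> near_pt (phi a) (phi x) e.
Proof.
move=> H Ua e e_gt0.
pose Q (i : 'I_k) r := forall x, near_pt a x r -> `|phi x i - phi a i| < e.
have [i r r' Hr le x nx|i _|r r_gt0 Hr] := @seq_radius R _ (enum 'I_k) Q.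
- by apply: Hr; apply: near_ptW nx le.
- exact: (analytic_continuous (H i a Ua)).
exists r => // x nx i; apply: Hr => //; exact: mem_enum.
Qed.

Lemma open_box p q (r : R) : near_pt p q r ->
  exists2 e, 0 < e & forall x, near_pt q x e -> near_pt p x r.
Proof.
move=> npq; pose Q (i : 'I_k) e := forall y : R, `|y - q i| < e -> `|y - p i| < r.
have [i e e' He le y h|i _|e e_gt0 He] := @seq_radius R _ (enum 'I_k) Q.
- by apply: He; apply: lt_le_trans h le.
- exists (r - `|q i - p i|); first by rewrite subr_gt0.
  by move=> y; have := ler_normD (y - q i) (q i - p i); rewrite addrA subrK; lra.
by exists e => // x nx i; apply: (He i) => //; exact: mem_enum.
Qed.

(** In a chart a small neighbourhood is a cube cut by a coordinate subspace, which is convex.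
    Segments there pull back to paths in [N], and a separation of [N] would disconnect the unit
    interval. *)
Theorem submanifold_locally_connected S s (r : R) : analytic_submanifold S -> S s -> 0 < r ->
  exists N, [/\ N s, rel_open S N, connected_set N & forall x, N x -> near_pt s x r].
Proof.
move=> mS Ss r_gt0.
have [d [U [V [phi [psi [[oU oV] Us [UV VU] [[psiK phiK] [aphi apsi]] HS]]]]]] := mS s Ss.
have Vs := UV s Us.
have [r1 r1_gt0 H1] := (proj2 oV) _ Vs.
have [r2 r2_gt0 H2] := analytic_map_continuous apsi Vs r_gt0.
pose e := Num.min r1 r2; have e_gt0 : 0 < e by rewrite lt_min r1_gt0.
have HV y : near_pt (phi s) y e -> V y.
  by move=> ny; apply: H1 => //; apply: near_ptW ny _; rewrite ge_min lexx.
have Hr y : near_pt (phi s) y e -> near_pt s (psi y) r.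
  move=> ny; rewrite -{1}(psiK s Us); apply: H2; apply: near_ptW ny _.
  by rewrite ge_min lexx orbT.
pose N x := [/\ S x, U x & near_pt (phi s) (phi x) e].
exists N; split.
- by split=> // i; rewrite subrr normr0.
- split=> [q [] //|p [Sp Up np]].
  have [r3 r3_gt0 H3] := (proj2 oU) p Up; have [e4 e4_gt0 H4] := open_box np.
  have [r4 r4_gt0 H5] := analytic_map_continuous aphi Up e4_gt0.
  exists (Num.min r3 r4); first by rewrite lt_min r3_gt0.
  move=> q Sq nq; split=> //.
    by apply: H3 => //; apply: near_ptW nq _; rewrite ge_min lexx.
  by apply/H4/H5/(near_ptW nq); rewrite ge_min lexx orbT.
- move=> A B [AN oA] [BN oB] AB nAB [a Aa] [b Bb].
  have [Sa Ua na] := AN a Aa; have [Sb Ub nb] := BN b Bb.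
  pose y t i := phi a i + t * (phi b i - phi a i).
  have ny t : 0 <= t <= 1 -> near_pt (phi s) (y t) e.
    move=> /andP[t0 t1] i; have := na i; have := nb i; rewrite /y !ltr_norml.
    move=> /andP[b1 b2] /andP[a1 a2].
    have t1' : 0 <= 1 - t by rewrite subr_ge0.
    case: (leP (phi a i) (phi b i)) => [|/ltW]; rewrite -subr_ge0 => le.
      have h1 := mulr_ge0 t0 le; have h2 := mulr_ge0 t1' le.
      by apply/andP; split; lra.
    have h1 := mulr_ge0 t0 le; have h2 := mulr_ge0 t1' le.
    by apply/andP; split; lra.
  have Ny t : 0 <= t <= 1 -> N (psi (y t)).
    move=> t01; have Vy := HV _ (ny t t01); split.
    + apply/(HS _ (VU _ Vy)) => i di; rewrite phiK // /y.
      by rewrite (proj1 (HS a Ua) Sa) // (proj1 (HS b Ub) Sb) // subrr mulr0 addr0.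
    + exact: VU.
    by rewrite phiK //; exact: ny.
  have y0 : psi (y 0) = a.
    by rewrite -[RHS]psiK //; congr psi; apply: funext => i; rewrite /y mul0r addr0.
  have y1 : psi (y 1) = b.
    by rewrite -[RHS]psiK //; congr psi; apply: funext => i; rewrite /y mul1r addrC subrK.
  have op (A' : ('I_k -> R) -> Prop) : rel_open N A' -> forall t, 0 <= t <= 1 ->
      A' (psi (y t)) -> exists2 r, 0 < r &
      forall u, 0 <= u <= 1 -> `|u - t| < r -> A' (psi (y u)).
    move=> [_ oA'] t t01 At; have [r3 r3_gt0 H3] := oA' _ At.
    have [r4 r4_gt0 H4] := analytic_map_continuous apsi (HV _ (ny t t01)) r3_gt0.
    pose M := \sum_i `|phi b i - phi a i| + 1.
    have M_gt0 : 0 < M by rewrite ltr_wpDl // sumr_ge0.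
    exists (r4 / M); first exact: divr_gt0.
    move=> u u01 ut; apply: H3; first exact: Ny.
    apply: H4 => i; rewrite /y opprD addrACA subrr add0r -mulrBl normrM.
    apply: (@le_lt_trans _ _ (`|u - t| * M)); last by rewrite -ltr_pdivlMr.
    apply: ler_wpM2l => //; rewrite /M (bigD1 i) //= -addrA lerDl.
    by rewrite addr_ge0 // sumr_ge0.
  apply: (@unit_interval_connected R (fun t => A (psi (y t))) (fun t => B (psi (y t)))).
  + by move=> t /Ny/AB.
  + by move=> t _; apply: nAB.
  + exact: op.
  + exact: op.
  + by rewrite y0.
  by rewrite y1.
by move=> x [_ Ux nx]; rewrite -(psiK x Ux); apply: Hr.
Qed.
End Manifold.
(** * Projective delineability *)

Lemma nat_search (Q : nat -> Prop) : (exists n, Q n) ->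
  exists2 n, Q n & forall i, (i < n)%N -> ~ Q i.
Proof.
move=> [n Qn]; have ex : exists n, `[< Q n >] by exists n; apply/asboolP.
exists (ex_minn ex); case: ex_minnP => i /asboolP // Qi min j ji /asboolP/min.
by rewrite leqNgt ji.
Qed.

(** Reduces exact orders to conditions of order at least [n], the form in which lines and root
    tracking handle them. *)
Lemma ord_is_ge (R : realType) k (f : {mpoly R[k]}) v o : ord_is f v o <->
  (forall a : 'X_{1..k}, (mdeg a < o)%N -> (f^`M[a]).@[v] = 0) /\
  ~ (forall a : 'X_{1..k}, (mdeg a < o.+1)%N -> (f^`M[a]).@[v] = 0).
Proof.
split=> [[[a ao nz] low]|[low H]]; split=> //.
  by move=> H; case/eqP: nz; apply: H; rewrite ao.
apply: contrapT => no; apply: H => a; rewrite ltnS leq_eqVlt => /orP[/eqP ao|/low //].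
by apply/eqP; apply: contraT => nz; case: no; exists a.
Qed.

Lemma ord_exists (R : realType) k (f : {mpoly R[k]}) v : f != 0 -> exists o, ord_is f v o.
Proof.
move=> f0; have [|o [a ao nz] low] := @nat_search
    (fun o => exists2 a : 'X_{1..k}, mdeg a = o & (f^`M[a]).@[v] != 0).
  apply: contrapT => H; case/eqP: f0; apply: mpoly_eq0_vanish => x.
  pose w i := x i - v i.
  have -> : f.@[x] = (line v w f).[1].
    by rewrite line_horner; apply: meval_eq => i; rewrite mulr1 addrC subrK.
  rewrite (_ : line v w f = 0) ?horner0 //; apply/polyP => i; rewrite coef0.
  apply: (proj1 (order_ge_line v f i.+1)) => // a _; apply/eqP; apply: contraT => nz.
  by case: H; exists (mdeg a), a.
exists o; split; first by exists a.
move=> b bo; apply/eqP; apply: contraT => bnz; case: (low _ bo).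
by exists b.
Qed.

Section Delineation.
Variables (R : realType) (m : nat).
Local Notation C := (R[i] : numClosedFieldType).
Local Notation iota := (real_complex R : R -> C).
Implicit Types (P : {poly {mpoly R[m]}}) (x p : 'I_m -> R).

Lemma Fp_real (F : {poly {mpoly R[m]}}) p : Fp F p = map_poly iota (Eval p F).
Proof. by apply/polyP => i; rewrite !coef_map. Qed.

Lemma root_Fp_real (F : {poly {mpoly R[m]}}) p (a : R) :
  root (Fp F p) (iota a) = root (Eval p F) a.
Proof. by rewrite Fp_real mapf_root. Qed.

Lemma Fp_shift_real (F : {poly {mpoly R[m]}}) p (a : R) j :
  (Fp F p \Po ('X + (iota a)%:P))`_j = iota (Eval p F \Po ('X + a%:P))`_j.
Proof.
rewrite Fp_real -[RHS](coef_map (real_complex R)) map_comp_poly rmorphD /=.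
by rewrite map_polyX map_polyC.
Qed.

Lemma proj_eq_theta l z (w : R * R) : nonzero2 w ->
  proj_eq (theta l z) w <-> w.1 - l * w.2 != 0 /\ z = w.2 / (w.1 - l * w.2).
Proof.
case: w => a b; rewrite /proj_eq /nonzero2 /= => w0.
have E : ((l * z + 1) * b == a * z) = (z * (a - l * b) == b).
  by rewrite -subr_eq0 -[RHS]subr_eq0 -oppr_eq0; congr (_ == 0); ring.
split=> [/eqP|[U0 Ez]]; last by apply/eqP; rewrite E Ez divfK.
rewrite E => /eqP h; have U0 : a - l * b != 0.
  apply/eqP => U0; apply: w0; have b0 : b = 0 by rewrite -h U0 mulr0.
  by move: U0; rewrite b0 mulr0 subr0 => ->.
by split=> //; apply/eqP; rewrite -(can2_eq (mulfK U0) (divfK U0)); apply/eqP.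
Qed.

Lemma theta_continuous (N : ('I_m -> R) -> Prop) l (z : ('I_m -> R) -> R) :
  (forall p e, N p -> 0 < e -> exists2 r, 0 < r &
     forall q, N q -> near_pt p q r -> `|z q - z p| < e) ->
  proj_continuous N (fun x => theta l (z x)).
Proof.
move=> cz W [_ [_ oW]]; split=> [q []//|p [Np Wp]].
have [r r_gt0 Hr] := oW _ Wp.
have l1 : 0 < 1 + `|l| by rewrite ltr_wpDr.
have [r' r'_gt0 H] := cz p (r / (1 + `|l|)) Np (divr_gt0 r_gt0 l1).
exists r' => // q Nq nq; split=> //; have := H q Nq nq; rewrite ltr_pdivlMr // mulrDr mulr1.
have a0 := normr_ge0 (z q - z p); have b0 := mulr_ge0 a0 (normr_ge0 l).
move=> lt; apply: Hr => /=; last by lra.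
by rewrite opprD addrACA subrr addr0 -mulrBr normrM mulrC; lra.
Qed.

(** In degree 0 the form is a nonzero constant over each point of [N], so there is no section. *)
Lemma delineable_deg0 P (N : ('I_m -> R) -> Prop) : size P = 1%N ->
  (forall x, N x -> Eval x P != 0) ->
  exists k (theta : 'I_k -> ('I_m -> R) -> R * R), proj_delineable_by P N theta /\
    forall l, order_invariant_section (homogH (size P).-1 P) N (theta l).
Proof.
move=> sP HP; exists 0%N, (fun _ _ => (0, 0)); split; last by case.
split; try by case.
move=> x w Nx w0; split=> [|[[]] //]; rewrite Eval_form_meval sP /hom big_ord1 expr0.
rewrite !mulr1 => E; case/eqP: (HP x Nx); apply/polyP => i; rewrite coef0.
by case: i => [//|i]; rewrite nth_default //; apply: leq_trans (size_poly _ _) _; rewrite sP.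
Qed.

Lemma nonroot P s : Eval s P != 0 -> exists l, (P.[l%:MP]).@[s] != 0.
Proof.
move=> P0; apply: contrapT => H; case/eqP: P0.
apply: (@poly_eq0_inf _ _ (fun n => n%:R)) => [i j /eqP|n]; first by rewrite eqr_nat => /eqP.
apply/eqP; apply: contraT => nz; case: H; exists n%:R.
by rewrite -horner_map /= mevalC.
Qed.

End Delineation.

Theorem mainTheorem8 (R : realType) (m : nat)
    (S : ('I_m -> R) -> Prop) (P : {poly {mpoly R[m]}}) (D : {mpoly R[m]}) :
  analytic_submanifold S ->
  connected_set S ->
  (forall x, S x -> Eval x P != 0) ->
  is_disc P D ->
  D != 0 ->
  order_invariant D S ->
  forall s, S s ->
  exists N : ('I_m -> R) -> Prop,
    [/\ N s, rel_open S N, connected_set N &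
     exists k : nat, exists theta : 'I_k -> ('I_m -> R) -> R * R,
       proj_delineable_by P N theta /\
       forall l : 'I_k,
         order_invariant_section (homogH (size P).-1 P) N (theta l)].
Proof.
move=> mS _ P0 discD D0 invD s Ss.
case sP : (size P) => [|[|d]].
- case/eqP: (P0 s Ss); move/eqP: sP; rewrite size_poly_eq0 => /eqP ->.
  by rewrite /Eval rmorph0.
- have [N [Ns oN cN _]] := submanifold_locally_connected mS Ss ltr01.
  exists N; split=> //; rewrite -[1%N]sP; apply: delineable_deg0 => // x Nx.
  by apply: P0; case: oN => + _; apply.
have [l Pl] := nonroot (P0 s Ss).
have b0 : P.[l%:MP] != 0 by apply: contraNneq Pl => ->; rewrite meval0.
have [e De] := ord_exists s D0; have [[a0 a0e Da0] _] := De.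
have low p : S p -> forall a : 'X_{1..m}, (mdeg a < e)%N -> (D^`M[a]).@[p] = 0.
  by move=> Sp; have [_] := proj1 (invD s p Ss Sp e) De.
have evl p : (evC p P.[l%:MP] != 0) = ((P.[l%:MP]).@[p] != 0) by rewrite fmorph_eq0.
have [|v0 [r0 r0_gt0 [c0 c0_gt0 sep]]] := local_separation sP discD _ low Ss a0e Da0 (l := l).
  by rewrite evl.
have [c _ Ec] := ge0_iota (ltW c0_gt0).
have c_gt0 : 0 < c by rewrite Ec ltcR in c0_gt0.
have sF : size (Frev l P) = d.+2 by rewrite size_Frev // sP.
have [|k [zeta [mu [r [r_gt0 H]]]]] := root_tracking sF Ss r0_gt0 c_gt0 (v0 := v0).
  by rewrite lead_Frev // -Ec; exact: sep.
have rr_gt0 : 0 < Num.min r r0 by rewrite lt_min r_gt0.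
(* Inside both radii: [r] serves the root tracking, and [r0] keeps [P.[l]] from vanishing on [N]. *)
have [N [Ns [NS oN] cN Nr]] := submanifold_locally_connected mS Ss rr_gt0.
have nr x : N x -> near_pt s x r.
  by move=> /Nr nx; apply: near_ptW nx _; rewrite ge_min lexx.
have Pl0 x : N x -> (P.[l%:MP]).@[x] != 0.
  move=> Nx; have nv0 : near_pt v0 v0 r0 by move=> i; rewrite subrr normr0.
  have nx : near_pt s x r0 by apply: near_ptW (Nr x Nx) _; rewrite ge_min lexx orbT.
  by have [+ _ _] := sep x v0 (NS x Nx) nx nv0; rewrite evl.
have {}H x (Nx : N x) := H x (NS x Nx) (nr x Nx).
exists N; split=> //; rewrite -sP; exists k, (fun i x => theta l (zeta i x)); split; first split.
- by move=> i x _; apply: theta_nonzero.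
- move=> i; apply: theta_continuous => p e' Np e'_gt0.
  have [_ _ _ /(_ i e' e'_gt0)[r' r'_gt0 Hr'] _] := H p Np.
  by exists r' => // q Nq; apply: Hr'; [exact: NS|exact: nr].
- move=> x w Nx w0; rewrite (Eval_form_root w0 (Pl0 x Nx)).
  have [Hroot _ _ _ _] := H x Nx; split.
    move=> [U0]; rewrite -root_Fp_real => /Hroot[i Ei].
    by exists i; apply/(proj_eq_theta _ _ w0).
  move=> [i /(proj_eq_theta _ _ w0)[U0 Ei]]; split=> //.
  by rewrite -root_Fp_real; apply/Hroot; exists i.
- move=> i j x Nx ij /(proj_eq_theta _ _ (@theta_nonzero R l (zeta j x)))[_].
  rewrite theta_U divr1 /= => E; case/eqP: ij.
  by have [_ inj _ _ _] := H x Nx; apply: inj.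
- move=> i; exists (mu i).
    by have [_ _ /(_ i)[/andP[]]] := H s Ns.
  move=> x Nx; have [_ _ /(_ i)[/andP[mu0 mud] mlow mnz] _ _] := H x Nx.
  apply: proj_root_mult_theta => //; first by rewrite sP.
    move=> j /mlow; rewrite Fp_shift_real => /eqP; rewrite fmorph_eq0 => /eqP //.
  by move: mnz; rewrite Fp_shift_real fmorph_eq0.
move=> i x y Nx Ny o; rewrite !ord_is_ge.
(* The order along a section is compared with a condition at [s], which does not depend on the point
   of [N]. *)
have E p n : N p -> (forall a : 'X_{1..m + 2}, (mdeg a < n)%N ->
    ((homogH (size P).-1 P)^`M[a]).@[pt3 p (theta l (zeta i p)).1 (theta l (zeta i p)).2] = 0)
    <-> ordge (Frev l P) s (real_complex R (zeta i s)) n.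
  move=> Np; have [_ _ _ _ Ho] := H p Np.
  exact: iff_trans (order_ge_homogH l P p (zeta i p) n) (Ho i n).
have [x1 x2] := (E x o Nx, E x o.+1 Nx); have [y1 y2] := (E y o Ny, E y o.+1 Ny).
by split=> -[A B]; split; [apply/y1/x1|move=> /y2/x2|apply/x1/y1|move=> /x2/y2].
Qed.
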